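(* Each of the algebras $U(sl_2)$ (isomorphic to $U(so_3)$), $U_q(sl_2)$ and $U_q'(so_3)$ is a deformation of a Poisson algebra $A$ over $\mathbb{C}$, namely, respectively: (a) for $U(sl_2)$: $A=\mathbb{C}[x,y,z]$ with $\{x,y\}=2z$, $\{y,z\}=-y$, $\{z,x\}=-x$; (b) for $U_q(sl_2)$: $A=\mathbb{C}[x,y,z^{\pm1}]$ with $\{x,y\}=2(z-z^{-1})$, $\{y,z\}=2zy$, $\{z,x\}=2zx$; (c) for $U_q'(so_3)$: $A=\mathbb{C}[x,y,z]$ with $\{x,y\}=xy-2z$, $\{y,z\}=yz-2x$, $\{z,x\}=zx-2y$. These Poisson algebras $A$ are $t$-homogeneous for $t=1,2,5$, respectively. Here $t$ is, in each case, the number of Poisson maximal ideals of $A$, each of which corresponds to a singularity of a surface: each Poisson maximal ideal is the maximal ideal of $A$ at a point $(\alpha,\beta,\gamma)$ that is a singularity of the surface $f=\lambda$ with $\lambda=f(\alpha,\beta,\gamma)$, where $f$ is $z^2-xy$ in case (a), $xy+z+z^{-1}$ (with $z\neq 0$) in case (b), and $xyz-x^2-y^2-z^2+4$ in case (c). The Poisson $t$-homogeneity of these examples is due to the fact that $J/J^2\simeq sl_2$, as Lie algebras, for each Poisson maximal ideal $J$ of $A$.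
   Context: The base field is $\mathbb{C}$. A Poisson algebra is a commutative $\mathbb{C}$-algebra $A$ with a bilinear product $\{-,-\}$ making $A$ a Lie algebra and such that $\{a,-\}$ is a $\mathbb{C}$-derivation of $A$ for each $a\in A$. An ideal $I$ is a Poisson ideal if $\{i,a\}\in I$ for all $i\in I$, $a\in A$. A Poisson maximal ideal is a maximal ideal of $A$ that is also a Poisson ideal. If $J$ is a Poisson ideal then so is $J^2$, and $J/J^2$ is a Lie algebra under the bracket induced by $\{-,-\}$. A Poisson $A$-module is an $A$-module $M$ with a bilinear product $\{-,-\}_M:A\times M\to M$ such that for all $a,b\in A$, $m\in M$: (1) $\{\{a,b\},m\}_M=\{a,\{b,m\}_M\}_M-\{b,\{a,m\}_M\}_M$; (2) $\{a,bm\}_M=\{a,b\}m+b\{a,m\}_M$; (3) $\{ab,m\}_M=a\{b,m\}_M+b\{a,m\}_M$. A Poisson submodule is an $A$-submodule $N$ with $\{a,n\}_M\in N$ for all $a\in A$, $n\in N$; a nonzero Poisson module $M$ is simple if its only Poisson submodules are $0$ and $M$. Isomorphisms of Poisson modules are bijective $A$-module homomorphisms commuting with the products $\{a,-\}$. A Poisson algebra $A$ is $t$-homogeneous if, for each positive integer $d$, there are, up to isomorphism, precisely $t$ simple Poisson $A$-modules of dimension $d$ over $\mathbb{C}$. Deformation: if $T$ is a $\mathbb{C}$-algebra with a central non-unit non-zero-divisor $h$ such that $B=T/hT$ is commutative, then $B$ is a Poisson algebra with $\{\bar u,\bar v\}=\overline{h^{-1}[u,v]}$. For $\lambda\in\mathbb{C}$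 with $h-\lambda$ a non-unit of $T$, the algebra $T/(h-\lambda)T$ is called a deformation of the Poisson algebra $B$. $U(\mathfrak{g})$ is the enveloping algebra of the Lie algebra $\mathfrak{g}$. Let $q\in\mathbb{C}$ with $q\neq 0$ and $q^2\neq 1$. $U_q(sl_2)$ is the quantized enveloping algebra, generated by $E,F,K^{\pm1}$ with $KE=q^2EK$, $KF=q^{-2}FK$, $EF-FE=(K-K^{-1})/(q-q^{-1})$. $U_q'(so_3)$ is the cyclically $q$-deformed algebra, here presented (up to isomorphism) as the algebra generated by $x,y,z$ with $xy-qyx=(1-q^2)z$, $yz-qzy=(q^{-1}-q)x$, $zx-qxz=(q^{-1}-q)y$. *)

(* Defs.v *)
From HB Require Import structures.
From mathcomp Require Import all_boot all_order all_algebra.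
From mathcomp Require Import boolp classical_sets functions cardinality.
From mathcomp Require Import monalg mpoly ring.

Set Implicit Arguments.
Unset Strict Implicit.
Unset Printing Implicit Defensive.

Import GRing.Theory.
Local Open Scope ring_scope.
Local Open Scope classical_set_scope.
Local Open Scope quotient_scope.

Section Submodule.
Variables (K : fieldType) (M : lmodType K).

Record submodule := Submodule {
  submodule_set :> M -> Prop;
  submodule0 : submodule_set 0;
  submoduleP : forall (a : K) u v,
    submodule_set u -> submodule_set v -> submodule_set (a *: u + v) }.

Definition submodule_pred (N : submodule) : {pred M} := [pred u | `[< N u >]].

Lemma submodule_predE (N : submodule) u : (u \in submodule_pred N) = `[< N u >].
Proof. by []. Qed.

Fact submodule_pred_closed (N : submodule) : submod_closed (submodule_pred N).
Proof.
split=> [|a u v]; rewrite !submodule_predE.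
  exact/asboolP/submodule0.
by move=> /asboolP Nu /asboolP Nv; apply/asboolP/submoduleP.
Qed.

HB.instance Definition _ (N : submodule) :=
  GRing.isSubmodClosed.Build K M (submodule_pred N) (submodule_pred_closed N).

Definition sub_lmod (N : submodule) := {u : M | u \in submodule_pred N}.

HB.instance Definition _ N := SubChoice.on (sub_lmod N).
HB.instance Definition _ N := [SubChoice_isSubLmodule of sub_lmod N by <:].

End Submodule.

Lemma val_sub_lmodP (K : fieldType) (M : lmodType K) (N : submodule M) (a : K)
    (u v : sub_lmod N) : val (a *: u + v) = a *: val u + val v.
Proof. exact: (linearP (\val : sub_lmod N -> M)). Qed.

Lemma val_sub_lmodD (K : fieldType) (M : lmodType K) (N : submodule M)
    (u v : sub_lmod N) : val (u + v) = val u + val v.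
Proof. exact: (raddfD (\val : sub_lmod N -> M)). Qed.

Lemma val_sub_lmodB (K : fieldType) (M : lmodType K) (N : submodule M)
    (u v : sub_lmod N) : val (u - v) = val u - val v.
Proof. exact: (raddfB (\val : sub_lmod N -> M)). Qed.

Section Quotient.
Variables (K : fieldType) (M : lmodType K) (N : submodule M).

Definition quot_lmod := Quotient.quot (submodule_pred N).

HB.instance Definition _ := GRing.Zmodule.on quot_lmod.

Definition quot_pi (u : M) : quot_lmod := \pi_(Quotient.quot (submodule_pred N)) u.

Definition quot_repr (a : quot_lmod) : M := repr (a : Quotient.quot _).

Lemma quot_reprK : cancel quot_repr quot_pi.
Proof. by move=> a; rewrite /quot_pi /quot_repr reprK. Qed.

Lemma quot_piP u v : quot_pi u = quot_pi v <-> N (u - v).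
Proof.
have := Quotient.idealrBE (submodule_pred N) u v.
rewrite submodule_predE => e; split.
  by move=> h; apply/asboolP; rewrite e; apply/eqP.
by move=> h; apply/eqP; rewrite -[_ == _]e; apply/asboolP.
Qed.

Lemma quot_repr_pi u : N (quot_repr (quot_pi u) - u).
Proof. by apply/quot_piP; rewrite quot_reprK. Qed.

Lemma quot_piD u v : quot_pi (u + v) = quot_pi u + quot_pi v.
Proof. by rewrite /quot_pi raddfD. Qed.

Definition quot_scale (k : K) (a : quot_lmod) := quot_pi (k *: quot_repr a).

Lemma submoduleZ k u : N u -> N (k *: u).
Proof. by move=> Nu; rewrite -[_ *: _]addr0; apply: submoduleP => //; apply: submodule0. Qed.

Lemma quot_scaleE k u : quot_scale k (quot_pi u) = quot_pi (k *: u).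
Proof. by apply/quot_piP; rewrite -scalerBr; apply/submoduleZ/quot_repr_pi. Qed.

Fact quot_scaleA a b v : quot_scale a (quot_scale b v) = quot_scale (a * b) v.
Proof. by rewrite -[v]quot_reprK !quot_scaleE scalerA. Qed.

Fact quot_scale1 : left_id 1 quot_scale.
Proof. by move=> v; rewrite -[v]quot_reprK !quot_scaleE scale1r. Qed.

Fact quot_scaleDr : right_distributive quot_scale +%R.
Proof.
move=> a u v; rewrite -[u]quot_reprK -[v]quot_reprK.
by rewrite -quot_piD !quot_scaleE scalerDr quot_piD.
Qed.

Fact quot_scaleDl v : {morph quot_scale^~ v : a b / a + b}.
Proof. by move=> a b; rewrite /= -[v]quot_reprK !quot_scaleE scalerDl quot_piD. Qed.

HB.instance Definition _ := GRing.Zmodule_isLmodule.Build K quot_lmod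
  quot_scaleA quot_scale1 quot_scaleDr quot_scaleDl.

Fact quot_pi_linear : linear quot_pi.
Proof. by move=> a u v; rewrite quot_piD -quot_scaleE. Qed.

HB.instance Definition _ := GRing.isLinear.Build K M quot_lmod _ quot_pi quot_pi_linear.

End Quotient.

Definition is_ideal (T : nzRingType) (I : set T) : Prop :=
  [/\ I 0, forall u v, I u -> I v -> I (u + v),
      forall a u, I u -> I (a * u) & forall a u, I u -> I (u * a)].

Record proper_ideal (T : nzRingType) := ProperIdeal {
  proper_ideal_set :> T -> Prop;
  proper_idealP : is_ideal proper_ideal_set;
  proper_ideal1 : ~ proper_ideal_set 1 }.

Section AlgQuotient.
Variables (K : fieldType) (T : algType K).

Fact ideal_submoduleP (I : set T) : is_ideal I ->
  forall (a : K) u v, I u -> I v -> I (a *: u + v).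
Proof. by case=> _ iD iM _ a u v Iu Iv; apply: iD => //; rewrite -mulr_algl; apply: iM. Qed.

Fact ideal_0 (I : set T) : is_ideal I -> I 0.
Proof. by case. Qed.

Definition ideal_submodule (I : set T) (hI : is_ideal I) : submodule T :=
  @Submodule K T I (ideal_0 hI) (ideal_submoduleP hI).

Variable I : proper_ideal T.

Definition quot_alg := quot_lmod (ideal_submodule (proper_idealP I)).

HB.instance Definition _ := GRing.Lmodule.on quot_alg.

Definition alg_pi : T -> quot_alg := @quot_pi K T (ideal_submodule (proper_idealP I)).
Definition alg_repr : quot_alg -> T := @quot_repr K T (ideal_submodule (proper_idealP I)).

HB.instance Definition _ := GRing.Linear.on alg_pi.

Lemma alg_reprK : cancel alg_repr alg_pi.
Proof. exact: quot_reprK. Qed.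

Lemma alg_piP u v : alg_pi u = alg_pi v <-> I (u - v).
Proof. exact: quot_piP. Qed.

Definition quot_mul (a b : quot_alg) : quot_alg := alg_pi (alg_repr a * alg_repr b).

Lemma quot_mulE u v : quot_mul (alg_pi u) (alg_pi v) = alg_pi (u * v).
Proof.
apply/alg_piP; case: (proper_idealP I) => _ iD iM iMr.
set u' := alg_repr _; set v' := alg_repr _.
have hu : I (u' - u) by apply/alg_piP; rewrite alg_reprK.
have hv : I (v' - v) by apply/alg_piP; rewrite alg_reprK.
have -> : u' * v' - u * v = (u' - u) * v' + u * (v' - v).
  by rewrite mulrBl mulrBr addrA subrK.
by apply: iD; [apply: iMr | apply: iM].
Qed.

Fact quot_mulA : associative quot_mul.
Proof.
by move=> a b c; rewrite -[a]alg_reprK -[b]alg_reprK -[c]alg_reprK !quot_mulE mulrA.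
Qed.
Fact quot_mul1 : left_id (alg_pi 1) quot_mul.
Proof. by move=> a; rewrite -[a]alg_reprK !quot_mulE mul1r. Qed.
Fact quot_mulr1 : right_id (alg_pi 1) quot_mul.
Proof. by move=> a; rewrite -[a]alg_reprK !quot_mulE mulr1. Qed.
Fact quot_mulDl : left_distributive quot_mul +%R.
Proof.
move=> a b c; rewrite -[a]alg_reprK -[b]alg_reprK -[c]alg_reprK.
by rewrite -raddfD !quot_mulE mulrDl raddfD.
Qed.
Fact quot_mulDr : right_distributive quot_mul +%R.
Proof.
move=> a b c; rewrite -[a]alg_reprK -[b]alg_reprK -[c]alg_reprK.
by rewrite -raddfD !quot_mulE mulrDr raddfD.
Qed.
Fact quot_1neq0 : alg_pi 1 != 0.
Proof.
apply/eqP; rewrite -(raddf0 alg_pi) => /alg_piP; rewrite subr0.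
exact: proper_ideal1.
Qed.

HB.instance Definition _ := GRing.Zmodule_isNzRing.Build quot_alg
  quot_mulA quot_mul1 quot_mulr1 quot_mulDl quot_mulDr quot_1neq0.

Fact quot_scaleAl (k : K) (a b : quot_alg) : k *: (a * b) = (k *: a) * b.
Proof.
rewrite -[a]alg_reprK -[b]alg_reprK -[LHS]/(k *: quot_mul _ _).
by rewrite quot_mulE -!linearZ -[RHS]/(quot_mul _ _) quot_mulE scalerAl.
Qed.
HB.instance Definition _ := GRing.Lmodule_isLalgebra.Build K quot_alg quot_scaleAl.

Fact quot_scaleAr (k : K) (a b : quot_alg) : k *: (a * b) = a * (k *: b).
Proof.
rewrite -[a]alg_reprK -[b]alg_reprK -[LHS]/(k *: quot_mul _ _).
by rewrite quot_mulE -!linearZ -[RHS]/(quot_mul _ _) quot_mulE scalerAr.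
Qed.
HB.instance Definition _ := GRing.Lalgebra_isAlgebra.Build K quot_alg quot_scaleAr.

Fact alg_pi_monoid_morphism : monoid_morphism alg_pi.
Proof. by split=> // u v; rewrite -quot_mulE. Qed.
HB.instance Definition _ :=
  GRing.isMonoidMorphism.Build T quot_alg alg_pi alg_pi_monoid_morphism.

End AlgQuotient.

Section ComAlgQuotient.
Variables (K : fieldType) (T : comAlgType K) (I : proper_ideal T).

Fact quot_mulC : commutative (@quot_mul K T I).
Proof. by move=> a b; rewrite /quot_mul mulrC. Qed.

HB.instance Definition _ :=
  GRing.PzRing_hasCommutativeMul.Build (quot_alg I) quot_mulC.

End ComAlgQuotient.

Definition alg_iso (K : fieldType) (T U : algType K) : Prop :=
  exists f : {lrmorphism T -> U}, bijective f.

Lemma smallest_ideal_is_ideal (T : nzRingType) (S : set T) :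
  is_ideal (smallest (@is_ideal T) S).
Proof.
split=> [I [[] //]|u v hu hv I hI|a u hu I hI|a u hu I hI];
  have [hid hS] := hI; case: (hid) => _ iD iM iMr.
- by apply: iD; [apply: hu | apply: hv].
- by apply: iM; apply: hu.
- by apply: iMr; apply: hu.
Qed.

Fact smallest_ideal_proper (T S : nzRingType) (f : {rmorphism T -> S}) (R : set T) :
  (forall r, R r -> f r = 0) -> ~ smallest (@is_ideal T) R 1.
Proof.
move=> fR /(_ [set u | f u = 0]) /=; rewrite rmorph1 => h.
have /eqP : 1 = 0 :> S by apply: h; split=> //; split=> /=;
  [exact: rmorph0 | move=> u v eu ev; rewrite rmorphD eu ev addr0
  | move=> a u eu; rewrite rmorphM eu mulr0
  | move=> a u eu; rewrite rmorphM eu mul0r].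
by rewrite oner_eq0.
Qed.

(* The quotient algebra is only formed for proper ideals; a character killing
   the relations certifies properness. *)
Definition rel_ideal (T S : nzRingType) (R : set T) (f : {rmorphism T -> S})
    (fR : forall r, R r -> f r = 0) : proper_ideal T :=
  ProperIdeal (smallest_ideal_is_ideal R) (smallest_ideal_proper fR).

Section FreeAlgebra.
Variables (K : fieldType) (I : choiceType).

Definition free_alg := {malg K[{fmonom I}]}.

HB.instance Definition _ := GRing.Lalgebra.on free_alg.

Fact free_scaleAr (k : K) (a b : free_alg) : k *: (a * b) = a * (k *: b).
Proof.
rewrite /free_alg in a b *.
have cK (g : {malg K[{fmonom I}]}) : malgC k * g = g * malgC k.
  rewrite !malgM_def fgmulUg fgmulgU; apply: eq_bigr => m _.
  by rewrite mul1m mulm1 mulrC.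
by rewrite -!mul_malgC mulrA cK -mulrA.
Qed.

HB.instance Definition _ := GRing.Lalgebra_isAlgebra.Build K free_alg free_scaleAr.

Definition free_gen (i : I) : free_alg := << fmu i >>.

Variable c : I -> K.

Definition word_eval (m : {fmonom I}) : K := \prod_(i <- (m : seq I)) c i.

Fact word_eval_mmorphism : mmorphism word_eval.
Proof.
split; last by rewrite /word_eval /one /= fmoneE /= big_nil.
by move=> m n; rewrite /word_eval /mul /= fmmulE /= big_cat.
Qed.
HB.instance Definition _ :=
  isMultiplicative.Build {fmonom I} K word_eval word_eval_mmorphism.

Definition free_char : free_alg -> K := monalg.mmap idfun word_eval.
HB.instance Definition _ := GRing.RMorphism.on free_char.

Lemma free_char_gen i : free_char (free_gen i) = c i.
Proof.
by rewrite /free_char /free_gen monalg.mmapU mul1r /word_eval fmuE /= big_seq1.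
Qed.

Lemma free_char1 : free_char 1 = 1.
Proof. exact: rmorph1. Qed.

Lemma free_charD u v : free_char (u + v) = free_char u + free_char v.
Proof. exact: rmorphD. Qed.

Lemma free_charN u : free_char (- u) = - free_char u.
Proof. exact: rmorphN. Qed.

Lemma free_charM u v : free_char (u * v) = free_char u * free_char v.
Proof. exact: rmorphM. Qed.

Lemma free_charZ k u : free_char (k *: u) = k * free_char u.
Proof. exact: monalg.mmapZ. Qed.

Definition free_charE :=
  (free_charN, free_charD, free_charM, free_charZ, free_char_gen).

End FreeAlgebra.

Record lie_algebra (K : fieldType) := LieAlgebra {
  lie_car :> lmodType K;
  lie_br : lie_car -> lie_car -> lie_car;
  lie_linear_l : forall y, linear (lie_br^~ y);
  lie_linear_r : forall x, linear (lie_br x);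
  lie_alternating : forall x, lie_br x x = 0;
  lie_jacobi : forall x y z,
    lie_br x (lie_br y z) + lie_br y (lie_br z x) + lie_br z (lie_br x y) = 0 }.

Definition lie_iso (K : fieldType) (L L' : lie_algebra K) : Prop :=
  exists2 f : {linear L -> L'}, bijective f &
    forall x y, f (lie_br x y) = lie_br (f x) (f y).

Section MatrixLie.
Variables (K : fieldType) (n : nat).

Definition mx_commutator (A B : 'M[K]_n) := A *m B - B *m A.

Variable N : submodule 'M[K]_n.
Hypothesis N_closed : forall A B, N A -> N B -> N (mx_commutator A B).

Fact matrix_lie_subproof (A B : sub_lmod N) :
  mx_commutator (val A) (val B) \in submodule_pred N.
Proof.
by rewrite submodule_predE; apply/asboolP/N_closed; apply/asboolP;
  rewrite -submodule_predE; apply: valP.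
Qed.

Definition matrix_lie_br (A B : sub_lmod N) : sub_lmod N :=
  Sub (mx_commutator (val A) (val B)) (matrix_lie_subproof A B).

Lemma mx_commutator_linear_l B : linear (mx_commutator^~ B).
Proof.
move=> a u v; rewrite /mx_commutator mulmxDl mulmxDr -scalemxAl -scalemxAr.
by rewrite scalerBr opprD addrACA.
Qed.

Lemma mx_commutator_linear_r B : linear (mx_commutator B).
Proof.
move=> a u v; rewrite /mx_commutator mulmxDl mulmxDr -scalemxAl -scalemxAr.
by rewrite scalerBr opprD addrACA.
Qed.

Lemma mx_commutator_jacobi A B C :
  mx_commutator A (mx_commutator B C) + mx_commutator B (mx_commutator C A)
    + mx_commutator C (mx_commutator A B) = 0.
Proof.
rewrite /mx_commutator !mulmxBl !mulmxBr !mulmxA.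
move: (A *m B *m C) (A *m C *m B) (B *m C *m A) (C *m B *m A) (B *m A *m C)
  (C *m A *m B) => a b c d e f.
by apply/matrixP => i j; rewrite !mxE; ring.
Qed.

Fact matrix_lie_linear_l B : linear (matrix_lie_br^~ B).
Proof.
move=> a u v; apply: val_inj; rewrite val_sub_lmodP.
by rewrite -[LHS]/(mx_commutator (val _) (val _)) val_sub_lmodP mx_commutator_linear_l.
Qed.

Fact matrix_lie_linear_r B : linear (matrix_lie_br B).
Proof.
move=> a u v; apply: val_inj; rewrite val_sub_lmodP.
by rewrite -[LHS]/(mx_commutator (val _) (val _)) val_sub_lmodP mx_commutator_linear_r.
Qed.

Fact matrix_lie_alternating A : matrix_lie_br A A = 0.
Proof. by apply: val_inj; rewrite /= /mx_commutator subrr. Qed.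

Fact matrix_lie_jacobi A B C :
  matrix_lie_br A (matrix_lie_br B C) + matrix_lie_br B (matrix_lie_br C A)
    + matrix_lie_br C (matrix_lie_br A B) = 0.
Proof. by apply: val_inj; rewrite !val_sub_lmodD mx_commutator_jacobi. Qed.

Definition matrix_lie : lie_algebra K :=
  LieAlgebra matrix_lie_linear_l matrix_lie_linear_r matrix_lie_alternating
    matrix_lie_jacobi.

End MatrixLie.

Section SlSo.
Variables (K : fieldType) (n : nat).

Fact sl_submoduleP (a : K) (A B : 'M[K]_n) :
  \tr A = 0 -> \tr B = 0 -> \tr (a *: A + B) = 0.
Proof. by move=> hA hB; rewrite linearP /= hA hB mulr0 addr0. Qed.

Definition sl_submodule : submodule 'M[K]_n :=
  @Submodule K 'M[K]_n (fun A => \tr A = 0) (mxtrace0 _ _) sl_submoduleP.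

Fact sl_closed (A B : 'M[K]_n) :
  sl_submodule A -> sl_submodule B -> sl_submodule (mx_commutator A B).
Proof. by move=> _ _; rewrite /= raddfB /= mxtrace_mulC subrr. Qed.

Definition sl : lie_algebra K := matrix_lie sl_closed.

Fact so_submoduleP (a : K) (A B : 'M[K]_n) :
  A^T = - A -> B^T = - B -> (a *: A + B)^T = - (a *: A + B).
Proof. by move=> hA hB; rewrite linearP /= hA hB scalerN opprD. Qed.

Fact so_submodule0 : (0 : 'M[K]_n)^T = - 0.
Proof. by rewrite trmx0 oppr0. Qed.

Definition so_submodule : submodule 'M[K]_n :=
  @Submodule K 'M[K]_n (fun A => A^T = - A) so_submodule0 so_submoduleP.

Fact so_closed (A B : 'M[K]_n) :
  so_submodule A -> so_submodule B -> so_submodule (mx_commutator A B).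
Proof.
move=> /= hA hB; rewrite /mx_commutator linearB /= !trmx_mul hA hB.
by rewrite !mulmxN !mulNmx !opprK opprB.
Qed.

Definition so : lie_algebra K := matrix_lie so_closed.

End SlSo.

Section Enveloping.
Variables (K : fieldType) (L : lie_algebra K).

(* The first family of relations turns the free algebra on the underlying set
   of L into the tensor algebra. *)
Let X (u : L) : free_alg K L := free_gen K u.

Definition env_rel : set (free_alg K L) :=
  [set r | (exists a u v, r = X (a *: u + v) - (a *: X u + X v)) \/
           (exists u v, r = X (lie_br u v) - (X u * X v - X v * X u))].

Fact env_rel_char r : env_rel r -> free_char (fun _ : L => 0 : K) r = 0.
Proof.
by case=> [[a [u [v ->]]]|[u [v ->]]]; rewrite /X !free_charE; ring.
Qed.

Definition env_alg : algType K := quot_alg (rel_ideal env_rel_char).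

End Enveloping.

Section Quantum.
Variables (K : fieldType) (q : K).

(* The generators of index 0, 1, 2, 3 are E, F, K and the inverse of K. *)
Definition uq_rel : set (free_alg K 'I_4) :=
  let E := free_gen K (0 : 'I_4) in let F := free_gen K (1 : 'I_4) in
  let k := free_gen K (2 : 'I_4) in let k' := free_gen K (3 : 'I_4) in
  [set` [:: k * k' - 1; k' * k - 1;
            k * E - q ^+ 2 *: (E * k); k * F - q ^- 2 *: (F * k);
            E * F - F * E - (q - q^-1)^-1 *: (k - k')]].

Fact uq_rel_char r : uq_rel r ->
  free_char (fun i : 'I_4 => ((1 < i)%N)%:R : K) r = 0.
Proof.
rewrite /uq_rel /= !inE => /orP[|/orP[|/orP[|/orP[|]]]] /eqP ->;
  by rewrite !free_charE ?free_char1 /=; ring.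
Qed.

Definition uq_sl2 : algType K := quot_alg (rel_ideal uq_rel_char).

Definition uq'_rel : set (free_alg K 'I_3) :=
  let x := free_gen K (0 : 'I_3) in let y := free_gen K (1 : 'I_3) in
  let z := free_gen K (2 : 'I_3) in
  [set` [:: x * y - q *: (y * x) - (1 - q ^+ 2) *: z;
            y * z - q *: (z * y) - (q^-1 - q) *: x;
            z * x - q *: (x * z) - (q^-1 - q) *: y]].

Fact uq'_rel_char r : uq'_rel r -> free_char (fun _ : 'I_3 => 0 : K) r = 0.
Proof.
set e := free_char _.
have relE i j k (a b : K) : e (free_gen K i * free_gen K j -
    a *: (free_gen K j * free_gen K i) - b *: free_gen K k) = 0.
  rewrite /e [LHS]free_charD [X in X + _]free_charD [X in X + _ + _]free_charM.
  rewrite [X in _ + X]free_charN [X in _ + X + _]free_charN.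
  rewrite [X in _ - X]free_charZ [X in _ - X - _]free_charZ !free_char_gen.
  by rewrite [X in a * X]free_charM !free_char_gen; ring.
rewrite /uq'_rel /= !inE => /orP[|/orP[|]] /eqP ->; exact: relE.
Qed.

Definition uq'_so3 : algType K := quot_alg (rel_ideal uq'_rel_char).

End Quantum.

Record poisson (K : fieldType) (A : comAlgType K) := Poisson {
  poisson_br :> A -> A -> A;
  poisson_linear_l : forall b, linear (poisson_br^~ b);
  poisson_linear_r : forall a, linear (poisson_br a);
  poisson_alternating : forall a, poisson_br a a = 0;
  poisson_jacobi : forall a b c,
    poisson_br a (poisson_br b c) + poisson_br b (poisson_br c a)
      + poisson_br c (poisson_br a b) = 0;
  poisson_leibniz : forall a b c,
    poisson_br a (b * c) = poisson_br a b * c + b * poisson_br a c }.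

Section PoissonIdeals.
Variables (K : fieldType) (A : comAlgType K) (P : poisson A).
Implicit Type J : set A.

Definition is_poisson_ideal J : Prop :=
  is_ideal J /\ forall i a, J i -> J (P i a).

Definition is_maximal_ideal J : Prop :=
  [/\ is_ideal J, ~ J 1 &
      forall I, is_ideal I -> J `<=` I -> I = J \/ I = setT].

Definition is_poisson_maximal J : Prop :=
  is_maximal_ideal J /\ is_poisson_ideal J.

Definition ideal_square J : set A :=
  smallest (@is_ideal A) [set i * j | i in J & j in J].

End PoissonIdeals.

Section Cotangent.
Variables (K : fieldType) (A : comAlgType K) (P : poisson A) (J : set A).
Hypothesis hJ : is_poisson_ideal P J.

Lemma poissonC a b : P a b = - P b a.
Proof.
have := poisson_alternating P (a + b).
have lD c u v : P c (u + v) = P c u + P c v.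
  by have := poisson_linear_r P c 1 u v; rewrite !scale1r.
have rD c u v : P (u + v) c = P u c + P v c.
  by have /= := poisson_linear_l P c 1 u v; rewrite !scale1r.
rewrite lD !rD !poisson_alternating add0r addr0 addrC => /eqP.
by rewrite addr_eq0 => /eqP.
Qed.

Let jI : is_ideal J := hJ.1.
Let J_lmod := ideal_submodule jI.

Fact cotangent_submodule0 : ideal_square J (val (0 : sub_lmod J_lmod)).
Proof. by case: (smallest_ideal_is_ideal [set i * j | i in J & j in J]). Qed.

Fact cotangent_submoduleP (a : K) (u v : sub_lmod J_lmod) :
  ideal_square J (val u) -> ideal_square J (val v) ->
  ideal_square J (val (a *: u + v)).
Proof.
rewrite val_sub_lmodP; apply: ideal_submoduleP; exact: smallest_ideal_is_ideal.
Qed.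

Definition cotangent_submodule : submodule (sub_lmod J_lmod) :=
  @Submodule K (sub_lmod J_lmod) (fun u => ideal_square J (val u))
    cotangent_submodule0 cotangent_submoduleP.

Definition cotangent := quot_lmod cotangent_submodule.
HB.instance Definition _ := GRing.Lmodule.on cotangent.

Lemma sub_lmodP (u : sub_lmod J_lmod) : J (val u).
Proof. by have := valP u; rewrite submodule_predE => /asboolP. Qed.

Fact ideal_br_subproof (u v : sub_lmod J_lmod) :
  P (val u) (val v) \in submodule_pred J_lmod.
Proof. by rewrite submodule_predE; apply/asboolP/hJ.2/sub_lmodP. Qed.

Definition ideal_br (u v : sub_lmod J_lmod) : sub_lmod J_lmod :=
  Sub (P (val u) (val v)) (ideal_br_subproof u v).

Definition cotangent_br (a b : cotangent) : cotangent :=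
  quot_pi cotangent_submodule (ideal_br (quot_repr a) (quot_repr b)).

Lemma ideal_square_br u c : ideal_square J u -> J c -> ideal_square J (P u c).
Proof.
set S := [set i * j | i in J & j in J] => hu Jc.
have [s0 sD sM sMr] : is_ideal (ideal_square J) := smallest_ideal_is_ideal S.
have [J0 JD JM JMr] := jI.
have lD u1 u2 : P (u1 + u2) c = P u1 c + P u2 c.
  by have /= := poisson_linear_l P c 1 u1 u2; rewrite !scale1r.
have l0 : P 0 c = 0.
  by have /eqP := lD 0 0; rewrite addr0 -subr_eq subrr eq_sym => /eqP.
have lM u1 u2 : P (u1 * u2) c = u1 * P u2 c + u2 * P u1 c.
  by rewrite (poissonC (u1 * u2)) (poissonC u1) (poissonC u2) poisson_leibniz; ring.
have idS : is_ideal [set v | ideal_square J v /\ ideal_square J (P v c)].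
  split=> /=.
  - by rewrite l0.
  - by move=> v w [? ?] [? ?]; split; [apply: sD | rewrite lD; apply: sD].
  - move=> a v [? ?]; split; first exact: sM.
    by rewrite lM; apply: sD; [apply: sM | apply: sMr].
  - move=> a v [? ?]; split; first exact: sMr.
    by rewrite mulrC lM; apply: sD; [apply: sM | apply: sMr].
have sub : S `<=` [set v | ideal_square J v /\ ideal_square J (P v c)].
  move=> _ [i Ji] [j Jj <-] /=.
  have gen a b : J a -> J b -> ideal_square J (a * b).
    by move=> Ja Jb I [_]; apply; exists a => //; exists b.
  split; first exact: gen.
  rewrite lM; apply: sD; apply: gen => //.
    exact: hJ.2.
  exact: hJ.2.
by have [] := hu _ (conj idS sub).
Qed.

Lemma cotangent_brE u v :
  cotangent_br (quot_pi _ u) (quot_pi _ v) = quot_pi _ (ideal_br u v).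
Proof.
apply/quot_piP.
rewrite -[submodule_set _ _]/(ideal_square J (val (_ - _))) val_sub_lmodB.
set u' := quot_repr _; set v' := quot_repr _.
have hu : ideal_square J (val (u' - u)) by apply: (quot_repr_pi cotangent_submodule).
have hv : ideal_square J (val (v' - v)) by apply: (quot_repr_pi cotangent_submodule).
have [_ sD sM _] := smallest_ideal_is_ideal [set i * j | i in J & j in J].
have lB c a b : P (a - b) c = P a c - P b c.
  by rewrite addrC -scaleN1r [LHS]poisson_linear_l scaleN1r addrC.
have -> : P (val u') (val v') - P (val u) (val v) =
  P (val (u' - u)) (val v') - P (val (v' - v)) (val u).
  by rewrite !val_sub_lmodB !lB (poissonC (val v')) (poissonC (val v)); ring.
apply: sD; first exact: ideal_square_br hu (sub_lmodP _).
by rewrite -mulN1r; apply: sM; apply: ideal_square_br hv (sub_lmodP _).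
Qed.

Let reprK := @quot_reprK K _ cotangent_submodule.

Fact cotangent_linear_l b : linear (cotangent_br^~ b).
Proof.
move=> k u v; rewrite -[u]reprK -[v]reprK -[b]reprK -linearP !cotangent_brE -linearP.
congr quot_pi; apply: val_inj; rewrite val_sub_lmodP.
by rewrite -[LHS]/(P (val _) (val _)) val_sub_lmodP poisson_linear_l.
Qed.

Fact cotangent_linear_r b : linear (cotangent_br b).
Proof.
move=> k u v; rewrite -[u]reprK -[v]reprK -[b]reprK -linearP !cotangent_brE -linearP.
congr quot_pi; apply: val_inj; rewrite val_sub_lmodP.
by rewrite -[LHS]/(P (val _) (val _)) val_sub_lmodP poisson_linear_r.
Qed.

Fact cotangent_alternating a : cotangent_br a a = 0.
Proof.
rewrite -[a]reprK cotangent_brE -(raddf0 (quot_pi _)); congr quot_pi.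
by apply: val_inj; rewrite /= poisson_alternating.
Qed.

Fact cotangent_jacobi a b c :
  cotangent_br a (cotangent_br b c) + cotangent_br b (cotangent_br c a)
    + cotangent_br c (cotangent_br a b) = 0.
Proof.
rewrite -[a]reprK -[b]reprK -[c]reprK !cotangent_brE -!raddfD /=.
rewrite -(raddf0 (quot_pi _)); congr quot_pi.
by apply: val_inj; rewrite !val_sub_lmodD poisson_jacobi.
Qed.

(* J / J^2 with the bracket induced by {-,-}. *)
Definition cotangent_lie : lie_algebra K :=
  LieAlgebra cotangent_linear_l cotangent_linear_r cotangent_alternating
    cotangent_jacobi.

End Cotangent.

Section PoissonModules.
Variables (K : fieldType) (A : comAlgType K) (P : poisson A).

(* The K-space structure of an A-module is the carrier's; [pm_act_scale] says
   that it is the one obtained by restriction of scalars. *)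
Record poisson_module := PoissonModule {
  pm_car :> lmodType K;
  pm_act : A -> pm_car -> pm_car;
  pm_act1 : forall m, pm_act 1 m = m;
  pm_actM : forall a b m, pm_act (a * b) m = pm_act a (pm_act b m);
  pm_actDl : forall a b m, pm_act (a + b) m = pm_act a m + pm_act b m;
  pm_actDr : forall a m n, pm_act a (m + n) = pm_act a m + pm_act a n;
  pm_act_scale : forall (k : K) m, pm_act (k%:A) m = k *: m;
  pm_br : A -> pm_car -> pm_car;
  pm_br_linear_l : forall m, linear (pm_br^~ m);
  pm_br_linear_r : forall a, linear (pm_br a);
  pm_br_lie : forall a b m,
    pm_br (P a b) m = pm_br a (pm_br b m) - pm_br b (pm_br a m);
  pm_br_act : forall a b m,
    pm_br a (pm_act b m) = pm_act (P a b) m + pm_act b (pm_br a m);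
  pm_br_mul : forall a b m,
    pm_br (a * b) m = pm_act a (pm_br b m) + pm_act b (pm_br a m) }.

Definition poisson_submodule (M : poisson_module) (N : set M) : Prop :=
  [/\ N 0, forall m n, N m -> N n -> N (m + n),
      forall a m, N m -> N (pm_act a m) & forall a m, N m -> N (pm_br a m)].

Definition simple_poisson_module (M : poisson_module) : Prop :=
  (exists m : M, m <> 0) /\
  forall N : set M, poisson_submodule N -> N = [set 0] \/ N = setT.

Definition poisson_module_iso (M N : poisson_module) : Prop :=
  exists f : {linear M -> N}, [/\ bijective f,
    forall a m, f (pm_act a m) = pm_act a (f m) &
    forall a m, f (pm_br a m) = pm_br a (f m)].

Definition has_dim (M : lmodType K) (d : nat) : Prop :=
  exists f : {linear 'rV[K]_d -> M}, bijective f.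

Definition homogeneous (t : nat) : Prop :=
  forall d : nat, (0 < d)%N ->
  exists S : 'I_t -> poisson_module,
    [/\ forall i, simple_poisson_module (S i) /\ has_dim (S i) d,
        forall i j, poisson_module_iso (S i) (S j) -> i = j &
        forall M : poisson_module, simple_poisson_module M -> has_dim M d ->
          exists i, poisson_module_iso M (S i)].

End PoissonModules.

Section Deformation.
Variables (K : fieldType) (T : algType K).

Definition is_unit (u : T) : Prop := exists v, u * v = 1 /\ v * u = 1.

Definition is_central (h : T) : Prop := forall u, h * u = u * h.

Fact principal_is_ideal h : is_central h -> is_ideal [set h * u | u in setT].
Proof.
move=> hc; split.
- by exists 0; rewrite ?mulr0.
- by move=> _ _ [u _ <-] [v _ <-]; exists (u + v); rewrite ?mulrDr.
- by move=> a _ [u _ <-]; exists (a * u); rewrite // !mulrA hc.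
- by move=> a _ [u _ <-]; exists (u * a); rewrite // mulrA.
Qed.

Fact principal_proper h : is_central h -> ~ is_unit h -> ~ [set h * u | u in setT] 1.
Proof. by move=> hc hu [v _ hv]; apply: hu; exists v; rewrite -hc. Qed.

Definition principal_ideal h (hc : is_central h) (hu : ~ is_unit h) :
  proper_ideal T := ProperIdeal (principal_is_ideal hc) (principal_proper hc hu).

Fact is_central_shift h (k : K) : is_central h -> is_central (h - k%:A).
Proof. by move=> hc u; rewrite mulrBl mulrBr hc mulr_algl mulr_algr. Qed.

End Deformation.

(* U is T/(h - lam)T for some T and h such that the Poisson algebra T/hT is
   isomorphic to A; the bracket of T/hT is h^-1[u,v], that is, the class of the
   w with [u,v] = hw. *)
Definition is_deformation (K : fieldType) (A : comAlgType K) (P : poisson A)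
    (U : algType K) : Prop :=
  exists (T : algType K) (h : T) (hc : is_central h) (hu : ~ is_unit h),
  [/\ forall u, h * u = 0 -> u = 0,
      forall a b : quot_alg (principal_ideal hc hu), a * b = b * a,
      exists2 f : {lrmorphism quot_alg (principal_ideal hc hu) -> A}, bijective f &
        forall u v w : T, u * v - v * u = h * w ->
          f (alg_pi _ w) = P (f (alg_pi _ u)) (f (alg_pi _ v)) &
      exists (lam : K) (hlu : ~ is_unit (h - lam%:A)),
        alg_iso U (quot_alg (principal_ideal (is_central_shift lam hc) hlu))].

Section Points.
Variables (K : fieldType) (A : comAlgType K).

Definition is_derivation (D : {linear A -> A}) : Prop :=
  forall a b, D (a * b) = D a * b + a * D b.

(* The partial derivative with respect to the first of three coordinates. *)
Definition is_partial (D : {linear A -> A}) (x y z : A) : Prop :=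
  [/\ is_derivation D, D x = 1, D y = 0 & D z = 0].

(* [ev] is the evaluation at a point p and x, y, z are the coordinates of the
   ambient space: p is a singularity of the surface f = lam. *)
Definition is_singularity (x y z : A) (ev : {lrmorphism A -> K | *%R})
    (f : A) (lam : K) : Prop :=
  [/\ ev f = lam,
      exists2 D, is_partial D x y z & ev (D f) = 0,
      exists2 D, is_partial D y x z & ev (D f) = 0 &
      exists2 D, is_partial D z x y & ev (D f) = 0].

End Points.

Section Coordinates.
Variable K : fieldType.

Definition mvar (n : nat) (i : 'I_n) : mpoly n K := 'X_i.

Definition laurent_rel : set (mpoly 4 K) := [set @mvar 4 2 * @mvar 4 3 - 1].

Fact laurent_rel_char r : laurent_rel r -> meval (fun _ => 1 : K) r = 0.
Proof.
by move=> ->; rewrite mevalB mevalM meval1 /mvar !mevalXU mulr1 subrr.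
Qed.

(* K[x, y, z, z^-1] as K[x, y, z, w] / (z w - 1). *)
Definition laurent3 : comAlgType K := quot_alg (rel_ideal laurent_rel_char).

Definition lvar (i : 'I_4) : laurent3 := alg_pi _ (mvar i).

End Coordinates.

(* The bracket {-,-} of A = K[x, y, z] or K[x, y, z^+-1] is the one with the
   prescribed values on the generators; since it is a biderivation these values
   determine it, and its existence is part of the claim. *)
Definition homogeneous_deformation (K : fieldType) (A : comAlgType K)
    (x y z : A) (bxy byz bzx : A) (f : A) (U : algType K) (t : nat) : Prop :=
  let bracket (P : poisson A) := [/\ P x y = bxy, P y z = byz & P z x = bzx] in
  (exists P : poisson A, bracket P) /\
  forall P : poisson A, bracket P ->
    [/\ is_deformation P U,
        homogeneous P t,
        ([set J : set A | is_poisson_maximal P J] #= `I_t)%card,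
        forall J : set A, is_poisson_maximal P J ->
          exists (alpha beta gamma : K) (ev : {lrmorphism A -> K | *%R}),
            [/\ ev x = alpha, ev y = beta, ev z = gamma,
                J = [set a | ev a = 0] &
                is_singularity x y z ev f (ev f)] &
        forall (J : set A) (hJ : is_poisson_ideal P J), is_maximal_ideal J ->
          lie_iso (cotangent_lie hJ) (sl K 2)].

(* Main.v *)
Require Import Defs.
From HB Require Import structures.
From mathcomp Require Import all_boot all_order all_algebra.
From mathcomp Require Import boolp classical_sets functions cardinality reals.
From mathcomp Require Import complex.
From mathcomp Require Import finmap monalg mpoly.
From mathcomp Require Import ring lra.

(* Each algebra T = T_h is presented by generators and relations over K with a
   central h (or a central invertible Q, the h being a multiple of Q - 1).  The
   universal properties identify T/hT with A and T/(h - lam)T with the deformed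
   algebra; that h is not a zero divisor follows from a PBW basis, obtained by
   letting T act on a free module on the ordered monomials and splitting the
   orbit map of the empty monomial.

   At a singular point p of the surface the differential at p, composed with a
   linear identification of the cotangent space with sl_2, is an isomorphism
   J/J^2 -> sl_2 of Lie algebras.  A finite dimensional simple Poisson module M
   has a common eigenvector for the action of A; the corresponding maximal ideal
   J is a Poisson ideal because j^N M = 0 and j^(N-1) M <> 0 give
   N j^(N-1) {b, j} M = 0, and the elements of M killed by J form a Poisson
   submodule, whence JM = 0.  Then J^2 brackets trivially with M, and M is a
   simple J/J^2-module, that is, the unique simple sl_2-module of its dimension.
   The points p are exactly the zeros of the brackets of the generators; that
   every maximal ideal is a point follows from the uncountability of K, as A has
   countable dimension and the inverses of a - c, c in K, would be independent. *)

Set Implicit Arguments.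
Unset Strict Implicit.
Unset Printing Implicit Defensive.

Import Order.TTheory GRing.Theory Num.Theory.
Local Open Scope ring_scope.

(** * Generators, relations and deformations *)

(** In all three cases the vector field v formed by the brackets of the generators is g grad f, with
    g = 1 in (a) and (c) and g = 2 z, a unit, in (b). Three things follow. The Jacobi identity
    holds, since curl v = grad g x grad f is orthogonal to v. The common zeros of the brackets are
    the critical points of f, whence the singularities. At such a point p the bracket of J/J^2 is
    governed by g(p) times the Hessian of f, which is nondegenerate at each of the points; rather
    than quoting that this forces sl_2, the proof exhibits matrices m1, m2, m3 that satisfy the
    linearized brackets.

    On the deformation side the obstacle is the regularity of h, which cannot be read off a
    presentation: an action respecting the relations has to be written down. For U'_q(so_3) the
    expansion of z x^i in ordinary monomials has a growing number of terms, while z acts on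
    q-Hermite polynomials in x with two terms, which is why they replace the powers of x. The
    algebras T, A and U enter there only through generators, relations and universal properties. *)

Section Generation.
Variables (K : fieldType) (T : algType K).

Definition is_subalg (S : set T) : Prop :=
  [/\ forall k : K, S k%:A, forall u v, S u -> S v -> S (u + v) &
      forall u v, S u -> S v -> S (u * v)].

(** Phrased as an induction principle: equality of morphisms, centrality and divisibility of
    commutators are each proved by checking that a property defines a subalgebra. *)
Definition generates (I : Type) (t : I -> T) : Prop :=
  forall S, is_subalg S -> (forall i, S (t i)) -> forall u, S u.

Lemma is_subalgZ S (k : K) u : is_subalg S -> S u -> S (k *: u).
Proof. by case=> Sk _ SM Su; rewrite -mulr_algl; apply: SM. Qed.

Lemma is_subalg1 S : is_subalg S -> S 1.
Proof. by case=> Sk _ _; rewrite -[1](scale1r (1 : T)). Qed.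

Lemma is_subalg0 S : is_subalg S -> S 0.
Proof. by case=> Sk _ _; rewrite -(scale0r (1 : T)). Qed.

Lemma is_subalg_sum S (J : Type) (r : seq J) (F : J -> T) :
  is_subalg S -> (forall i, S (F i)) -> S (\sum_(i <- r) F i).
Proof.
move=> hS SF; elim: r => [|i r IH]; first by rewrite big_nil; apply: is_subalg0.
by rewrite big_cons; case: (hS) => _ SD _; apply: SD.
Qed.

Lemma is_subalg_prod S (J : Type) (r : seq J) (F : J -> T) :
  is_subalg S -> (forall i, S (F i)) -> S (\prod_(i <- r) F i).
Proof.
move=> hS SF; elim: r => [|i r IH]; first by rewrite big_nil; apply: is_subalg1.
by rewrite big_cons; case: (hS) => _ _ SM; apply: SM.
Qed.

Lemma lrmorph_eq_on_generators (U : algType K) (f g : {lrmorphism T -> U})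
    (I : Type) (t : I -> T) :
  generates t -> (forall i, f (t i) = g (t i)) -> f =1 g.
Proof.
move=> gt e u; apply: (gt (fun u => f u = g u)) => //; split.
- by move=> k; rewrite !linearZ /= !rmorph1.
- by move=> a b /= ea eb; rewrite !raddfD /= ea eb.
- by move=> a b /= ea eb; rewrite !rmorphM /= ea eb.
Qed.

Lemma generatesW (I I' : Type) (t : I -> T) (t' : I' -> T) :
  (forall S, is_subalg S -> (forall i, S (t' i)) -> forall i, S (t i)) ->
  generates t -> generates t'.
Proof. by move=> h gt S hS St'; apply: gt => //; apply: h. Qed.

End Generation.

Section FreeLift.
Variables (K : fieldType) (I : choiceType).

Lemma generates_free_gen : generates (@free_gen K I).
Proof.
move=> S hS Sgen u.
have SU (m : {fmonom I}) : S (<< m >> : {malg K[{fmonom I}]}).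
  have -> : (<< m >> : {malg K[{fmonom I}]}) =
      \prod_(i <- (m : seq I)) free_gen K i :> free_alg K I.
    case: m => s; elim: s => [|i s IH]; first by rewrite big_nil -fmoneE.
    rewrite big_cons -IH.
    have -> : FMonom (i :: s) = mul (fmu i) (FMonom s) by rewrite /mul /= fmmulE fmuE.
    by rewrite /free_gen [RHS]malgM_def fgmulUU mulr1.
  exact: is_subalg_prod.
have -> : u = \sum_(m <- monalg.msupp u) (monalg.mcoeff m u *: (<< m >> : free_alg K I)).
  rewrite [LHS](monalg.monalgE u); apply: eq_bigr => m _.
  apply/monalg.malgP => n; rewrite monalg.mcoeffZ !monalg.mcoeffU.
  by case: eqP => _; rewrite ?mulr1n ?mulr1 ?mulr0n ?mulr0.
by apply: is_subalg_sum => // m; apply: is_subalgZ.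
Qed.

Variables (S : algType K) (c : I -> S).

Definition word_lift (m : {fmonom I}) : S := \prod_(i <- (m : seq I)) c i.

Fact word_lift_mmorphism : mmorphism word_lift.
Proof.
split; last by rewrite /word_lift /one /= fmoneE /= big_nil.
by move=> m n; rewrite /word_lift /mul /= fmmulE /= big_cat.
Qed.
HB.instance Definition _ :=
  isMultiplicative.Build {fmonom I} S word_lift word_lift_mmorphism.

Definition free_lift (u : free_alg K I) : S :=
  monalg.mmap (GRing.in_alg S) word_lift u.

Fact free_lift_additive : additive free_lift.
Proof. by move=> u v; rewrite /free_lift monalg.mmapB. Qed.
HB.instance Definition _ :=
  GRing.isAdditive.Build (free_alg K I) S free_lift free_lift_additive.

Fact free_lift_multiplicative : monoid_morphism free_lift.
Proof.
suff [hM h1] : MMorphism.axiom (free_lift : {malg K[{fmonom I}]} -> S).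
  by split=> // u v; apply: hM.
apply: monalg.commr_mmap_is_multiplicative => g m m'.
by rewrite /GRing.comm mulr_algl mulr_algr.
Qed.
HB.instance Definition _ :=
  GRing.isMonoidMorphism.Build (free_alg K I) S free_lift free_lift_multiplicative.

Fact free_lift_scalable : scalable free_lift.
Proof. by move=> k u; rewrite /free_lift monalg.mmapZ mulr_algl. Qed.
HB.instance Definition _ :=
  GRing.isScalable.Build K (free_alg K I) S *:%R free_lift free_lift_scalable.

Lemma free_lift_gen i : free_lift (free_gen K i) = c i.
Proof.
by rewrite /free_lift /free_gen monalg.mmapU /= scale1r mul1r /word_lift fmuE /= big_seq1.
Qed.

End FreeLift.

Section QuotLift.
Variables (K : fieldType) (T U : algType K) (J : Defs.proper_ideal T).

Lemma generates_alg_pi (I : Type) (t : I -> T) :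
  generates t -> generates (fun i => alg_pi J (t i)).
Proof.
move=> gt S hS St u; rewrite -[u]alg_reprK.
apply: (gt (fun u => S (alg_pi J u))) => //; case: (hS) => Sk SD SM; split.
- by move=> k; rewrite linearZ rmorph1; apply: Sk.
- by move=> a b Sa Sb; rewrite raddfD; apply: SD.
- by move=> a b Sa Sb; rewrite rmorphM; apply: SM.
Qed.

Variables (f : {lrmorphism T -> U}) (fJ : forall u, J u -> f u = 0).

(** The proof that f kills J is an argument so that the morphism instances below can be attached to
    the term [quot_lift fJ]; [com_of] and [quot_der] use the same device. *)
Definition quot_lift (_ : forall u, J u -> f u = 0) (a : quot_alg J) : U := f (alg_repr a).
Local Notation fq := (quot_lift fJ).

Lemma quot_lift_pi u : fq (alg_pi J u) = f u.
Proof.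
apply/eqP; rewrite -subr_eq0 -raddfB /=; apply/eqP/fJ/(alg_piP J).
by rewrite alg_reprK.
Qed.

Fact quot_lift_additive : additive fq.
Proof.
move=> a b; rewrite -[a]alg_reprK -[b]alg_reprK -raddfB !quot_lift_pi.
exact: raddfB.
Qed.
HB.instance Definition _ :=
  GRing.isAdditive.Build (quot_alg J) U fq quot_lift_additive.

Fact quot_lift_multiplicative : monoid_morphism fq.
Proof.
split; first by rewrite -[1](rmorph1 (alg_pi J)) quot_lift_pi rmorph1.
move=> a b; rewrite -[a]alg_reprK -[b]alg_reprK -rmorphM !quot_lift_pi.
exact: rmorphM.
Qed.
HB.instance Definition _ :=
  GRing.isMonoidMorphism.Build (quot_alg J) U fq quot_lift_multiplicative.

Fact quot_lift_scalable : scalable fq.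
Proof.
by move=> k a; rewrite -[a]alg_reprK -linearZ !quot_lift_pi linearZ.
Qed.
HB.instance Definition _ :=
  GRing.isScalable.Build K (quot_alg J) U *:%R fq quot_lift_scalable.

Lemma quot_lift_exists :
  exists g : {lrmorphism quot_alg J -> U}, forall u, g (alg_pi J u) = f u.
Proof. by exists fq => u; apply: quot_lift_pi. Qed.

End QuotLift.

Lemma smallest_ideal_kernel (T S : nzRingType) (R : set T) (f : {rmorphism T -> S}) :
  (forall r, R r -> f r = 0) ->
  forall u, smallest (@is_ideal T) R u -> f u = 0.
Proof.
move=> fR u /(_ [set u | f u = 0]%classic); apply; split => //; split => /=.
- exact: rmorph0.
- by move=> v w ev ew; rewrite rmorphD ev ew addr0.
- by move=> a v ev; rewrite rmorphM ev mulr0.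
- by move=> a v ev; rewrite rmorphM ev mul0r.
Qed.

Lemma presented_alg_lift (K : fieldType) (I : choiceType) (S : nzRingType)
    (R : set (free_alg K I)) (e : {rmorphism free_alg K I -> S})
    (eR : forall r, R r -> e r = 0) (U : algType K) (c : I -> U) :
  (forall r, R r -> free_lift c r = 0) ->
  exists g : {lrmorphism quot_alg (rel_ideal eR) -> U},
    forall i, g (alg_pi _ (free_gen K i)) = c i.
Proof.
move=> cR; have [|g hg] := @quot_lift_exists K _ U (rel_ideal eR) (free_lift c).
  exact: smallest_ideal_kernel.
by exists g => i; rewrite hg /= free_lift_gen.
Qed.

Lemma presented_alg_rel (K : fieldType) (T : algType K) (S : nzRingType)
    (R : set T) (e : {rmorphism T -> S}) (eR : forall r, R r -> e r = 0) r :
  R r -> alg_pi (rel_ideal eR) r = 0.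
Proof.
move=> Rr; rewrite -(raddf0 (alg_pi _)); apply/alg_piP; rewrite subr0.
by move=> J [_ RJ]; apply: RJ.
Qed.

Section CommutativeAlgebra.
Variables (K : fieldType) (B : algType K) (BC : forall a b : B, a * b = b * a).
Definition com_of (_ : forall a b : B, a * b = b * a) : Type := B.
HB.instance Definition _ := GRing.Algebra.on (com_of BC).
HB.instance Definition _ :=
  GRing.PzRing_hasCommutativeMul.Build (com_of BC) BC.
End CommutativeAlgebra.

(** * The algebra of linear endomorphisms of a space *)

Section Endomorphisms.
Variables (K : fieldType) (V : lmodType K) (v0 : V) (v0_neq0 : v0 <> 0).

Fact linear_fun0 : linear (0 : V -> V).
Proof. by move=> k u v; rewrite /= scaler0 addr0. Qed.
Fact linear_funP (k : K) (f g : V -> V) :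
  linear f -> linear g -> linear (k *: f + g).
Proof.
move=> hf hg a u v.
rewrite -[LHS]/(k *: f _ + g _) -[RHS]/(a *: (k *: f u + g u) + (k *: f v + g v)).
by rewrite hf hg !scalerDr !scalerA [a * k]mulrC addrACA.
Qed.

Definition endo_submodule : submodule (V -> V) :=
  @Submodule K (V -> V : lmodType K) (fun f => linear f) linear_fun0 linear_funP.

(** A nonzero vector is recorded in the type because it gives [1 != 0], which the ring structure
    demands. *)
Definition endo (_ : v0 <> 0) : Type := sub_lmod endo_submodule.
HB.instance Definition _ := GRing.Lmodule.on (endo v0_neq0).
Local Notation E := (endo v0_neq0).

Definition endo_fun (f : E) : V -> V := \val (f : sub_lmod endo_submodule).

Fact endo_fun_linear (f : E) : linear (endo_fun f).
Proof. by have := valP (f : sub_lmod endo_submodule); rewrite submodule_predE => /asboolP. Qed.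
HB.instance Definition _ (f : E) :=
  GRing.isLinear.Build K V V _ (endo_fun f) (endo_fun_linear f).

Fact endo_subproof (f : {linear V -> V}) : (f : V -> V) \in submodule_pred endo_submodule.
Proof. by rewrite submodule_predE; apply/asboolP/linearP. Qed.

Definition to_endo (f : {linear V -> V}) : E :=
  (Sub (f : V -> V) (endo_subproof f) : sub_lmod endo_submodule).

Lemma to_endoE f v : endo_fun (to_endo f) v = f v.
Proof. by []. Qed.

Lemma endoP (f g : E) : endo_fun f =1 endo_fun g -> f = g.
Proof. by move=> e; apply/val_inj/funext. Qed.

Definition endo_mul (f g : E) : E := to_endo (endo_fun f \o endo_fun g).
Definition endo_one : E := to_endo idfun.

Lemma endo_funD (f g : E) v : endo_fun (f + g) v = endo_fun f v + endo_fun g v.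
Proof. by rewrite /endo_fun val_sub_lmodD. Qed.

Lemma endo_mulE (f g : E) v : endo_fun (endo_mul f g) v = endo_fun f (endo_fun g v).
Proof. by []. Qed.

Fact endo_mulA : associative endo_mul. Proof. by move=> f g h; apply: endoP. Qed.
Fact endo_mul1 : left_id endo_one endo_mul. Proof. by move=> f; apply: endoP. Qed.
Fact endo_mulr1 : right_id endo_one endo_mul. Proof. by move=> f; apply: endoP. Qed.
Fact endo_mulDl : left_distributive endo_mul +%R.
Proof. by move=> f g h; apply: endoP => v; rewrite endo_funD !endo_mulE endo_funD. Qed.
Fact endo_mulDr : right_distributive endo_mul +%R.
Proof. by move=> f g h; apply: endoP => v; rewrite endo_funD !endo_mulE endo_funD raddfD. Qed.
Fact endo_1neq0 : endo_one != 0.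
Proof. by apply/eqP => /(congr1 (fun f => endo_fun f v0)). Qed.

HB.instance Definition _ := GRing.Zmodule_isNzRing.Build E
  endo_mulA endo_mul1 endo_mulr1 endo_mulDl endo_mulDr endo_1neq0.

Lemma endo_funZ k (f : E) v : endo_fun (k *: f) v = k *: endo_fun f v.
Proof. by rewrite /endo_fun -[k *: f]addr0 val_sub_lmodP addr0. Qed.

Lemma endo_fun0 v : endo_fun (0 : E) v = 0.
Proof. by rewrite -(scale0r (0 : E)) endo_funZ scale0r. Qed.

Lemma endo_funM (f g : E) v : endo_fun (f * g) v = endo_fun f (endo_fun g v).
Proof. by []. Qed.

Lemma endo_fun1 v : endo_fun (1 : E) v = v.
Proof. by []. Qed.

Lemma endo_funN (f : E) v : endo_fun (- f) v = - endo_fun f v.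
Proof. by rewrite -[- f]scaleN1r endo_funZ scaleN1r. Qed.

Fact endo_scaleAl k (f g : E) : k *: (f * g) = (k *: f) * g.
Proof. by apply: endoP => v; rewrite endo_funZ !endo_funM endo_funZ. Qed.
HB.instance Definition _ := GRing.Lmodule_isLalgebra.Build K E endo_scaleAl.
Fact endo_scaleAr k (f g : E) : k *: (f * g) = f * (k *: g).
Proof. by apply: endoP => v; rewrite endo_funZ !endo_funM endo_funZ linearZ. Qed.
HB.instance Definition _ := GRing.Lalgebra_isAlgebra.Build K E endo_scaleAr.

End Endomorphisms.

Section LRMorphismEquations.
Variables (K : fieldType) (T U : algType K) (f : {lrmorphism T -> U}).
Lemma lrmorph0 : f 0 = 0. Proof. exact: raddf0. Qed.
Lemma lrmorph1 : f 1 = 1. Proof. exact: rmorph1. Qed.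
Lemma lrmorphN u : f (- u) = - f u. Proof. exact: raddfN. Qed.
Lemma lrmorphD u v : f (u + v) = f u + f v. Proof. exact: raddfD. Qed.
Lemma lrmorphB u v : f (u - v) = f u - f v. Proof. exact: raddfB. Qed.
Lemma lrmorphM u v : f (u * v) = f u * f v. Proof. exact: rmorphM. Qed.
Lemma lrmorphZ k u : f (k *: u) = k *: f u. Proof. exact: linearZ. Qed.
Lemma lrmorphXn u n : f (u ^+ n) = f u ^+ n. Proof. exact: rmorphXn. Qed.
Definition lrmorphE := (lrmorph0, lrmorph1, lrmorphD, lrmorphB, lrmorphN, lrmorphM,
  lrmorphZ).
End LRMorphismEquations.

(** Both composites with [g] fix generators, so injectivity of the lift comes without computing the
    kernel of [f]. *)
Lemma quot_lift_bij (K : fieldType) (T U : algType K) (J : Defs.proper_ideal T)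
    (I : Type) (t : I -> T) (f : {lrmorphism T -> U})
    (fJ : forall u, J u -> f u = 0) (g : {lrmorphism U -> quot_alg J}) :
  generates t -> generates (fun i => f (t i)) ->
  (forall i, g (f (t i)) = alg_pi J (t i)) ->
  bijective (quot_lift fJ).
Proof.
move=> gt gft gf; exists g => [a|u].
- have e : (g \o quot_lift fJ : {lrmorphism _ -> _}) =1
      (idfun : {lrmorphism quot_alg J -> quot_alg J}).
    apply: (lrmorph_eq_on_generators (generates_alg_pi (J := J) gt)) => i /=.
    by rewrite quot_lift_pi gf.
  exact: e.
- have e : (quot_lift fJ \o g : {lrmorphism _ -> _}) =1
      (idfun : {lrmorphism U -> U}).
    apply: (lrmorph_eq_on_generators gft) => i /=.
    by rewrite gf quot_lift_pi.
  exact: e.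
Qed.

Section Regular.
Variables (K : fieldType) (T : algType K) (I : Type) (t : I -> T).
Hypothesis gt : generates t.

Lemma is_central_gen h : (forall i, h * t i = t i * h) -> is_central h.
Proof.
move=> ht; apply: (gt (S := fun u => h * u = u * h)) => //; split.
- by move=> k; rewrite mulr_algl mulr_algr.
- by move=> u v eu ev; rewrite mulrDl mulrDr eu ev.
- by move=> u v eu ev; rewrite mulrA eu -mulrA ev mulrA.
Qed.

Variables (V : lmodType K) (v0 : V) (v0_neq0 : v0 <> 0).
Variables (rho : {lrmorphism T -> endo v0_neq0}) (s : {linear V -> T}).
Hypothesis s1 : s v0 = 1.
Hypothesis s_equivariant : forall i v, s (endo_fun (rho (t i)) v) = t i * s v.

(* The section s splits the orbit map u |-> u v0, so T embeds in V. *)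
Lemma regular_of_module h :
  (forall v, endo_fun (rho h) v = 0 -> v = 0) -> forall u, h * u = 0 -> u = 0.
Proof.
have s_equiv : forall u v, s (endo_fun (rho u) v) = u * s v.
  apply: (gt (S := fun u => forall v, s (endo_fun (rho u) v) = u * s v)) => //; split.
  - by move=> k v; rewrite linearZ rmorph1 endo_funZ endo_fun1 linearZ mulr_algl.
  - by move=> u u' hu hu' v; rewrite raddfD endo_funD raddfD /= hu hu' mulrDl.
  - by move=> u u' hu hu' v; rewrite rmorphM endo_funM hu hu' mulrA.
move=> h_reg u hu0; rewrite -[u]mulr1 -s1 -s_equiv.
have -> : endo_fun (rho u) v0 = 0.
  by apply: h_reg; rewrite -endo_funM -rmorphM hu0 raddf0 endo_fun0.
exact: raddf0.
Qed.

End Regular.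

(** * A criterion for being a deformation *)

Section DeformationIntro.
Variables (K : fieldType) (A : comAlgType K) (P : poisson A) (U T : algType K).
Variables (I : Type) (t : I -> T) (h : T) (lam : K).
Hypothesis gt : generates t.
Hypothesis hc : is_central h.
Hypothesis h_reg : forall u, h * u = 0 -> u = 0.
Variable f : {lrmorphism T -> A}.
Hypothesis fh : f h = 0.
Hypothesis gft : generates (fun i => f (t i)).
Hypothesis f_factor : forall (B : comAlgType K) (p : {lrmorphism T -> B}),
  p h = 0 -> exists g : {lrmorphism A -> B}, forall i, g (f (t i)) = p (t i).
Hypothesis f_bracket : forall i j, exists2 w : T,
  t i * t j - t j * t i = h * w & f w = P (f (t i)) (f (t j)).
Variable phi : {lrmorphism T -> U}.
Hypothesis phih : phi h = lam%:A.
Hypothesis gphi : generates (fun i => phi (t i)).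
Hypothesis phi_factor : forall (B : algType K) (p : {lrmorphism T -> B}),
  p h = lam%:A -> exists g : {lrmorphism U -> B}, forall i, g (phi (t i)) = p (t i).

Let h_cancel u v : h * u = h * v -> u = v.
Proof. by move/eqP; rewrite -subr_eq0 -mulrBr => /eqP/h_reg/eqP; rewrite subr_eq0 => /eqP. Qed.

Fact not_unit_h : ~ is_unit h.
Proof.
move=> [v [hv _]]; have := congr1 f hv; rewrite rmorphM /= fh mul0r rmorph1 => /eqP.
by rewrite eq_sym oner_eq0.
Qed.

Fact not_unit_h_shift : ~ is_unit (h - lam%:A).
Proof.
move=> [v [hv _]]; have := congr1 phi hv.
rewrite rmorphM rmorphB /= linearZ phih /= rmorph1 subrr mul0r => /eqP.
by rewrite eq_sym oner_eq0.
Qed.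

Let fD u v : f (u + v) = f u + f v. Proof. exact: rmorphD. Qed.
Let fM u v : f (u * v) = f u * f v. Proof. exact: rmorphM. Qed.
Let PDr c u v : P c (u + v) = P c u + P c v.
Proof. by have /= := poisson_linear_r P c 1 u v; rewrite !scale1r. Qed.
Let PZ1 (k : K) c : P c k%:A = 0.
Proof.
have P1 : P c 1 = 0.
  have /eqP := poisson_leibniz P c 1 1.
  by rewrite !mul1r mulr1 -subr_eq subrr eq_sym => /eqP.
have P0 : P c 0 = 0 by have /eqP := PDr c 0 0; rewrite addr0 -subr_eq subrr eq_sym => /eqP.
by have := poisson_linear_r P c k 1 0; rewrite addr0 P1 scaler0 P0 addr0.
Qed.

(** For fixed a, commutator and Poisson bracket are both derivations in the second argument, so the
    b for which h^-1 [a, b] exists and lifts {f a, f b} form a subalgebra. With antisymmetry,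
    generators suffice in both arguments; regularity of h identifies the given [w] with the one
    constructed. *)
Lemma commutator_bracket u v w : u * v - v * u = h * w -> f w = P (f u) (f v).
Proof.
pose good a b := exists2 c, a * b - b * a = h * c & f c = P (f a) (f b).
have good_sym a b : good a b -> good b a.
  case=> c ec fc; exists (- c); first by rewrite mulrN -ec opprB.
  by rewrite raddfN /= fc poissonC opprK.
have good_subalg a : is_subalg (good a).
  split.
  - move=> k; exists 0; first by rewrite mulr_algl mulr_algr mulr0 subrr.
    by rewrite raddf0 linearZ /= rmorph1 PZ1.
  - move=> b c [b' eb fb] [c' ec fc]; exists (b' + c').
      by rewrite !(mulrDl, mulrDr) -eb -ec opprD addrACA.
    by rewrite !fD PDr fb fc.
  - move=> b c [b' eb fb] [c' ec fc]; exists (b' * c + b * c').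
      rewrite mulrDr mulrA -eb [h * (b * c')]mulrA hc -mulrA -ec.
      by rewrite mulrBl mulrBr !mulrA addrA subrK.
    by rewrite fD !fM fb fc poisson_leibniz.
have good_gen i b : good (t i) b by apply: gt => // j; apply: f_bracket.
have [w' ew' <-] : good u v.
  by apply: gt => // i; apply/good_sym/good_gen.
by rewrite ew' => /h_cancel ->.
Qed.

(** This is the commutativity of T/hT, which must be known before the universal property of A, valid
    for commutative targets only, can be applied to T/hT. *)
Lemma commutator_divisible u v : exists w, u * v - v * u = h * w.
Proof.
pose good a b := exists c, a * b - b * a = h * c.
have good_sym a b : good a b -> good b a.
  by case=> c ec; exists (- c); rewrite mulrN -ec opprB.
have good_subalg a : is_subalg (good a).
  split.
  - by move=> k; exists 0; rewrite mulr_algl mulr_algr mulr0 subrr.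
  - by move=> b c [b' eb] [c' ec]; exists (b' + c'); rewrite !(mulrDl, mulrDr) -eb -ec opprD addrACA.
  - move=> b c [b' eb] [c' ec]; exists (b' * c + b * c').
    rewrite mulrDr mulrA -eb [h * (b * c')]mulrA hc -mulrA -ec.
    by rewrite mulrBl mulrBr !mulrA addrA subrK.
have good_gen i b : good (t i) b.
  by apply: gt => // j; have [w ew _] := f_bracket i j; exists w.
by apply: (gt (S := good u)) => // i; apply/good_sym/good_gen.
Qed.

Lemma is_deformation_intro : is_deformation P U.
Proof.
exists T, h, hc, not_unit_h.
set J := principal_ideal _ _.
have JC (a b : quot_alg J) : a * b = b * a.
  rewrite -[a]alg_reprK -[b]alg_reprK -!rmorphM; apply/alg_piP.
  by have [w ew] := commutator_divisible (alg_repr a) (alg_repr b); exists w.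
have fJ u : J u -> f u = 0 by case=> w _ <-; rewrite rmorphM /= fh mul0r.
split => //.
- have [|g hg] := @f_factor (com_of JC) (alg_pi J).
    apply/eqP; rewrite -(raddf0 (alg_pi J)); apply/eqP/alg_piP; rewrite subr0.
    by exists 1 => //; rewrite mulr1.
  exists (quot_lift fJ); first exact: (quot_lift_bij (t := t) fJ (g := g)).
  by move=> u v w e /=; rewrite !quot_lift_pi; apply: commutator_bracket.
- exists lam, not_unit_h_shift.
  set J' := principal_ideal _ _.
  have phiJ u : J' u -> phi u = 0.
    by case=> w _ <-; rewrite rmorphM rmorphB /= linearZ phih /= rmorph1 subrr mul0r.
  have [|g hg] := @phi_factor _ (alg_pi J').
    apply/eqP; rewrite -(rmorph1 (alg_pi J')) -linearZ; apply/eqP/alg_piP.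
    by exists 1 => //; rewrite mulr1.
  have [q qK qK'] : bijective (quot_lift phiJ) by apply: (quot_lift_bij (t := t) phiJ (g := g)).
  exists g; exists (quot_lift phiJ) => a.
  - have e : (quot_lift phiJ \o g : {lrmorphism _ -> _}) =1
      (idfun : {lrmorphism U -> U}).
      by apply: (lrmorph_eq_on_generators gphi) => i /=; rewrite hg quot_lift_pi.
    exact: e.
  - have e : (g \o quot_lift phiJ : {lrmorphism _ -> _}) =1
      (idfun : {lrmorphism quot_alg J' -> quot_alg J'}).
      apply: (lrmorph_eq_on_generators (generates_alg_pi (J := J') gt)) => i /=.
      by rewrite quot_lift_pi hg.
    exact: e.
Qed.

End DeformationIntro.

(** On an explicit list this computes to a conjunction, so relations can be destructed and split
    directly. *)
Fixpoint all_zero (V : nmodType) (s : seq V) : Prop :=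
  if s is r :: s' then r = 0 /\ all_zero s' else True.

Lemma all_zeroP (V : nmodType) (s : seq V) :
  all_zero s <-> forall r, r \in s -> r = 0.
Proof.
elim: s => [//|a s IH] /=; split.
- by case=> a0 /IH s0 r; rewrite inE => /predU1P [->|/s0].
- move=> s0; split; first by apply: s0; rewrite inE eqxx.
  by apply/IH => r rs; apply: s0; rewrite inE rs orbT.
Qed.

(* A finite presentation is given by relators that can be evaluated in any
   algebra; a character killing them makes the presented algebra nonzero. *)
Section Presentation.
Variables (K : fieldType) (I : choiceType).
Variable rels : forall T : algType K, (I -> T) -> seq T.
Hypothesis rels_natural : forall (T U : algType K) (f : {lrmorphism T -> U})
  (c : I -> T), map f (rels c) = rels (fun i => f (c i)).
Variable c0 : I -> K^o.
Hypothesis rels_c0 : all_zero (rels c0).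

Lemma free_lift_rels (T : algType K) (c : I -> T) r :
  r \in rels (@free_gen K I) -> free_lift c r \in rels c.
Proof.
move=> r_rel; have -> : rels c = rels (fun i => free_lift c (free_gen K i)).
  by congr rels; apply: funext => i; rewrite free_lift_gen.
by rewrite -rels_natural; apply: map_f.
Qed.

(** The character [e] is arbitrary, so that the lemma applies verbatim to [uq_sl2] and [uq'_so3],
    which were formed with characters of their own. *)
Lemma presented_quotient (S : nzRingType) (e : {rmorphism free_alg K I -> S})
    (eR : forall r, [set` rels (@free_gen K I)]%classic r -> e r = 0) :
  let t i : quot_alg (rel_ideal eR) := alg_pi _ (free_gen K i) in
  [/\ generates t, all_zero (rels t) &
      forall (B : algType K) (c : I -> B), all_zero (rels c) ->
        exists g : {lrmorphism quot_alg (rel_ideal eR) -> B}, forall i, g (t i) = c i].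
Proof.
move=> t; split.
- exact: (generates_alg_pi (J := rel_ideal eR) (@generates_free_gen K I)).
- apply/all_zeroP => r; rewrite -(rels_natural (alg_pi (rel_ideal eR)) (@free_gen K I)).
  by case/mapP => r' r'rel ->; apply: (presented_alg_rel eR).
- move=> B c /all_zeroP crel; apply: presented_alg_lift => r r_rel.
  exact/crel/free_lift_rels.
Qed.

Lemma presented_exists : exists (T : algType K) (t : I -> T),
  [/\ generates t, all_zero (rels t) &
      forall (B : algType K) (c : I -> B), all_zero (rels c) ->
        exists g : {lrmorphism T -> B}, forall i, g (t i) = c i].
Proof.
have char r : [set` rels (@free_gen K I)]%classic r -> free_lift c0 r = 0.
  by move=> r_rel; move/all_zeroP: rels_c0; apply; apply: free_lift_rels.
exists (quot_alg (rel_ideal char)), (fun i => alg_pi _ (free_gen K i)).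
exact: presented_quotient.
Qed.

End Presentation.

Section LinearEquations.
Variables (K : fieldType) (U V : lmodType K) (f : {linear U -> V}).
Lemma lin0 : f 0 = 0. Proof. exact: raddf0. Qed.
Lemma linN u : f (- u) = - f u. Proof. exact: raddfN. Qed.
Lemma linD u v : f (u + v) = f u + f v. Proof. exact: raddfD. Qed.
Lemma linB u v : f (u - v) = f u - f v. Proof. exact: raddfB. Qed.
Lemma linZ k u : f (k *: u) = k *: f u. Proof. exact: linearZ. Qed.
Definition linE := (lin0, linD, linB, linN, linZ).
End LinearEquations.
Arguments linE {K U V} f.

Section LeftMultiplication.
Variables (K : fieldType) (T : algType K) (a : T).
Definition mul_left (u : T) : T := a * u.
Fact mul_left_linear : linear mul_left.
Proof. by move=> k u v; rewrite /mul_left mulrDr scalerAr. Qed.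
HB.instance Definition _ := GRing.isLinear.Build K T T _ mul_left mul_left_linear.
End LeftMultiplication.

(** * Free modules and linear equations *)

Section LinearExtension.
Variables (K : fieldType) (I : choiceType).
Local Notation V := {malg K[I]}.

Lemma malg_span_ind (S : V -> Prop) :
  S 0 -> (forall k u v, S u -> S v -> S (k *: u + v)) -> (forall i, S << i >>) ->
  forall v, S v.
Proof.
move=> S0 SP Se v.
have -> : v = \sum_(m <- monalg.msupp v) (monalg.mcoeff m v *: (<< m >> : V)).
  rewrite [LHS](monalg.monalgE v); apply: eq_bigr => m _.
  apply/monalg.malgP => n; rewrite monalg.mcoeffZ !monalg.mcoeffU.
  by case: eqP => _; rewrite ?mulr1n ?mulr1 ?mulr0n ?mulr0.
elim: (finmap.enum_fset _) => [|m r IH]; first by rewrite big_nil.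
by rewrite big_cons; apply: SP.
Qed.

Lemma malg_linear_ext (W : lmodType K) (f g : {linear V -> W}) :
  (forall i, f << i >> = g << i >>) -> f =1 g.
Proof.
move=> e; apply: malg_span_ind => [|k u v eu ev|//]; first by rewrite !raddf0.
by rewrite !linearP eu ev.
Qed.

Variables (W : lmodType K) (g : I -> W).

Definition linext (v : V) : W := \sum_(m <- monalg.msupp v) monalg.mcoeff m v *: g m.

Lemma linextEw (d : {fset I}%fset) v : fsubset (monalg.msupp v) d ->
  linext v = \sum_(m <- d) monalg.mcoeff m v *: g m.
Proof.
move=> le; rewrite /linext (big_fset_incl _ le) //= => i _ /monalg.mcoeff_outdom ->.
by rewrite scale0r.
Qed.

Fact linext_linear : linear linext.
Proof.
move=> k u v; pose d := (monalg.msupp u `|` monalg.msupp v)%fset.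
have du : fsubset (monalg.msupp u) d by apply: fsubsetUl.
have dv : fsubset (monalg.msupp v) d by apply: fsubsetUr.
have dw : fsubset (monalg.msupp (k *: u + v)) d.
  apply: (fsubset_trans (monalg.msuppD_le _ _)); apply: fsetSU.
  exact: monalg.msuppZ_le.
rewrite (linextEw du) (linextEw dv) (linextEw dw) scaler_sumr -big_split /=.
by apply: eq_bigr => m _; rewrite monalg.mcoeffD monalg.mcoeffZ scalerDl scalerA.
Qed.
HB.instance Definition _ := GRing.isLinear.Build K V W _ linext linext_linear.

Lemma linext_basis i : linext << i >> = g i.
Proof.
rewrite (linextEw (d := [fset i]%fset)) ?monalg.msuppU_le // big_seq_fset1.
by rewrite monalg.mcoeffUU scale1r.
Qed.

End LinearExtension.

(** An interface whose only instance, [malg_free_module], is opaque: operators on a basis are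
    handled through lifting, extensionality and coordinates, and simplification cannot unfold the
    monoid algebra behind them. *)
Record free_module (K : fieldType) (I : choiceType) := FreeModule {
  fm_car :> lmodType K;
  fm_basis : I -> fm_car;
  fm_coord : I -> fm_car -> K;
  fm_lift : forall W : lmodType K, (I -> W) -> {linear fm_car -> W};
  fm_coord_linear : forall i k u v,
    fm_coord i (k *: u + v) = k * fm_coord i u + fm_coord i v;
  fm_coord_basis : forall i j, fm_coord i (fm_basis j) = (j == i)%:R;
  fm_coord_inj : forall u v, (forall i, fm_coord i u = fm_coord i v) -> u = v;
  fm_finite : forall v, exists s : seq I, forall i, fm_coord i v != 0 -> i \in s;
  fm_lift_basis : forall (W : lmodType K) (g : I -> W) i, fm_lift g (fm_basis i) = g i;
  fm_ext : forall (W : lmodType K) (f g : {linear fm_car -> W}),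
    (forall i, f (fm_basis i) = g (fm_basis i)) -> f =1 g }.

Fact malg_free_module (K : fieldType) (I : choiceType) : free_module K I.
Proof.
pose lift (W : lmodType K) (g : I -> W) : {linear {malg K[I]} -> W} := linext g.
refine (@FreeModule K I {malg K[I]} (fun i => << i >>) (fun i v => monalg.mcoeff i v) lift _ _ _ _ _ _).
- by move=> i k u v; rewrite monalg.mcoeffD monalg.mcoeffZ.
- by move=> i j; rewrite monalg.mcoeffU.
- by move=> u v /monalg.malgP.
- by move=> v; exists (finmap.enum_fset (monalg.msupp v)) => i; rewrite monalg.mcoeff_neq0.
- by move=> W g i; apply: linext_basis.
- exact: malg_linear_ext.
Qed.

Section FreeModuleTheory.
Variables (K : fieldType) (I : choiceType) (V : free_module K I).
Implicit Types u v : V.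

Lemma fm_coord0 i : fm_coord i (0 : V) = 0.
Proof.
have /eqP := fm_coord_linear i 1 (0 : V) 0.
by rewrite scale1r addr0 mul1r -subr_eq subrr eq_sym => /eqP.
Qed.
Lemma fm_coordD i u v : fm_coord i (u + v) = fm_coord i u + fm_coord i v.
Proof. by rewrite -[u in LHS]scale1r fm_coord_linear mul1r. Qed.
Lemma fm_coordZ i k u : fm_coord i (k *: u) = k * fm_coord i u.
Proof. by rewrite -[k *: u]addr0 fm_coord_linear fm_coord0 addr0. Qed.
Lemma fm_coordN i u : fm_coord i (- u) = - fm_coord i u.
Proof. by rewrite -scaleN1r fm_coordZ mulN1r. Qed.
Definition fm_coordE := (fm_coord0, fm_coordD, fm_coordN, fm_coordZ).

Definition fm_reindex (g : I -> I) : {linear V -> V} :=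
  fm_lift V (fun i => fm_basis V (g i)).

Lemma fm_reindex_basis g i : fm_reindex g (fm_basis V i) = fm_basis V (g i).
Proof. exact: fm_lift_basis. Qed.

Lemma fm_reindexC g g' v : g \o g' =1 g' \o g ->
  fm_reindex g (fm_reindex g' v) = fm_reindex g' (fm_reindex g v).
Proof.
move=> e; apply: (fm_ext (f := fm_reindex g \o fm_reindex g')
  (g := fm_reindex g' \o fm_reindex g)) => i /=.
by rewrite !fm_reindex_basis; congr fm_basis; apply: e.
Qed.

Lemma fm_reindexK g g' v : cancel g g' -> fm_reindex g' (fm_reindex g v) = v.
Proof.
move=> gK; apply: (fm_ext (f := fm_reindex g' \o fm_reindex g) (g := idfun)) => i /=.
by rewrite !fm_reindex_basis gK.
Qed.

Lemma fm_coord_reindex g i v : injective g ->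
  fm_coord (g i) (fm_reindex g v) = fm_coord i v.
Proof.
move=> g_inj.
have lin (c : V -> K) : (forall k u v, c (k *: u + v) = k * c u + c v) ->
    linear (c : V -> K^o) by [].
pose c1 v : K^o := fm_coord (g i) (fm_reindex g v).
pose c2 v : K^o := fm_coord i v.
have l1 : linear c1 by move=> k u w; rewrite /c1 linearP fm_coord_linear.
have l2 : linear c2 by move=> k u w; rewrite /c2 fm_coord_linear.
pose C1 : {linear V -> K^o} := HB.pack c1 (GRing.isLinear.Build K V K^o _ c1 l1).
pose C2 : {linear V -> K^o} := HB.pack c2 (GRing.isLinear.Build K V K^o _ c2 l2).
apply: (fm_ext (f := C1) (g := C2)) => j /=.
by rewrite /c1 /c2 fm_reindex_basis !fm_coord_basis (inj_eq g_inj).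
Qed.

(** The coordinates of a fixed vector are constant along the orbits of [g]; these are infinite and
    the support is finite, so all coordinates vanish. Applied to multiplication by Q, this is the
    regularity of Q - 1. *)
Lemma fm_reindex_fixed0 g v : injective g ->
  (forall i m n, iter m g i = iter n g i -> m = n) -> fm_reindex g v = v -> v = 0.
Proof.
move=> g_inj g_free gv; apply: fm_coord_inj => i; rewrite fm_coord0.
apply/eqP; apply: contraT => vi.
have iterE n : fm_coord (iter n g i) v = fm_coord i v.
  by elim: n => //= n <-; rewrite -{1}gv fm_coord_reindex.
have [supp supp_v] := fm_finite v.
pose s := [seq iter n g i | n <- iota 0 (size supp).+1].
have s_uniq : uniq s.
  by rewrite map_inj_in_uniq ?iota_uniq // => m n _ _; apply: g_free.
have s_sub : {subset s <= supp}.
  by move=> _ /mapP [n _ ->]; apply: supp_v; rewrite iterE.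
by have := uniq_leq_size s_uniq s_sub; rewrite size_map size_iota ltnn.
Qed.

End FreeModuleTheory.

Ltac free_module_ring :=
  apply: fm_coord_inj => ?; rewrite ?fm_coordE; ring.

(* Linear identities in a module, reduced to identities between coefficients. *)
Section LinearReflection.
Variables (K : fieldType) (V : lmodType K).

Inductive lexpr := LVar of nat | LZero | LAdd of lexpr & lexpr | LOpp of lexpr
  | LScale of K & lexpr.

Fixpoint lexpr_eval (w : seq V) (e : lexpr) : V :=
  match e with
  | LVar n => w`_n | LZero => 0 | LAdd a b => lexpr_eval w a + lexpr_eval w b
  | LOpp a => - lexpr_eval w a | LScale k a => k *: lexpr_eval w a
  end.

Fixpoint lexpr_coef (n : nat) (e : lexpr) : K :=
  match e with
  | LVar m => (m == n)%:R | LZero => 0 | LAdd a b => lexpr_coef n a + lexpr_coef n b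
  | LOpp a => - lexpr_coef n a | LScale k a => k * lexpr_coef n a
  end.

Lemma lexpr_evalE w e :
  lexpr_eval w e = \sum_(i < size w) lexpr_coef i e *: w`_i.
Proof.
elim: e => [m||a IHa b IHb|a IHa|k a IHa] /=.
- case: (ltnP m (size w)) => hm; last first.
    rewrite nth_default // big1 // => i _.
    by rewrite gtn_eqF ?scale0r //; apply: leq_trans hm.
  rewrite (bigD1 (Ordinal hm)) //= eqxx scale1r big1 ?addr0 // => i.
  rewrite -val_eqE /= eq_sym => /negPf ->; exact: scale0r.
- by rewrite big1 // => i _; rewrite scale0r.
- by rewrite IHa IHb -big_split /=; apply: eq_bigr => i _; rewrite scalerDl.
- by rewrite IHa -sumrN; apply: eq_bigr => i _; rewrite scaleNr.
- by rewrite IHa scaler_sumr; apply: eq_bigr => i _; rewrite scalerA.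
Qed.

Fixpoint lexpr_eq (n : nat) (a b : lexpr) : Prop :=
  if n is m.+1 then lexpr_coef m a = lexpr_coef m b /\ lexpr_eq m a b else True.

Lemma lexpr_eqP w a b : lexpr_eq (size w) a b -> lexpr_eval w a = lexpr_eval w b.
Proof.
move=> ab; rewrite !lexpr_evalE; apply: eq_bigr => i _; congr (_ *: _).
elim: (size w) ab i => [|n IH] /=; first by move=> _ [].
move=> [abn /IH {}IH] [i i_lt] /=; move: i_lt.
by rewrite ltnS leq_eqVlt => /predU1P [->//|lt_in]; apply: (IH (Ordinal lt_in)).
Qed.

End LinearReflection.

(** Atoms are matched up to unification, by typechecking [erefl], so that differently displayed
    forms of one term share a variable. *)
Ltac lmod_index x w :=
  lazymatch w with
  | cons ?y ?w' => match constr:(Set) with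
      | _ => let _ := constr:(erefl : x = y) in constr:(0%N)
      | _ => let n := lmod_index x w' in constr:(n.+1)
      end
  end.
Ltac lmod_mem x w :=
  lazymatch w with
  | cons ?y ?w' => match constr:(Set) with
      | _ => let _ := constr:(erefl : x = y) in constr:(true)
      | _ => lmod_mem x w'
      end
  | _ => constr:(false)
  end.
Ltac lmod_atoms V e w :=
  lazymatch e with
  | (?a + ?b)%R => let w1 := lmod_atoms V a w in lmod_atoms V b w1
  | (- ?a)%R => lmod_atoms V a w
  | (_ *: ?a)%R => lmod_atoms V a w
  | 0%R => w
  | _ => lazymatch lmod_mem e w with
         | true => w
         | false => constr:(@cons (GRing.Lmodule.sort V) e w)
         end
  end.
Ltac lmod_reify K e w :=
  lazymatch e with
  | (?a + ?b)%R => let a' := lmod_reify K a w in let b' := lmod_reify K b w in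
     constr:(@LAdd K a' b')
  | (- ?a)%R => let a' := lmod_reify K a w in constr:(@LOpp K a')
  | (?k *: ?a)%R => let a' := lmod_reify K a w in constr:(@LScale K k a')
  | 0%R => constr:(@LZero K)
  | _ => let n := lmod_index e w in constr:(@LVar K n)
  end.
Ltac lmod_coefs K V :=
  lazymatch goal with
  | |- ?a = ?b =>
    let w0 := constr:(@nil (GRing.Lmodule.sort V)) in
    let w1 := lmod_atoms V a w0 in
    let w := lmod_atoms V b w1 in
    let a' := lmod_reify K a w in let b' := lmod_reify K b w in
    refine (@lexpr_eqP K V w a' b' _); cbn [lexpr_eq size lexpr_coef eqn];
    repeat split; rewrite ?eqE /=
  end.
Ltac lmod K V := lmod_coefs K V; ring.

Ltac alg_lmod K T :=
  rewrite ?(mulrDl, mulrDr, mulrN, mulNr, scalerDr) -?scalerAl -?scalerAr ?scalerA ?mulrA;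
  lmod K (T : lmodType K).

Lemma ord3P (P : 'I_3 -> Prop) : P 0 -> P 1 -> P 2%R -> forall i, P i.
Proof.
by move=> P0 P1 P2 [[|[|[|//]]] p];
  [move: P0 | move: P1 | move: P2]; congr P; apply: val_inj.
Qed.

Lemma ord4P (P : 'I_4 -> Prop) : P 0 -> P 1 -> P 2%R -> P 3%R -> forall i, P i.
Proof.
by move=> P0 P1 P2 P3 [[|[|[|[|//]]]] p];
  [move: P0 | move: P1 | move: P2 | move: P3]; congr P; apply: val_inj.
Qed.

(** * A PBW basis of the homogenized enveloping algebra of sl_2 *)

Section HomogenizedSl2.
Variable K : fieldType.

(* The homogenized enveloping algebra of sl_2: at h = 1 the generators x, y, z are
   E, - F and - H / 2. *)
Definition hsl2_rels (T : algType K) (c : 'I_4 -> T) : seq T :=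
  let h := c 0 in let x := c 1 in let y := c 2%R in let z := c 3%R in
  [:: h * x - x * h; h * y - y * h; h * z - z * h;
      x * y - y * x - 2%:R *: (h * z); y * z - z * y + h * y; z * x - x * z + h * x].

Lemma hsl2_rels_natural (T U : algType K) (f : {lrmorphism T -> U}) (c : 'I_4 -> T) :
  map f (hsl2_rels c) = hsl2_rels (fun i => f (c i)).
Proof. by rewrite /= !lrmorphE. Qed.

Lemma hsl2_rels0 : all_zero (hsl2_rels (fun _ : 'I_4 => 0 : K^o)).
Proof. by rewrite /= !mulr0 scaler0 !subrr addr0. Qed.

Let I : choiceType := (nat * nat * nat * nat)%type.
Let V := malg_free_module K I.

Definition hsl2_basis (i k j l : nat) : V := fm_basis V (i, k, j, l).
Local Notation b := hsl2_basis.

Definition shift_x := fm_reindex V (fun m : I => (m.1.1.1.+1, m.1.1.2, m.1.2, m.2)).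
Definition shift_h := fm_reindex V (fun m : I => (m.1.1.1, m.1.1.2, m.1.2, m.2.+1)).

Lemma shift_x_basis i k j l : shift_x (b i k j l) = b i.+1 k j l.
Proof. exact: fm_reindex_basis. Qed.
Lemma shift_h_basis i k j l : shift_h (b i k j l) = b i k j l.+1.
Proof. exact: fm_reindex_basis. Qed.

(* The basis vector (i, k, j, l) stands for x^i y^k z^j h^l; the values at
   i + 1 are forced by the relations of x with y and z. *)
Fixpoint act_yz (i k j l : nat) : V * V :=
  if i is i'.+1 then
    (shift_x (act_yz i' k j l).1 - 2%:R *: shift_h (act_yz i' k j l).2,
     shift_x (act_yz i' k j l).2 - shift_h (b i k j l))
  else (b 0 k.+1 j l, b 0 k j.+1 l + k%:R *: b 0 k j l.+1).

Definition act_y : {linear V -> V} :=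
  fm_lift V (fun m : I => (act_yz m.1.1.1 m.1.1.2 m.1.2 m.2).1).
(** At i = 0 the action rests on z y^k = y^k z + k h y^k. *)
Definition act_z : {linear V -> V} :=
  fm_lift V (fun m : I => (act_yz m.1.1.1 m.1.1.2 m.1.2 m.2).2).

Lemma act_y_basis i k j l : act_y (b i k j l) = (act_yz i k j l).1.
Proof. exact: fm_lift_basis. Qed.
Lemma act_z_basis i k j l : act_z (b i k j l) = (act_yz i k j l).2.
Proof. exact: fm_lift_basis. Qed.

Lemma basis_ext (W : lmodType K) (f g : {linear V -> W}) :
  (forall i k j l, f (b i k j l) = g (b i k j l)) -> f =1 g.
Proof. by move=> e; apply: fm_ext => -[[[i k] j] l]; apply: e. Qed.

Lemma shift_xh v : shift_x (shift_h v) = shift_h (shift_x v).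
Proof. exact: fm_reindexC. Qed.

Lemma act_y_shift_x v : act_y (shift_x v) = shift_x (act_y v) - 2%:R *: shift_h (act_z v).
Proof.
apply: (basis_ext (f := act_y \o shift_x)
  (g := (shift_x \o act_y) \- (2%:R \*: (shift_h \o act_z)))) => i k j l /=.
by rewrite shift_x_basis !act_y_basis act_z_basis.
Qed.

Lemma act_z_shift_x v : act_z (shift_x v) = shift_x (act_z v) - shift_h (shift_x v).
Proof.
apply: (basis_ext (f := act_z \o shift_x)
  (g := (shift_x \o act_z) \- (shift_h \o shift_x))) => i k j l /=.
by rewrite shift_x_basis !act_z_basis.
Qed.

Lemma act_yz_shift_h i k j l :
  act_yz i k j l.+1 = (shift_h (act_yz i k j l).1, shift_h (act_yz i k j l).2).
Proof.
elim: i => [|i IH] /=.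
  by rewrite !(linE shift_h) !shift_h_basis.
by rewrite IH /= !(linE shift_x, linE shift_h) -shift_h_basis !shift_xh.
Qed.

Lemma act_y_shift_h v : act_y (shift_h v) = shift_h (act_y v).
Proof.
apply: (basis_ext (f := act_y \o shift_h) (g := shift_h \o act_y)) => i k j l /=.
by rewrite shift_h_basis !act_y_basis act_yz_shift_h.
Qed.

Lemma act_z_shift_h v : act_z (shift_h v) = shift_h (act_z v).
Proof.
apply: (basis_ext (f := act_z \o shift_h) (g := shift_h \o act_z)) => i k j l /=.
by rewrite shift_h_basis !act_z_basis act_yz_shift_h.
Qed.

(** The defect [d] of the relation commutes with [shift_x], which is the resolution of the overlap
    of the three relations among x, y, z; it therefore suffices to see that [d] vanishes at i =
    0. *)
Lemma act_yzC v : act_y (act_z v) - act_z (act_y v) + shift_h (act_y v) = 0.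
Proof.
pose d : {linear V -> V} :=
  (act_y \o act_z) \- (act_z \o act_y) \+ (shift_h \o act_y).
have d_shift_x u : d (shift_x u) = shift_x (d u).
  rewrite /d /= !(act_y_shift_x, act_z_shift_x, linE shift_x, linE shift_h, linE act_y, linE act_z).
  rewrite !(act_y_shift_x, act_z_shift_x, act_y_shift_h, act_z_shift_h, shift_xh,
     linE shift_x, linE shift_h, linE act_y, linE act_z).
  free_module_ring.
apply: (basis_ext (f := d) (g := \0)) => i k j l; rewrite [RHS]/=.
elim: i => [|i IH]; last by rewrite -shift_x_basis d_shift_x IH lin0.
rewrite /d /= act_y_basis act_z_basis /= !(linE act_y, linE act_z).
rewrite !act_y_basis !act_z_basis /= shift_h_basis -natr1.
free_module_ring.
Qed.

Lemma hsl2_v0_neq0 : b 0 0 0 0 <> 0.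
Proof.
move/(congr1 (fm_coord (0, 0, 0, 0))); rewrite fm_coord0 fm_coord_basis eqxx.
by apply/eqP; rewrite oner_eq0.
Qed.

Definition hsl2_act (i : 'I_4) : endo hsl2_v0_neq0 :=
  nth 0 [:: to_endo hsl2_v0_neq0 shift_h; to_endo hsl2_v0_neq0 shift_x;
            to_endo hsl2_v0_neq0 act_y; to_endo hsl2_v0_neq0 act_z] i.

Lemma hsl2_act_rels : all_zero (hsl2_rels hsl2_act).
Proof.
do 6?split=> //; apply: endoP => v;
  rewrite !(endo_funD, endo_funN, endo_funZ, endo_funM, endo_fun0) !to_endoE.
- by rewrite shift_xh subrr.
- by rewrite act_y_shift_h subrr.
- by rewrite act_z_shift_h subrr.
- by rewrite act_y_shift_x subKr subrr.
- exact: act_yzC.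
- by rewrite act_z_shift_x; free_module_ring.
Qed.

Section Monomials.
Variables (T : algType K) (h x y z : T).
Hypothesis hx : h * x = x * h.
Hypothesis hy : h * y = y * h.
Hypothesis hz : h * z = z * h.
Hypothesis xy : x * y = y * x + 2%:R *: (h * z).
Hypothesis yz : y * z = z * y - h * y.
Hypothesis zx : z * x = x * z - h * x.

(** The section required as [s] by [regular_of_module]; the lemmas that follow are its equivariance
    under each generator. *)
Definition hsl2_monomial : {linear V -> T} :=
  fm_lift V (fun m : I => x ^+ m.1.1.1 * (y ^+ m.1.1.2 * (z ^+ m.1.2 * h ^+ m.2))).
Local Notation s := hsl2_monomial.

Lemma hsl2_monomial_basis i k j l :
  s (b i k j l) = x ^+ i * (y ^+ k * (z ^+ j * h ^+ l)).
Proof. exact: fm_lift_basis. Qed.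

Lemma hsl2_monomial_x v : s (shift_x v) = x * s v.
Proof.
apply: (basis_ext (f := s \o shift_x) (g := mul_left x \o s)) => i k j l /=.
by rewrite shift_x_basis !hsl2_monomial_basis exprS -mulrA.
Qed.

Let commX (u : T) n : h * u = u * h -> h * u ^+ n = u ^+ n * h.
Proof. by move=> hu; apply: (commrX n hu). Qed.

Lemma hsl2_monomial_h v : s (shift_h v) = h * s v.
Proof.
apply: (basis_ext (f := s \o shift_h) (g := mul_left h \o s)) => i k j l /=.
rewrite shift_h_basis !hsl2_monomial_basis /mul_left exprS.
rewrite [RHS]mulrA (commX _ hx) -[RHS]mulrA; congr (_ * _).
rewrite [RHS]mulrA (commX _ hy) -[RHS]mulrA; congr (_ * _).
by rewrite [RHS]mulrA (commX _ hz) -[RHS]mulrA.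
Qed.

Let zyX k : z * y ^+ k = y ^+ k * z + k%:R *: (h * y ^+ k).
Proof.
elim: k => [|k IH]; first by rewrite scale0r addr0 mulr1 mul1r.
have zy : z * y = y * z + h * y by rewrite yz subrK.
rewrite exprS mulrA zy mulrDl -!mulrA IH mulrDr -natr1 scalerDl scale1r.
by rewrite -scalerAr [y * (h * _)]mulrA -hy -!mulrA -exprS addrA.
Qed.

(** Moving y past x produces a z, hence the joint induction on the exponent of x, which replays the
    recursion of [act_yz] inside T. *)
Lemma hsl2_monomial_yz v : s (act_y v) = y * s v /\ s (act_z v) = z * s v.
Proof.
suff yzP i k j l : s (act_y (b i k j l)) = y * s (b i k j l) /\
    s (act_z (b i k j l)) = z * s (b i k j l).
  split.
    apply: (basis_ext (f := s \o act_y) (g := mul_left y \o s)) => i k j l /=.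
    by have [-> _] := yzP i k j l.
  apply: (basis_ext (f := s \o act_z) (g := mul_left z \o s)) => i k j l /=.
  by have [_ ->] := yzP i k j l.
rewrite act_y_basis act_z_basis; elim: i => [|i [IHy IHz]].
  rewrite /= !(linE s) !hsl2_monomial_basis !mul1r; split.
    by rewrite exprS -mulrA.
  rewrite [RHS]mulrA zyX [RHS]mulrDl -scalerAl; congr (_ + _ *: _).
    by rewrite exprS -!mulrA.
  by rewrite (commX _ hy) -!mulrA [h * _]mulrA (commX _ hz) exprS -!mulrA.
rewrite /= !(linE s) !hsl2_monomial_x !hsl2_monomial_h IHy IHz -shift_x_basis.
rewrite hsl2_monomial_x !mulrA xy zx.
by rewrite !mulrDl mulNr -!scalerAl addrK.
Qed.

End Monomials.
End HomogenizedSl2.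

(** * Poisson brackets in three coordinates *)

Section PolynomialAlgebra.
Variables (K : fieldType) (n : nat).

Lemma generates_mvar : generates (@mvar K n).
Proof.
move=> S hS Sx u.
rewrite (mpolyE u); apply: is_subalg_sum => // m; apply: is_subalgZ => //.
rewrite mpolyXE_id; case: (hS) => _ _ SM.
elim: (index_enum _) => [|i r IH]; first by rewrite big_nil; apply: is_subalg1.
rewrite big_cons; apply: (SM) => //.
by elim: (m i) => [|e IHe]; [rewrite expr0; apply: is_subalg1 | rewrite exprS; apply: (SM) => //; apply: Sx].
Qed.

Variables (B : comAlgType K) (c : 'I_n -> B).

Definition mpoly_lift (u : mpoly n K) : B := mpoly.mmap (GRing.in_alg B) c u.

Fact mpoly_lift_additive : additive mpoly_lift.
Proof. by move=> u v; rewrite /mpoly_lift mpoly.mmapB. Qed.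
HB.instance Definition _ :=
  GRing.isAdditive.Build (mpoly n K) B mpoly_lift mpoly_lift_additive.

Fact mpoly_lift_multiplicative : monoid_morphism mpoly_lift.
Proof.
have [hM h1] := mpoly.mmap_is_multiplicative c (GRing.in_alg B).
by split=> // u v; apply: hM.
Qed.
HB.instance Definition _ :=
  GRing.isMonoidMorphism.Build (mpoly n K) B mpoly_lift mpoly_lift_multiplicative.

Fact mpoly_lift_scalable : scalable mpoly_lift.
Proof. by move=> k u; rewrite /mpoly_lift mpoly.mmapZ /= mulr_algl. Qed.
HB.instance Definition _ :=
  GRing.isScalable.Build K (mpoly n K) B *:%R mpoly_lift mpoly_lift_scalable.

Lemma mpoly_lift_mvar i : mpoly_lift (mvar K i) = c i.
Proof. by rewrite /mpoly_lift /mvar mpoly.mmapX mpoly.mmap1U. Qed.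

End PolynomialAlgebra.

Definition countably_spanned (K : fieldType) (A : lmodType K) : Prop :=
  exists e : nat -> A, forall a, exists n (c : nat -> K), a = \sum_(i < n) c i *: e i.

Lemma sum_countably_spanned (K : fieldType) (A : lmodType K) (e : nat -> A)
    (J : Type) (r : seq J) (F : J -> A) :
  (forall j, exists n (c : nat -> K), F j = \sum_(i < n) c i *: e i) ->
  exists n (c : nat -> K), \sum_(j <- r) F j = \sum_(i < n) c i *: e i.
Proof.
move=> Fe; elim: r => [|j r [n [c IH]]].
  by exists 0%N, (fun _ => 0); rewrite big_nil big_ord0.
have [m [d Fj]] := Fe j; exists (maxn n m).
exists (fun i => (if (i < m)%N then d i else 0) + (if (i < n)%N then c i else 0)).
rewrite big_cons Fj IH.
have widen (k : nat) (b : nat -> K) : (k <= maxn n m)%N ->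
    \sum_(i < k) b i *: e i = \sum_(i < maxn n m) (if (i < k)%N then b i else 0) *: e i.
  move=> le; rewrite (big_ord_widen _ (fun i => b i *: e i) le) big_mkcond /=.
  by apply: eq_bigr => i _; case: ifP => // _; rewrite scale0r.
rewrite (widen m) ?leq_maxr // (widen n) ?leq_maxl // -big_split /=.
by apply: eq_bigr => i _; rewrite scalerDl.
Qed.

Lemma mpoly_countably_spanned (K : fieldType) (n : nat) :
  countably_spanned (mpoly n K).
Proof.
(* Monomials are listed by their codes; a number that codes no monomial contributes 0. *)
pose e i : mpoly n K := oapp (fun m : 'X_{1.. n} => 'X_[m] : mpoly n K) 0 (choice.unpickle i).
exists e => u.
rewrite {1}(mpolyE u); apply: (sum_countably_spanned (e := e)) => m.
exists (choice.pickle m).+1, (fun i => if i == choice.pickle m then u@_m else 0).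
rewrite big_ord_recr /= eqxx /e choice.pickleK big1 ?add0r // => i _.
by rewrite ltn_eqF ?scale0r.
Qed.

Lemma quot_countably_spanned (K : fieldType) (T : algType K) (J : Defs.proper_ideal T) :
  countably_spanned T -> countably_spanned (quot_alg J).
Proof.
case=> e eP; exists (fun i => alg_pi J (e i)) => a.
have [n [c aE]] := eP (alg_repr a); exists n, c.
rewrite -{1}[a]alg_reprK aE raddf_sum; apply: eq_bigr => i _.
exact: linearZ.
Qed.

(** * Derivations of a quotient algebra *)

Section QuotientDerivation.
Variables (K : fieldType) (T : comAlgType K) (J : Defs.proper_ideal T).
Variable D : {linear T -> T}.
Hypothesis D_der : is_derivation D.
Hypothesis DJ : forall u, J u -> J (D u).

Definition quot_der (_ : forall u, J u -> J (D u)) (a : quot_alg J) : quot_alg J :=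
  alg_pi J (D (alg_repr a)).

Lemma quot_der_pi u : quot_der DJ (alg_pi J u) = alg_pi J (D u).
Proof. by apply/alg_piP; rewrite -raddfB; apply/DJ/alg_piP; rewrite alg_reprK. Qed.

Fact quot_der_linear : linear (quot_der DJ).
Proof.
move=> k a b; rewrite -[a]alg_reprK -[b]alg_reprK.
have h u v : quot_der DJ (k *: alg_pi J u + alg_pi J v) =
    k *: quot_der DJ (alg_pi J u) + quot_der DJ (alg_pi J v).
  have -> : k *: alg_pi J u + alg_pi J v = alg_pi J (k *: u + v) by rewrite linearP.
  by rewrite !quot_der_pi !linearP.
exact: h.
Qed.
HB.instance Definition _ :=
  GRing.isLinear.Build K (quot_alg J) (quot_alg J) _ (quot_der DJ) quot_der_linear.

Lemma quot_der_derivation : is_derivation (quot_der DJ).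
Proof.
move=> a b; rewrite -[a]alg_reprK -[b]alg_reprK.
have h (u v : T) : quot_der DJ (alg_pi J (u * v)) =
    quot_der DJ (alg_pi J u) * alg_pi J v + alg_pi J u * quot_der DJ (alg_pi J v).
  by rewrite !quot_der_pi D_der (lrmorphD (alg_pi J)) /= !(lrmorphM (alg_pi J)).
by rewrite -h; congr (quot_der DJ); rewrite lrmorphM.
Qed.

End QuotientDerivation.

(** By minimality of the ideal: by the Leibniz rule, its elements u with [D u] again in it form an
    ideal, and this ideal contains the relators. *)
Lemma rel_ideal_der (K : fieldType) (T : comAlgType K) (S : nzRingType)
    (R : set T) (e : {rmorphism T -> S}) (eR : forall r, R r -> e r = 0)
    (D : {linear T -> T}) : is_derivation D ->
  (forall r, R r -> rel_ideal eR (D r)) ->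
  forall u, rel_ideal eR u -> rel_ideal eR (D u).
Proof.
move=> D_der DR u.
have idR : is_ideal (rel_ideal eR) := proper_idealP (rel_ideal eR).
have [I0 ID IM IMr] := idR.
pose S' := [set v | rel_ideal eR v /\ rel_ideal eR (D v)]%classic.
have idS : is_ideal S'.
  split.
  - by split=> //; rewrite raddf0.
  - by move=> v w [? ?] [? ?]; split; rewrite ?raddfD; apply: ID.
  - move=> a v [? ?]; split; first exact: IM.
    by rewrite D_der; apply: ID; apply: IM.
  - move=> a v [? ?]; split; first exact: IMr.
    by rewrite D_der; apply: ID; apply: IMr.
have RS' : (R `<=` S')%classic.
  by move=> r Rr; split; [move=> I [_ RI]; apply: RI | apply: DR].
by move=> hu; have [] := hu S' (conj idS RS').
Qed.

(* The bracket v . (grad a x grad b) of a vector field v = (q, r, p); it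
   satisfies the Jacobi identity as soon as v . curl v = 0. *)
Section JacobianBracket.
Variables (K : fieldType) (A : comAlgType K) (D1 D2 D3 : {linear A -> A}).
Hypotheses (D1_der : is_derivation D1) (D2_der : is_derivation D2)
  (D3_der : is_derivation D3).
Hypothesis D12 : forall a, D2 (D1 a) = D1 (D2 a).
Hypothesis D13 : forall a, D3 (D1 a) = D1 (D3 a).
Hypothesis D23 : forall a, D3 (D2 a) = D2 (D3 a).
Variables p q r : A.
Hypothesis vcurl : q * (D2 p - D3 r) + r * (D3 q - D1 p) + p * (D1 r - D2 q) = 0.

Definition jac_br (a b : A) : A :=
  p * (D1 a * D2 b - D2 a * D1 b) + q * (D2 a * D3 b - D3 a * D2 b)
    + r * (D3 a * D1 b - D1 a * D3 b).

Fact jac_br_linear_r a : linear (jac_br a).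
Proof.
move=> k u v; rewrite /jac_br !linearP /= !(mulrDr, mulrN, mulrDl, mulNr).
by alg_lmod K A.
Qed.
Fact jac_br_alternating a : jac_br a a = 0.
Proof. rewrite /jac_br; ring. Qed.
Lemma jac_brC a b : jac_br a b = - jac_br b a.
Proof. rewrite /jac_br; ring. Qed.
Fact jac_br_linear_l b : linear (jac_br^~ b).
Proof.
by move=> k u v /=; rewrite jac_brC jac_br_linear_r opprD -scalerN -!jac_brC.
Qed.
Fact jac_br_leibniz a b c : jac_br a (b * c) = jac_br a b * c + b * jac_br a c.
Proof. rewrite /jac_br D1_der D2_der D3_der; ring. Qed.

(** The Jacobiator is [- det] times v . curl v, where [det] is the Jacobian determinant of a, b, c;
    the second derivatives cancel because the three derivations commute. *)
Fact jac_br_jacobi a b c :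
  jac_br a (jac_br b c) + jac_br b (jac_br c a) + jac_br c (jac_br a b) = 0.
Proof.
pose det := D1 a * (D2 b * D3 c - D3 b * D2 c) + D2 a * (D3 b * D1 c - D1 b * D3 c)
  + D3 a * (D1 b * D2 c - D2 b * D1 c).
rewrite -[RHS](mul0r (- det)) -vcurl /det /jac_br.
rewrite !(linB D1, linD D1, D1_der) !(linB D2, linD D2, D2_der) !(linB D3, linD D3, D3_der).
rewrite !(D12, D13, D23).
move: (D1 p) (D2 p) (D3 p) (D1 q) (D2 q) (D3 q) (D1 r) (D2 r) (D3 r) => p1 p2 p3 q1 q2 q3 r1 r2 r3. ring.
Qed.

Definition jac_poisson : poisson A :=
  Poisson jac_br_linear_l jac_br_linear_r jac_br_alternating jac_br_jacobi
    jac_br_leibniz.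

End JacobianBracket.

(** * Partial derivatives of K[x, y, z] and K[x, y, z, z^-1] *)

Section CoordinateDerivations.
Variable K : fieldType.

Lemma mderiv_derivation n (i : 'I_n) :
  is_derivation (mderiv i : {linear mpoly n K -> mpoly n K}).
Proof. by move=> a b; rewrite /= mderivM. Qed.

Lemma mderiv_mvar n (i j : 'I_n) : mderiv i (mvar K j) = (j == i)%:R.
Proof.
rewrite /mvar mderivX mnmE; case: eqP => [->|_]; last by rewrite scale0r.
by rewrite scale1r (_ : (_ - _)%MM = 0%MM) ?mpolyX0 //; apply/mnmP => k; rewrite mnmBE subnn mnm0E.
Qed.

Lemma mvar_partial (i j k : 'I_3) : j != i -> k != i ->
  is_partial (mderiv i : {linear mpoly 3 K -> mpoly 3 K}) (mvar K i) (mvar K j) (mvar K k).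
Proof.
move=> /negPf ji /negPf ki; split; first exact: mderiv_derivation.
- by rewrite /= mderiv_mvar eqxx.
- by rewrite /= mderiv_mvar ji.
- by rewrite /= mderiv_mvar ki.
Qed.

Let J := rel_ideal (@laurent_rel_char K).
Local Notation w := (mvar K (3 : 'I_4)).
Local Notation zv := (mvar K (2 : 'I_4)).

(* d/dz of z^-1 is - z^-2. *)
Definition laurent_dz0 (u : mpoly 4 K) : mpoly 4 K :=
  mderiv (2 : 'I_4) u - w ^+ 2 * mderiv (3 : 'I_4) u.
Fact laurent_dz0_linear : linear laurent_dz0.
Proof.
by move=> k u v; rewrite /laurent_dz0 !linearP /= mulrDr -scalerAr opprD scalerBr addrACA.
Qed.
HB.instance Definition _ :=
  GRing.isLinear.Build K (mpoly 4 K) (mpoly 4 K) _ laurent_dz0 laurent_dz0_linear.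

Lemma laurent_dz0_derivation : is_derivation laurent_dz0.
Proof. by move=> a b; rewrite /= /laurent_dz0 !mderivM; ring. Qed.

Fact laurent_rel_mem u : J (u * (zv * w - 1)).
Proof.
have [_ _ JM _] := proper_idealP J; apply: JM.
by move=> I [_ RI]; apply: RI.
Qed.

Fact laurent_dxy_ideal (i : 'I_4) : (i < 2)%N -> forall u, J u -> J (mderiv i u).
Proof.
move=> i2; apply: (rel_ideal_der (D := mderiv i)); first exact: mderiv_derivation.
move=> _ -> /=; rewrite raddfB /= mderivM !mderiv_mvar mderivC.
rewrite -!val_eqE /= !gtn_eqF ?(leq_trans i2) // mul0r mulr0 addr0 subr0.
by have [] := proper_idealP J.
Qed.

Fact laurent_dz_ideal u : J u -> J (laurent_dz0 u).
Proof.
apply: (rel_ideal_der (D := laurent_dz0)); first exact: laurent_dz0_derivation.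
move=> _ -> /=; rewrite /laurent_dz0 !raddfB /= !mderivM !mderiv_mvar !mderivC /=.
rewrite (_ : _ - _ = - w * (zv * w - 1)); first exact: laurent_rel_mem.
ring.
Qed.

Definition laurent_dx : {linear laurent3 K -> laurent3 K} :=
  quot_der (laurent_dxy_ideal (i := 0) isT).
Definition laurent_dy : {linear laurent3 K -> laurent3 K} :=
  quot_der (laurent_dxy_ideal (i := 1) isT).
Definition laurent_dz : {linear laurent3 K -> laurent3 K} :=
  quot_der laurent_dz_ideal.

Lemma laurent_dx_pi u : laurent_dx (alg_pi J u) = alg_pi J (mderiv (0 : 'I_4) u).
Proof. exact: quot_der_pi. Qed.
Lemma laurent_dy_pi u : laurent_dy (alg_pi J u) = alg_pi J (mderiv (1 : 'I_4) u).
Proof. exact: quot_der_pi. Qed.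
Lemma laurent_dz_pi u : laurent_dz (alg_pi J u) = alg_pi J (laurent_dz0 u).
Proof. exact: quot_der_pi. Qed.

Lemma laurent_dx_derivation : is_derivation laurent_dx.
Proof. exact/quot_der_derivation/mderiv_derivation. Qed.
Lemma laurent_dy_derivation : is_derivation laurent_dy.
Proof. exact/quot_der_derivation/mderiv_derivation. Qed.
Lemma laurent_dz_derivation : is_derivation laurent_dz.
Proof. exact/quot_der_derivation/laurent_dz0_derivation. Qed.

Lemma lvar_zw : lvar K 2 * lvar K 3 = 1.
Proof.
rewrite /lvar -rmorphM -(rmorph1 (alg_pi _)); apply/alg_piP.
by rewrite -[X in J X]mul1r; apply: laurent_rel_mem.
Qed.

Lemma laurent_dx_lvar i : laurent_dx (lvar K i) = (i == 0)%:R.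
Proof. by rewrite /= quot_der_pi /= mderiv_mvar; case: eqP => _; rewrite ?rmorph1 ?raddf0. Qed.
Lemma laurent_dy_lvar i : laurent_dy (lvar K i) = (i == 1)%:R.
Proof. by rewrite /= quot_der_pi /= mderiv_mvar; case: eqP => _; rewrite ?rmorph1 ?raddf0. Qed.
Lemma laurent_dz_lvar i :
  laurent_dz (lvar K i) = (i == 2)%:R - (lvar K 3) ^+ 2 *+ (i == 3).
Proof.
rewrite /= quot_der_pi /= /laurent_dz0 !mderiv_mvar (lrmorphB (alg_pi J)) (lrmorphM (alg_pi J)) (lrmorphXn (alg_pi J)) /=.
move: i; apply: ord4P; rewrite /= ?(lrmorph0 (alg_pi J)) ?(lrmorph1 (alg_pi J)) /=
  ?mulr0 ?mulr1 ?mulr0n ?mulr1n ?subr0 ?sub0r //.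
Qed.

Lemma laurent_pi_ext (f g : laurent3 K -> laurent3 K) :
  (forall u, f (alg_pi J u) = g (alg_pi J u)) -> f =1 g.
Proof. by move=> e a; rewrite -[a]alg_reprK. Qed.

Lemma laurent_dyx a : laurent_dy (laurent_dx a) = laurent_dx (laurent_dy a).
Proof.
move: a; apply: laurent_pi_ext => u.
by rewrite !(laurent_dx_pi, laurent_dy_pi) mderiv_comm.
Qed.

Lemma laurent_dzx a : laurent_dz (laurent_dx a) = laurent_dx (laurent_dz a).
Proof.
move: a; apply: laurent_pi_ext => u.
rewrite !(laurent_dx_pi, laurent_dy_pi, laurent_dz_pi) /laurent_dz0; congr (alg_pi _ _).
rewrite !raddfB /= !mderivM !mderiv_mvar /= mul0r mulr0 addr0 mul0r add0r.
by rewrite (mderiv_comm (2 : 'I_4) (0 : 'I_4)) (mderiv_comm (3 : 'I_4) (0 : 'I_4)).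
Qed.

Lemma laurent_dzy a : laurent_dz (laurent_dy a) = laurent_dy (laurent_dz a).
Proof.
move: a; apply: laurent_pi_ext => u.
rewrite !(laurent_dx_pi, laurent_dy_pi, laurent_dz_pi) /laurent_dz0; congr (alg_pi _ _).
rewrite !raddfB /= !mderivM !mderiv_mvar /= mul0r mulr0 addr0 mul0r add0r.
by rewrite (mderiv_comm (2 : 'I_4) (1 : 'I_4)) (mderiv_comm (3 : 'I_4) (1 : 'I_4)).
Qed.

Lemma laurent_partial_x : is_partial laurent_dx (lvar K 0) (lvar K 1) (lvar K 2).
Proof. by split; rewrite ?laurent_dx_lvar //; apply: laurent_dx_derivation. Qed.
Lemma laurent_partial_y : is_partial laurent_dy (lvar K 1) (lvar K 0) (lvar K 2).
Proof. by split; rewrite ?laurent_dy_lvar //; apply: laurent_dy_derivation. Qed.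
Lemma laurent_partial_z : is_partial laurent_dz (lvar K 2) (lvar K 0) (lvar K 1).
Proof.
by split; rewrite ?laurent_dz_lvar ?subr0 //; apply: laurent_dz_derivation.
Qed.

Lemma generates_lvar : generates (@lvar K).
Proof. exact: (generates_alg_pi (J := J) (@generates_mvar K 4)). Qed.

Lemma laurent_lift (B : comAlgType K) (c : 'I_4 -> B) : c 2%R * c 3%R = 1 ->
  exists g : {lrmorphism laurent3 K -> B}, forall i, g (lvar K i) = c i.
Proof.
move=> cz; have [|g hg] := @quot_lift_exists K _ B J (mpoly_lift c).
  apply: smallest_ideal_kernel => _ ->.
  rewrite /= (lrmorphB (mpoly_lift c)) (lrmorphM (mpoly_lift c)) (lrmorph1 (mpoly_lift c)) /=.
  by rewrite !mpoly_lift_mvar cz subrr.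
by exists g => i; rewrite hg /= mpoly_lift_mvar.
Qed.

End CoordinateDerivations.

Section InvertibleGeneration.
Variables (K : fieldType) (A : comAlgType K).

(* Generation as an algebra with inverses, which covers K[x, y, z^+-1]. *)
Definition generates3 (x y z : A) : Prop :=
  forall S : set A, is_subalg S -> (forall u v, S u -> u * v = 1 -> S v) ->
  S x -> S y -> S z -> forall u, S u.

End InvertibleGeneration.

Lemma mpoly_generates3 (K : fieldType) :
  generates3 (mvar K (0 : 'I_3)) (mvar K (1 : 'I_3)) (mvar K (2 : 'I_3)).
Proof. by move=> S hS _ Sx Sy Sz; apply: (@generates_mvar K 3) => //; apply: ord3P. Qed.

Lemma laurent_generates3 (K : fieldType) :
  generates3 (lvar K 0) (lvar K 1) (lvar K 2).
Proof.
move=> S hS SV Sx Sy Sz; apply: (@generates_lvar K) => //; apply: ord4P => //.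
exact: SV (lvar_zw K).
Qed.

(** * Characters, brackets and kernels *)

Section CharacterEquations.
Variables (K : fieldType) (A : comAlgType K) (ev : {lrmorphism A -> K | *%R}).
Lemma ev0 : ev 0 = 0. Proof. exact: raddf0. Qed.
Lemma ev1 : ev 1 = 1. Proof. exact: rmorph1. Qed.
Lemma evN a : ev (- a) = - ev a. Proof. exact: raddfN. Qed.
Lemma evD a b : ev (a + b) = ev a + ev b. Proof. exact: raddfD. Qed.
Lemma evB a b : ev (a - b) = ev a - ev b. Proof. exact: raddfB. Qed.
Lemma evM a b : ev (a * b) = ev a * ev b. Proof. exact: rmorphM. Qed.
Lemma evZ k a : ev (k *: a) = k * ev a. Proof. exact: scalarZ. Qed.
Lemma evA (k : K) : ev k%:A = k. Proof. by rewrite evZ ev1 mulr1. Qed.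
Lemma evX a n : ev (a ^+ n) = ev a ^+ n. Proof. exact: rmorphXn. Qed.
Lemma ev_nat n : ev n%:R = n%:R. Proof. exact: rmorph_nat. Qed.
Definition evE := (ev0, ev1, evD, evB, evN, evM, evZ, evX, ev_nat).
End CharacterEquations.

Section PoissonEquations.
Variables (K : fieldType) (A : comAlgType K) (P : poisson A).
Lemma pbDr c u v : P c (u + v) = P c u + P c v.
Proof. by have := poisson_linear_r P c 1 u v; rewrite !scale1r. Qed.
Lemma pbDl c u v : P (u + v) c = P u c + P v c.
Proof. by have /= := poisson_linear_l P c 1 u v; rewrite !scale1r. Qed.
Lemma pb0r c : P c 0 = 0.
Proof. by have /eqP := pbDr c 0 0; rewrite addr0 -subr_eq subrr eq_sym => /eqP. Qed.
Lemma pbZr k c u : P c (k *: u) = k *: P c u.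
Proof. by have := poisson_linear_r P c k u 0; rewrite !addr0 pb0r addr0. Qed.
Lemma pbZl k c u : P (k *: u) c = k *: P u c.
Proof. by rewrite (poissonC P) pbZr -scalerN -(poissonC P). Qed.
Lemma pbNr c u : P c (- u) = - P c u.
Proof. by rewrite -scaleN1r pbZr scaleN1r. Qed.
Lemma pbNl c u : P (- u) c = - P u c.
Proof. by rewrite -scaleN1r pbZl scaleN1r. Qed.
Lemma pb1r c : P c 1 = 0.
Proof.
have /eqP := poisson_leibniz P c 1 1.
by rewrite !mul1r mulr1 -subr_eq subrr eq_sym => /eqP.
Qed.
Lemma pb1l c : P 1 c = 0.
Proof. by rewrite (poissonC P) pb1r oppr0. Qed.
End PoissonEquations.

Definition kernel_of (K : fieldType) (A : comAlgType K) (ev : {lrmorphism A -> K | *%R}) :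
  set A := [set a | ev a = 0]%classic.

Section Kernel.
Variables (K : fieldType) (A : comAlgType K) (ev : {lrmorphism A -> K | *%R}).

Lemma kernel_ideal : is_ideal (kernel_of ev).
Proof.
rewrite /kernel_of; split=> /=.
- exact: ev0.
- by move=> u v eu ev'; rewrite evD eu ev' addr0.
- by move=> a u eu; rewrite evM eu mulr0.
- by move=> a u eu; rewrite evM eu mul0r.
Qed.

Lemma kernel_maximal : is_maximal_ideal (kernel_of ev).
Proof.
split; first exact: kernel_ideal.
  by rewrite /kernel_of /= ev1 => /eqP; rewrite oner_eq0.
move=> I [I0 ID IM _] sub.
have [[a [Ia /eqP ea]]|none] := pselect (exists a, I a /\ ev a <> 0); [right|left].
  apply/seteqP; split=> // b _.
  have Ic : I (b - (ev b / ev a) *: a).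
    by apply: sub; rewrite /kernel_of /= evB evZ divfK ?subrr.
  have -> : b = (b - (ev b / ev a) *: a) + (ev b / ev a) *: a by rewrite subrK.
  by apply: ID => //; rewrite -mulr_algl; apply: IM.
apply/seteqP; split=> // b Ib; rewrite /kernel_of /=.
by apply: contrapT => eb; apply: none; exists b.
Qed.

Lemma ideal_square_mul a b : ev a = 0 -> ev b = 0 ->
  ideal_square (kernel_of ev) (a * b).
Proof. by move=> ea eb I [_]; apply; exists a => //; exists b. Qed.

Lemma ideal_square_ideal : is_ideal (ideal_square (kernel_of ev)).
Proof. exact: smallest_ideal_is_ideal. Qed.

End Kernel.

(* The local structure at a Poisson maximal ideal with residue field K: delta
   induces an isomorphism of J / J^2 onto sl_2. *)
Record sl2_point (K : fieldType) (A : comAlgType K) (P : poisson A)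
    (ev : {lrmorphism A -> K | *%R}) (delta : {linear A -> 'M[K]_2}) : Prop := Sl2Point {
  sl2p_ev : forall a b, ev (P a b) = 0;
  sl2p_tr : forall a, \tr (delta a) = 0;
  sl2p_der : forall a b, delta (a * b) = ev a *: delta b + ev b *: delta a;
  sl2p_br : forall a b, delta (P a b) = mx_commutator (delta a) (delta b);
  sl2p_surj : forall M, \tr M = 0 -> exists2 a, ev a = 0 & delta a = M;
  sl2p_ker : forall a, ev a = 0 -> delta a = 0 -> ideal_square (kernel_of ev) a }.

Section Sl2PointTheory.
Variables (K : fieldType) (A : comAlgType K) (P : poisson A).
Variables (ev : {lrmorphism A -> K | *%R}) (delta : {linear A -> 'M[K]_2}).
Hypothesis pt : sl2_point P ev delta.

Lemma sl2_point_poisson_ideal : is_poisson_ideal P (kernel_of ev).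
Proof.
by split; [apply: kernel_ideal | move=> i a _; apply: (sl2p_ev pt)].
Qed.

Lemma sl2_point_maximal : is_poisson_maximal P (kernel_of ev).
Proof. by split; [apply: kernel_maximal | apply: sl2_point_poisson_ideal]. Qed.

Lemma sl2_point_square a : ideal_square (kernel_of ev) a -> delta a = 0.
Proof.
move=> ha; pose S := [set v | ev v = 0 /\ delta v = 0]%classic.
suff [idS subS] : is_ideal S /\ ([set i * j | i in kernel_of ev & j in kernel_of ev] `<=` S)%classic.
  by have [] := ha S (conj idS subS).
split.
  split=> /=.
  - by rewrite /S /= ev0 raddf0.
  - by move=> u v [eu du] [ev' dv]; rewrite /S /= evD raddfD /= eu ev' du dv !addr0.
  - by move=> b u [eu du]; rewrite /S /= evM (sl2p_der pt) eu du mulr0 scaler0 scale0r addr0.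
  - by move=> b u [eu du]; rewrite /S /= evM (sl2p_der pt) eu du mul0r scaler0 scale0r addr0.
move=> _ [i ei] [j ej <-]; rewrite /kernel_of /= in ei ej.
by rewrite /S /= evM (sl2p_der pt) ei ej mul0r !scale0r addr0.
Qed.

(** On the kernel of [ev], [delta] is onto sl_2 with kernel the square of the ideal. The ideal is a
    variable with an equation because [cotangent_lie] depends on the given proof [hJ]. *)
Lemma sl2_point_cotangent (J : set A) (hJ : is_poisson_ideal P J) :
  J = kernel_of ev -> lie_iso (cotangent_lie hJ) (sl K 2).
Proof.
move=> JE; subst J.
set L := cotangent_lie hJ.
have in_sl (M : 'M[K]_2) : \tr M = 0 -> M \in submodule_pred (sl_submodule K 2).
  by move=> trM; rewrite submodule_predE; apply/asboolP.
pose to_sl (a : A) : sl K 2 :=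
  (Sub (delta a) (in_sl _ (sl2p_tr pt a)) : sub_lmod (sl_submodule K 2)).
pose phi (u : L) : sl K 2 := to_sl (val (quot_repr u)).
have ker_val (u : sub_lmod (ideal_submodule hJ.1)) : ev (val u) = 0.
  exact: (sub_lmodP (hJ := hJ) u).
have phi_pi (u : sub_lmod (ideal_submodule hJ.1)) :
    phi (quot_pi (cotangent_submodule hJ) u) = to_sl (val u).
  apply: val_inj => /=; apply/eqP; rewrite -subr_eq0 -raddfB /=; apply/eqP.
  apply: sl2_point_square; rewrite -val_sub_lmodB.
  exact: (quot_repr_pi (cotangent_submodule hJ)).
have phi_lin : linear phi.
  move=> k u v; rewrite -[u]quot_reprK -[v]quot_reprK -linearP !phi_pi.
  apply: val_inj; rewrite [RHS](val_sub_lmodP (N := sl_submodule K 2)) /=.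
  by rewrite -[RHS](linearP delta); congr (delta _).
pose Phi : {linear L -> sl K 2} := HB.pack phi (GRing.isLinear.Build K L (sl K 2) _ phi phi_lin).
exists Phi; last first.
  have br u v : phi (cotangent_br (hJ := hJ) (quot_pi _ u) (quot_pi _ v)) =
      lie_br (phi (quot_pi _ u)) (phi (quot_pi _ v)).
    rewrite cotangent_brE !phi_pi; apply: val_inj.
    exact: (sl2p_br pt).
  by move=> u v; rewrite -[u]quot_reprK -[v]quot_reprK; apply: br.
have phi_inj : injective phi.
  move=> u v; rewrite -[u]quot_reprK -[v]quot_reprK !phi_pi => /(congr1 val) /= e.
  apply/quot_piP; apply: (sl2p_ker pt); rewrite val_sub_lmodB.
    by rewrite evB !ker_val subrr.
  by rewrite raddfB /= e subrr.
have phi_surj (M : sl K 2) : exists u, phi u = M.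
  have trM : \tr (val M) = 0.
    by have := valP (M : sub_lmod (sl_submodule K 2)); rewrite submodule_predE => /asboolP.
  have [a ea da] := sl2p_surj pt trM.
  have Ja : a \in submodule_pred (ideal_submodule hJ.1).
    by rewrite submodule_predE; apply/asboolP.
  exists (quot_pi (cotangent_submodule hJ) (Sub a Ja)); rewrite phi_pi.
  by apply: val_inj.
have [g gP] := choice phi_surj.
by exists g => u //=; apply: phi_inj; rewrite gP.
Qed.

End Sl2PointTheory.

(** * The differential at a singular point *)

Section Sl2PointIntro.
Variables (K : fieldType) (A : comAlgType K) (P : poisson A) (x y z : A).
Variables D1 D2 D3 : {linear A -> A}.
Hypotheses (D1x : is_partial D1 x y z) (D2y : is_partial D2 y x z)
  (D3z : is_partial D3 z x y).
Hypothesis gen : generates3 x y z.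
Variable ev : {lrmorphism A -> K | *%R}.
Hypotheses (ev_xy : ev (P x y) = 0) (ev_yz : ev (P y z) = 0) (ev_zx : ev (P z x) = 0).
Variables m1 m2 m3 : 'M[K]_2.

(** The differential at the point with dx, dy, dz sent to [m1], [m2], [m3]. Values are plain
    matrices, with the trace condition kept apart, so that linear identities need no subtype. *)
Definition differential (a : A) : 'M[K]_2 :=
  ev (D1 a) *: m1 + ev (D2 a) *: m2 + ev (D3 a) *: m3.
Local Notation delta := differential.

Fact differential_linear : linear delta.
Proof.
move=> k a b; rewrite /delta (linearP D1) (linearP D2) (linearP D3) !evD !evZ.
by lmod K ('M[K]_2 : lmodType K).
Qed.
HB.instance Definition _ :=
  GRing.isLinear.Build K A 'M[K]_2 _ delta differential_linear.

Let deltaD a b : delta (a + b) = delta a + delta b. Proof. exact: raddfD. Qed.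
Let deltaB a b : delta (a - b) = delta a - delta b. Proof. exact: raddfB. Qed.
Let deltaN a : delta (- a) = - delta a. Proof. exact: raddfN. Qed.
Let deltaZ k a : delta (k *: a) = k *: delta a. Proof. exact: linearZ. Qed.
Let delta0 : delta 0 = 0. Proof. exact: raddf0. Qed.

Hypotheses (tr1 : \tr m1 = 0) (tr2 : \tr m2 = 0) (tr3 : \tr m3 = 0).
Hypotheses (br12 : mx_commutator m1 m2 = delta (P x y))
  (br23 : mx_commutator m2 m3 = delta (P y z))
  (br31 : mx_commutator m3 m1 = delta (P z x)).
Hypothesis m_span : forall M, \tr M = 0 ->
  exists a b c : K, M = a *: m1 + b *: m2 + c *: m3.
Hypothesis m_free : forall a b c : K, a *: m1 + b *: m2 + c *: m3 = 0 ->
  [/\ a = 0, b = 0 & c = 0].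

Let ev_unit u v : u * v = 1 -> ev u != 0.
Proof.
move=> uv; apply/eqP => eu; have := congr1 ev uv.
by rewrite evM ev1 eu mul0r => /eqP; rewrite eq_sym oner_eq0.
Qed.

Let der1 (D : {linear A -> A}) : is_derivation D -> D 1 = 0.
Proof.
move=> hD; have /eqP := hD 1 1.
by rewrite !mul1r mulr1 -subr_eq subrr eq_sym => /eqP.
Qed.

Lemma differential_der a b : delta (a * b) = ev a *: delta b + ev b *: delta a.
Proof.
have [d1 _ _ _] := D1x; have [d2 _ _ _] := D2y; have [d3 _ _ _] := D3z.
rewrite /delta d1 d2 d3 !evD !evM.
by lmod K ('M[K]_2 : lmodType K).
Qed.

Lemma differential_x : delta x = m1.
Proof.
have [_ d1 _ _] := D1x; have [_ _ d2 _] := D2y; have [_ _ d3 _] := D3z.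
by rewrite /delta d1 d2 d3 ev0 ev1 scale1r !scale0r !addr0.
Qed.
Lemma differential_y : delta y = m2.
Proof.
have [_ _ d1 _] := D1x; have [_ d2 _ _] := D2y; have [_ _ _ d3] := D3z.
by rewrite /delta d1 d2 d3 ev0 ev1 scale1r !scale0r addr0 add0r.
Qed.
Lemma differential_z : delta z = m3.
Proof.
have [_ _ _ d1] := D1x; have [_ _ _ d2] := D2y; have [_ d3 _ _] := D3z.
by rewrite /delta d1 d2 d3 ev0 ev1 scale1r !scale0r !add0r.
Qed.

Lemma differential1 (k : K) : delta k%:A = 0.
Proof.
have [d1 _ _ _] := D1x; have [d2 _ _ _] := D2y; have [d3 _ _ _] := D3z.
by rewrite /delta (linZ D1) (linZ D2) (linZ D3) !der1 // !scaler0 ev0 !scale0r !addr0.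
Qed.

(** Derivations at a point that agree on u also agree on its inverse v: they vanish on u v = 1, and
    ev u is invertible in the field. *)
Lemma derivation_at_point_eq (M : lmodType K) (f g : {linear A -> M}) :
  (forall a b, f (a * b) = ev a *: f b + ev b *: f a) ->
  (forall a b, g (a * b) = ev a *: g b + ev b *: g a) ->
  f x = g x -> f y = g y -> f z = g z -> f =1 g.
Proof.
move=> hf hg ex ey ez; apply: gen => //.
- have one (h : {linear A -> M}) :
      (forall a b, h (a * b) = ev a *: h b + ev b *: h a) -> h 1 = 0.
    move=> /(_ 1 1) /eqP.
    by rewrite mulr1 ev1 scale1r -subr_eq subrr eq_sym => /eqP.
  split.
  + by move=> k; rewrite (linZ f) (linZ g) !one.
  + by move=> u v eu ev'; rewrite (linD f) (linD g) eu ev'.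
  + by move=> u v eu ev'; rewrite hf hg eu ev'.
- move=> u v eu uv; have u0 := ev_unit uv.
  have : f (u * v) = g (u * v).
    have one (h : {linear A -> M}) :
      (forall a b, h (a * b) = ev a *: h b + ev b *: h a) -> h 1 = 0.
      move=> /(_ 1 1) /eqP.
      by rewrite mulr1 ev1 scale1r -subr_eq subrr eq_sym => /eqP.
    by rewrite uv !one.
  by rewrite hf hg eu => /addIr /(scalerI u0).
Qed.

(** For fixed c, b |-> ev {c, b} is a derivation at the point, hence 0 once it is 0 on x, y, z. This
    is applied to each c in x, y, z and then, by antisymmetry, to arbitrary c. *)
Lemma ev_bracket0 a b : ev (P a b) = 0.
Proof.
have step c : ev (P c x) = 0 -> ev (P c y) = 0 -> ev (P c z) = 0 ->
    forall b, ev (P c b) = 0.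
  move=> cx cy cz; apply: gen => //.
  - split; first by move=> k; rewrite pbZr pb1r scaler0 ev0.
      by move=> u v eu ev'; rewrite pbDr evD eu ev' addr0.
    by move=> u v eu ev'; rewrite poisson_leibniz evD !evM eu ev' mul0r mulr0 addr0.
  - move=> u v eu uv; have := congr1 (fun w => ev (P c w)) uv.
    rewrite /= poisson_leibniz evD !evM eu mul0r add0r pb1r ev0 => /eqP.
    by rewrite mulf_eq0 (negPf (ev_unit uv)) => /eqP.
have neg u v : ev (P u v) = 0 -> ev (P v u) = 0.
  by move=> e; rewrite poissonC evN e oppr0.
have ex b' : ev (P x b') = 0.
  by apply: step; [rewrite poisson_alternating ev0 | | apply: neg].
have ey b' : ev (P y b') = 0.
  by apply: step; [apply: neg | rewrite poisson_alternating ev0 |].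
have ez b' : ev (P z b') = 0.
  by apply: step; [| apply: neg | rewrite poisson_alternating ev0].
by apply: step; apply: neg.
Qed.

(** For fixed a both sides are derivations at the point in b, the left one because all brackets
    vanish there; the relations between [m1], [m2], [m3] say that they agree on generators. *)
Lemma differential_br a b : delta (P a b) = mx_commutator (delta a) (delta b).
Proof.
pose F c : {linear A -> 'M[K]_2} := HB.pack (fun b => delta (P c b))
  (GRing.isLinear.Build K A 'M[K]_2 _ (fun b => delta (P c b))
    (fun k u v => etrans (congr1 delta (poisson_linear_r P c k u v)) (linearP delta _ _ _))).
pose G c : {linear A -> 'M[K]_2} := HB.pack (fun b => mx_commutator (delta c) (delta b))
  (GRing.isLinear.Build K A 'M[K]_2 _ (fun b => mx_commutator (delta c) (delta b))
    (fun k u v => etrans (congr1 (mx_commutator (delta c)) (linearP delta k u v))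
                   (mx_commutator_linear_r (delta c) k _ _))).
have derF c u v : F c (u * v) = ev u *: F c v + ev v *: F c u.
  rewrite /= poisson_leibniz deltaD !differential_der !ev_bracket0 !scale0r addr0 add0r.
  by rewrite addrC.
have derG c u v : G c (u * v) = ev u *: G c v + ev v *: G c u.
  by rewrite /= differential_der mx_commutator_linear_r
    -[_ *: delta u]addr0 mx_commutator_linear_r /mx_commutator mulmx0 mul0mx subrr addr0.
have neg u v : delta (P u v) = mx_commutator (delta u) (delta v) ->
    delta (P v u) = mx_commutator (delta v) (delta u).
  by move=> e; rewrite poissonC deltaN e /mx_commutator opprB.
have alt u : delta (P u u) = mx_commutator (delta u) (delta u).
  by rewrite poisson_alternating delta0 /mx_commutator subrr.
have exy : delta (P x y) = mx_commutator (delta x) (delta y).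
  by rewrite differential_x differential_y br12.
have eyz : delta (P y z) = mx_commutator (delta y) (delta z).
  by rewrite differential_y differential_z br23.
have ezx : delta (P z x) = mx_commutator (delta z) (delta x).
  by rewrite differential_z differential_x br31.
have step c : F c x = G c x -> F c y = G c y -> F c z = G c z -> F c =1 G c.
  by move=> cx cy cz; apply: derivation_at_point_eq.
have ex := step x (alt x) exy (neg _ _ ezx).
have ey := step y (neg _ _ exy) (alt y) eyz.
have ez := step z ezx (neg _ _ eyz) (alt z).
exact: (step a (neg _ _ (ex a)) (neg _ _ (ey a)) (neg _ _ (ez a)) b).
Qed.

(** First-order Taylor expansion modulo J^2. Its use is that an element of J with zero differential
    lies in J^2. *)
Lemma taylor a : ideal_square (kernel_of ev)
  (a - (ev a)%:A - (ev (D1 a) *: (x - (ev x)%:A) + ev (D2 a) *: (y - (ev y)%:A)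
     + ev (D3 a) *: (z - (ev z)%:A))).
Proof.
have [d1 d1x d1y d1z] := D1x; have [d2 d2y d2x d2z] := D2y; have [d3 d3z d3x d3y] := D3z.
have [I0 ID IM _] := ideal_square_ideal ev.
have IZ k u : ideal_square (kernel_of ev) u -> ideal_square (kernel_of ev) (k *: u).
  by move=> Iu; rewrite -mulr_algl; apply: (IM).
pose lin u := ev (D1 u) *: (x - (ev x)%:A) + ev (D2 u) *: (y - (ev y)%:A)
     + ev (D3 u) *: (z - (ev z)%:A).
have linP u v k : lin (k *: u + v) = k *: lin u + lin v.
  by rewrite /lin (linearP D1) (linearP D2) (linearP D3) !evD !evZ; lmod K (A : lmodType K).
have linM u v : lin (u * v) = ev u *: lin v + ev v *: lin u.
  by rewrite /lin d1 d2 d3 !evD !evM; lmod K (A : lmodType K).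
have lin1 : lin 1 = 0 by rewrite /lin (der1 d1) (der1 d2) (der1 d3) !raddf0 !scale0r !addr0.
have lin00 : lin 0 = 0 by rewrite /lin !raddf0 !scale0r !addr0.
have prod u v : ideal_square (kernel_of ev) ((u - (ev u)%:A) * (v - (ev v)%:A)).
  by apply: ideal_square_mul; rewrite evB evA subrr.
have prodE u v : (u - (ev u)%:A) * (v - (ev v)%:A) =
    u * v - ev u *: v - ev v *: u + (ev u * ev v)%:A.
  rewrite !(mulrBl, mulrBr) mulr_algl !mulr_algr scalerA opprB.
  by rewrite [ev v * _]mulrC; lmod K (A : lmodType K).
apply: (gen (S := fun a => ideal_square (kernel_of ev) (a - (ev a)%:A - lin a))).
- split.
  + by move=> k; rewrite -[k *: 1]addr0 linP lin1 lin00 addr0 evA scaler0 addr0 subrr subr0.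
  + move=> u v Iu Iv.
    have -> : u + v - (ev (u + v))%:A - lin (u + v) =
        (u - (ev u)%:A - lin u) + (v - (ev v)%:A - lin v).
      rewrite -[u in lin (u + v)]scale1r linP evD.
      by lmod K (A : lmodType K).
    exact: ID.
  + move=> u v Iu Iv.
    have -> : u * v - (ev (u * v))%:A - lin (u * v) =
        (u - (ev u)%:A) * (v - (ev v)%:A) +
        (ev u *: (v - (ev v)%:A - lin v) + ev v *: (u - (ev u)%:A - lin u)).
      by rewrite prodE linM evM; lmod K (A : lmodType K).
    by apply: (ID) => //; apply: (ID); apply: IZ.
- move=> u v Iu uv; have u0 := ev_unit uv.
  have euv : ev u * ev v = 1 by rewrite -evM uv ev1.
  have evv : ev v = (ev u)^-1 by apply: (mulfI u0); rewrite euv mulfV.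
  have linv : lin v = - (ev v * ev v) *: lin u.
    have := linM u v; rewrite uv lin1 => /esym /eqP; rewrite addr_eq0 => /eqP e.
    apply: (scalerI u0); rewrite e scalerA mulrN mulrA euv mul1r scaleNr //.
  (* For u v = 1 the remainder of v is a combination of a product of two elements of J and of the
     remainder of u. *)
  have -> : v - (ev v)%:A - lin v =
      (- ev v) *: ((u - (ev u)%:A) * (v - (ev v)%:A)) +
      - (ev v * ev v) *: (u - (ev u)%:A - lin u).
    rewrite prodE linv uv evv.
    by lmod_coefs K (A : lmodType K); field.
  by apply: ID; apply: IZ.
- by rewrite /lin d1x d2x d3x ev0 ev1 scale1r !scale0r !addr0 subrr.
- by rewrite /lin d1y d2y d3y ev0 ev1 scale1r !scale0r addr0 add0r subrr.
- by rewrite /lin d1z d2z d3z ev0 ev1 scale1r !scale0r !add0r subrr.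
Qed.

Lemma sl2_point_intro : sl2_point P ev delta.
Proof.
split.
- exact: ev_bracket0.
- by move=> a; rewrite !linearD !linearZ /= tr1 tr2 tr3 !mulr0 !addr0.
- exact: differential_der.
- exact: differential_br.
- move=> M /m_span [a [b [c ->]]].
  exists (a *: (x - (ev x)%:A) + b *: (y - (ev y)%:A) + c *: (z - (ev z)%:A)).
    by rewrite !evD !evZ !evB !evA !subrr !mulr0 !addr0.
  rewrite /= !deltaD !deltaZ !deltaB !differential1 !subr0.
  by rewrite differential_x differential_y differential_z.
- move=> a ea /m_free [a1 a2 a3]; have := taylor a.
  by rewrite ea a1 a2 a3 !scale0r !addr0 !subr0.
Qed.

End Sl2PointIntro.

(** * Simple Poisson modules *)

Lemma mx2P (K : fieldType) (A B : 'M[K]_2) :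
  A 0 0 = B 0 0 -> A 0 1 = B 0 1 -> A 1 0 = B 1 0 -> A 1 1 = B 1 1 -> A = B.
Proof.
have ord2 (i : 'I_2) : i = 0 \/ i = 1.
  by case: i => [[|[|//]] p]; [left | right]; apply: val_inj.
by move=> e00 e01 e10 e11; apply/matrixP => i j;
  case: (ord2 i) => ->; case: (ord2 j) => ->.
Qed.

Lemma mxtrace2 (K : fieldType) (A : 'M[K]_2) : \tr A = A 0 0 + A 1 1.
Proof.
rewrite /mxtrace !big_ord_recl big_ord0 addr0; congr (A _ _ + A _ _); exact: val_inj.
Qed.

Lemma mulmx2 (K : fieldType) (A B : 'M[K]_2) i j :
  (A *m B) i j = A i 0 * B 0 j + A i 1 * B 1 j.
Proof.
rewrite mxE !big_ord_recl big_ord0 addr0.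
by congr (A _ _ * B _ _ + A _ _ * B _ _); apply: val_inj.
Qed.

Lemma mx_commutator2 (K : fieldType) (A B : 'M[K]_2) i j :
  mx_commutator A B i j =
    A i 0 * B 0 j + A i 1 * B 1 j - (B i 0 * A 0 j + B i 1 * A 1 j).
Proof.
have subE (X Y : 'M[K]_2) : (X - Y) i j = X i j - Y i j by rewrite !mxE.
by rewrite /mx_commutator subE !mulmx2.
Qed.

(** * The simple sl_2-module of dimension d *)

Section StandardRepresentation.
Variables (K : numClosedFieldType) (d : nat).
Implicit Types u : 'rV[K]_d.

(* Coordinates are extended by 0, so that the formulas below need no case
   distinction at the top index. *)
Definition entry u (j : nat) : K := if insub j is Some j' then u 0 j' else 0.

Lemma entry_ord u (j : 'I_d) : entry u j = u 0 j.
Proof. by rewrite /entry valK. Qed.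
Lemma entry_out u j : (d <= j)%N -> entry u j = 0.
Proof. by move=> dj; rewrite /entry insubF // ltnNge dj. Qed.
Lemma entry_row (g : nat -> K) j : entry (\row_(i < d) g i) j = if (j < d)%N then g j else 0.
Proof. by rewrite /entry; case: insubP => [i -> <-|/negPf ->] //; rewrite mxE. Qed.
Lemma entry_ext u v : (forall j, entry u j = entry v j) -> u = v.
Proof. by move=> e; apply/rowP => j; rewrite -!entry_ord. Qed.
Lemma entryP k u v j : entry (k *: u + v) j = k * entry u j + entry v j.
Proof. by rewrite /entry; case: insub => [i|]; rewrite ?mxE // mulr0 addr0. Qed.
Lemma entry0 j : entry 0 j = 0.
Proof. by rewrite /entry; case: insub => [i|] //; rewrite mxE. Qed.
Lemma entryZ k u j : entry (k *: u) j = k * entry u j.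
Proof. by rewrite -[k *: u]addr0 entryP entry0 addr0. Qed.
Lemma entryD u v j : entry (u + v) j = entry u j + entry v j.
Proof. by rewrite -[u]scale1r entryP mul1r scale1r. Qed.
Lemma entryN u j : entry (- u) j = - entry u j.
Proof. by rewrite -scaleN1r entryZ mulN1r. Qed.

(** The basis is v_j = f^j v_0 with v_0 of highest weight d - 1: then f is a shift, v_j has weight d
    - 1 - 2 j, and e v_(j+1) = (j + 1) (d - 1 - j) v_j. *)
Definition std_h u : 'rV[K]_d := \row_(j < d) ((d%:R - 1 - j%:R *+ 2) * entry u j).
Definition std_f u : 'rV[K]_d := \row_(j < d) (if (j : nat) is i.+1 then entry u i else 0).
Definition std_e u : 'rV[K]_d :=
  \row_(j < d) (j.+1%:R * (d%:R - 1 - j%:R) * entry u j.+1).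

Lemma entry_h u j : entry (std_h u) j = (d%:R - 1 - j%:R *+ 2) * entry u j.
Proof.
rewrite (entry_row (fun j => (d%:R - 1 - j%:R *+ 2) * entry u j)).
by case: ltnP => // dj; rewrite entry_out ?mulr0.
Qed.
Lemma entry_e u j : entry (std_e u) j = j.+1%:R * (d%:R - 1 - j%:R) * entry u j.+1.
Proof.
rewrite (entry_row (fun j => j.+1%:R * (d%:R - 1 - j%:R) * entry u j.+1)).
by case: ltnP => // dj; rewrite entry_out ?mulr0 // leqW.
Qed.
Lemma entry_f0 u : entry (std_f u) 0 = 0.
Proof.
by rewrite (entry_row (fun j => if j is i.+1 then entry u i else 0)) if_same.
Qed.
Lemma entry_fS u j : entry (std_f u) j.+1 = if (j.+1 < d)%N then entry u j else 0.
Proof. exact: (entry_row (fun j => if j is i.+1 then entry u i else 0)). Qed.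

Fact std_h_linear : linear std_h.
Proof. by move=> k u v; apply: entry_ext => j; rewrite entryP !entry_h entryP; ring. Qed.
Fact std_e_linear : linear std_e.
Proof. by move=> k u v; apply: entry_ext => j; rewrite entryP !entry_e entryP; ring. Qed.
Fact std_f_linear : linear std_f.
Proof.
move=> k u v; apply: entry_ext => -[|j]; rewrite entryP ?entry_f0 ?mulr0 ?addr0 //.
by rewrite !entry_fS entryP; case: ifP => // _; rewrite mulr0 addr0.
Qed.
HB.instance Definition _ := GRing.isLinear.Build K 'rV[K]_d 'rV[K]_d _ std_h std_h_linear.
HB.instance Definition _ := GRing.isLinear.Build K 'rV[K]_d 'rV[K]_d _ std_e std_e_linear.
HB.instance Definition _ := GRing.isLinear.Build K 'rV[K]_d 'rV[K]_d _ std_f std_f_linear.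

Lemma std_ef u : std_e (std_f u) = std_f (std_e u) + std_h u.
Proof.
apply: entry_ext => j; rewrite entryD entry_e entry_h entry_fS.
case: j => [|j].
  rewrite entry_f0 add0r; case: ifP => [_|d1]; first by ring.
  case: (posnP d) => [d0|d_gt0].
    by rewrite mulr0 entry_out ?mulr0 // d0.
  have -> : d = 1%N by apply/eqP; rewrite eqn_leq d_gt0 andbT leqNgt d1.
  by ring.
rewrite entry_fS entry_e; case: ltnP => [lt_jd|le_dj].
  by rewrite (ltnW lt_jd) -!natr1; ring.
rewrite mulr0; case: ltnP => [lt_jd|le_dj']; last by rewrite entry_out ?mulr0 ?addr0 // leqW.
(* At the top index j + 1 = d - 1 the shift cuts off the left side, and the right side vanishes too:
   (j + 1) + (d - 1 - 2 (j + 1)) = 0. *)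
have -> : d = j.+2 by apply/eqP; rewrite eqn_leq le_dj lt_jd.
by rewrite -!natr1; ring.
Qed.

Lemma std_he u : std_h (std_e u) = std_e (std_h u) + 2%:R *: std_e u.
Proof.
apply: entry_ext => j; rewrite entryD entryZ !(entry_e, entry_h) -!natr1; ring.
Qed.

Lemma std_hf u : std_h (std_f u) = std_f (std_h u) - 2%:R *: std_f u.
Proof.
apply: entry_ext => -[|j]; rewrite entryD entryN entryZ !entry_h.
  by rewrite !entry_f0; ring.
by rewrite !entry_fS; case: ifP => _; rewrite ?entry_h -?natr1; ring.
Qed.

Definition std_rep (M : 'M[K]_2) u : 'rV[K]_d :=
  M 0 1 *: std_e u + M 1 0 *: std_f u + M 0 0 *: std_h u.

Lemma std_rep_linear M : linear (std_rep M).
Proof.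
move=> k u v; rewrite /std_rep !(linE std_e, linE std_f, linE std_h).
by lmod (K : fieldType) ('rV[K]_d : lmodType K).
Qed.
HB.instance Definition _ M :=
  GRing.isLinear.Build K 'rV[K]_d 'rV[K]_d _ (std_rep M) (std_rep_linear M).

Lemma std_rep_commutator (A B : 'M[K]_2) u : \tr A = 0 -> \tr B = 0 ->
  std_rep (mx_commutator A B) u =
  std_rep A (std_rep B u) - std_rep B (std_rep A u).
Proof.
have tr11 (M : 'M[K]_2) : \tr M = 0 -> M 1 1 = - M 0 0.
  by rewrite mxtrace2 => /eqP; rewrite addrC addr_eq0 => /eqP.
move=> /tr11 A11 /tr11 B11.
rewrite /std_rep !(linE std_e, linE std_f, linE std_h) /=.
rewrite !(std_ef, std_he, std_hf).
rewrite !mx_commutator2 A11 B11.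
by lmod (K : fieldType) ('rV[K]_d : lmodType K).
Qed.

(** The exact coefficient is irrelevant, only that it is nonzero inside the range: e^j maps a vector
    with top index j to a nonzero multiple of v_0. *)
Lemma std_iter_e u j : exists2 c : nat -> K,
  (forall i, (i + j < d)%N -> c i != 0) &
  forall i, entry (iter j std_e u) i = c i * entry u (i + j).
Proof.
elim: j => [|j [c c0 IH]].
  by exists (fun _ => 1) => [i _|i]; rewrite ?oner_eq0 // mul1r addn0.
exists (fun i => i.+1%:R * (d%:R - 1 - i%:R) * c i.+1) => [i lt|i]; last first.
  by rewrite /= entry_e IH mulrA addSnnS.
rewrite !mulf_neq0 ?pnatr_eq0 ?c0 ?addSnnS //.
have i1d : (i.+1 < d)%N by apply: leq_ltn_trans lt; rewrite addnS ltnS leq_addr.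
by rewrite -addrA -opprD nat1r -natrB 1?ltnW // pnatr_eq0 subn_eq0 -ltnNge.
Qed.

Hypothesis d_gt0 : (0 < d)%N.

(** If j is the top index of u, then e^j u is a nonzero multiple of v_0, and powers of f recover the
    whole basis from v_0. *)
Lemma std_irreducible (N : set 'rV[K]_d) (u : 'rV[K]_d) :
  (forall v w, N v -> N w -> N (v + w)) -> (forall k v, N v -> N (k *: v)) ->
  (forall v, N v -> N (std_e v)) -> (forall v, N v -> N (std_f v)) ->
  N u -> u <> 0 -> forall v, N v.
Proof.
move=> ND NZ Ne Nf Nu u0.
have [j uj0 j_max] : exists2 j, entry u j != 0 & forall k, (j < k)%N -> entry u k = 0.
  have ex : exists j, entry u j != 0.
    apply: contrapT => none; apply: u0; apply: entry_ext => j; rewrite entry0.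
    by apply/eqP; apply: contrapT => /negP uj; apply: none; exists j.
  have bound k : entry u k != 0 -> (k <= d)%N.
    by apply: contraNT; rewrite -ltnNge => /ltnW /entry_out ->.
  case: (ex_maxnP ex bound) => j uj jmax; exists j => // k jk.
  by apply/eqP; apply: contraTT jk => /jmax; rewrite -leqNgt.
have jd : (j < d)%N by rewrite ltnNge; apply: contra uj0 => /entry_out ->.
pose e0 : 'rV[K]_d := \row_(i < d) (i == 0%N :> nat)%:R.
have entry_e0 i : entry e0 i = (i == 0%N)%:R.
  rewrite (entry_row (fun i => (i == 0%N)%:R)); case: ltnP => // di.
  by rewrite gtn_eqF // (leq_trans d_gt0 di).
have Ne0 : N e0.
  have [c c0 cE] := std_iter_e u j.
  have -> : e0 = (c 0%N * entry u j)^-1 *: iter j std_e u.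
    apply: entry_ext => i; rewrite entryZ cE entry_e0.
    case: i => [|i]; first by rewrite add0n mulVf // mulf_neq0 // c0.
    by rewrite (j_max (i.+1 + j)%N) ?mulr0 // addSn ltnS leq_addl.
  apply: NZ; elim: (j) => [//|k IHk]; exact: Ne.
pose b k : 'rV[K]_d := \row_(i < d) (i == k :> nat)%:R.
have entry_b k i : entry (b k) i = if (i < d)%N then (i == k)%:R else 0.
  exact: (entry_row (fun i => (i == k)%:R)).
have Nb k : N (b k).
  elim: k => [//|k IHk].
  have -> : b k.+1 = std_f (b k).
    apply: entry_ext => -[|i]; first by rewrite entry_f0 entry_b if_same.
    rewrite entry_fS !entry_b eqSS; case: ifP => // id.
    by rewrite (ltnW id).
  exact: Nf.
move=> v.
have -> : v = \sum_(i < d) v 0 i *: b i.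
  apply/rowP => k; rewrite summxE (bigD1 k) //= !mxE eqxx mulr1 big1 ?addr0 // => i ik.
  by rewrite !mxE [_ == _](_ : _ = false) ?mulr0 //; apply/negbTE; rewrite eq_sym.
elim/big_ind: _ => //; last by move=> i _; apply: NZ.
by rewrite -(scale0r u); apply: NZ.
Qed.

End StandardRepresentation.

Section FiniteDimension.
Variables (K : fieldType) (M : lmodType K) (d : nat).
Variable phi : {linear 'rV[K]_d -> M}.

Lemma linear_inverse (psi : M -> 'rV[K]_d) : cancel phi psi -> cancel psi phi ->
  linear psi.
Proof.
move=> phiK psiK k u v; apply: (can_inj phiK).
by rewrite psiK linearP /= !psiK.
Qed.

Hypothesis phi_bij : bijective phi.

Lemma dim_injective (m : nat) (g : {linear 'rV[K]_m -> M}) : injective g -> (m <= d)%N.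
Proof.
have [psi phiK psiK] := phi_bij.
pose Psi : {linear M -> 'rV[K]_d} :=
  HB.pack psi (GRing.isLinear.Build K M 'rV[K]_d _ psi (linear_inverse phiK psiK)).
move=> g_inj; pose B := lin1_mx (Psi \o g).
suff : row_free B by move=> /eqP <-; apply: rank_leq_col.
apply: inj_row_free => v; rewrite mul_rV_lin1 /= => /(congr1 phi).
by rewrite psiK raddf0 -(raddf0 g) => /g_inj.
Qed.

Lemma nilpotent_bound (T : {linear M -> M}) :
  (forall m, exists n, iter n T m = 0) -> exists n, forall m, iter n T m = 0.
Proof.
move=> Tnil.
have iter0 n : iter n T 0 = 0 by elim: n => //= n ->; rewrite raddf0.
have iterP n k u v : iter n T (k *: u + v) = k *: iter n T u + iter n T v.
  by elim: n => //= n ->; rewrite linearP.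
have iterW n n' m : (n <= n')%N -> iter n T m = 0 -> iter n' T m = 0.
  by move=> le e; rewrite -(subnK le) iterD e iter0.
have [s sP] := choice (fun i : 'I_d => Tnil (phi (delta_mx 0 i))).
have [N sN] : exists N, forall i, (s i <= N)%N.
  by exists (\max_i s i)%N => i; apply: leq_bigmax.
exists N => m; have [psi phiK psiK] := phi_bij.
rewrite -[m]psiK [psi m]row_sum_delta linear_sum.
elim/big_ind: _ => [|u v eu ev|i _]; first exact: iter0.
  by rewrite -[u]scale1r iterP eu ev scaler0 addr0.
rewrite (linZ phi) -[_ *: phi _]addr0 iterP iter0 addr0.
by rewrite (iterW (s i)) ?scaler0.
Qed.

End FiniteDimension.

(** * Simple sl_2-modules are standard *)

Section Sl2Modules.
Variables (K : numClosedFieldType) (M : lmodType K) (e f h : {linear M -> M}).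
Hypothesis ef : forall m, e (f m) = f (e m) + h m.
Hypothesis he : forall m, h (e m) = e (h m) + 2%:R *: e m.
Hypothesis hf : forall m, h (f m) = f (h m) - 2%:R *: f m.

(** The eigenvalues form an arithmetic progression, distinct in characteristic 0; the step [s] is 2
    along powers of e and - 2 along powers of f. *)
Lemma weight_independent (lam s : K) (w : nat -> M) (n : nat) : s != 0 ->
  (forall k, h (w k) = (lam + s * k%:R) *: w k) ->
  (forall k, (k < n)%N -> w k <> 0) ->
  forall c : nat -> K, \sum_(k < n) c k *: w k = 0 -> forall k, (k < n)%N -> c k = 0.
Proof.
move=> s0 hw; elim: n => [//|n IH] w0 c sum0.
have c0 k : (k < n)%N -> c k = 0.
  move=> kn; have wn k' : (k' < n)%N -> w k' <> 0 by move=> ?; apply: w0; apply: leqW.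
  have := IH wn (fun k => c k * (s * (k%:R - n%:R))) _ k kn.
  move=> /(_ _) /eqP; rewrite !mulf_eq0 (negPf s0) /=.
  rewrite subr_eq0 eqr_nat ltn_eqF // orbF => ck; apply/eqP/ck.
  (* Applying h - (lam + s n) kills the last term and multiplies the k-th coefficient by s (k - n),
     which is nonzero for k < n. *)
  have := congr1 (fun m => h m - (lam + s * n%:R) *: m) sum0.
  rewrite /= raddf0 scaler0 subr0; apply: etrans.
  rewrite linear_sum scaler_sumr -sumrB big_ord_recr /=.
  rewrite linearZ /= hw !scalerA [(lam + _) * _]mulrC subrr addr0.
  by apply: eq_bigr => i _; rewrite linearZ /= hw !scalerA -scalerBl; congr (_ *: _); ring.
move=> k; rewrite ltnS leq_eqVlt => /predU1P [->|/c0 //].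
move: sum0; rewrite big_ord_recr /= big1 ?add0r => [/eqP|i _]; last by rewrite c0 ?scale0r.
rewrite scaler_eq0 => /orP [/eqP //|/eqP wn0]; by case: (w0 n).
Qed.

Variables (d : nat) (phi : {linear 'rV[K]_d -> M}).
Hypotheses (d_gt0 : (0 < d)%N) (phi_bij : bijective phi).

Lemma exists_eigenvector (T : {linear M -> M}) :
  exists (lam : K) (m : M), T m = lam *: m /\ m <> 0.
Proof.
have [psi phiK psiK] := phi_bij.
pose Psi : {linear M -> 'rV[K]_d} :=
  HB.pack psi (GRing.isLinear.Build K M 'rV[K]_d _ psi (linear_inverse phiK psiK)).
have [lam] := eigenvalue_closed (lin1_mx (Psi \o (T \o phi))) d_gt0.
move=> /eigenvalueP [v]; rewrite mul_rV_lin1 /= => vE v0.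
exists lam, (phi v); split.
  by rewrite -[LHS]psiK vE linearZ.
by rewrite -(raddf0 phi) => /(can_inj phiK) /eqP; rewrite (negPf v0).
Qed.

Lemma weight_vanish (lam s : K) (w : nat -> M) : s != 0 ->
  (forall k, h (w k) = (lam + s * k%:R) *: w k) -> exists k, w k = 0.
Proof.
move=> s0 hw; apply: contrapT => none.
have w0 k : w k <> 0 by move=> wk; apply: none; exists k.
pose g (c : 'rV[K]_d.+1) : M := \sum_(k < d.+1) c 0 k *: w k.
have g_lin : linear g.
  move=> k u v; rewrite /g scaler_sumr -big_split /=; apply: eq_bigr => i _.
  by rewrite !mxE scalerDl scalerA.
pose G : {linear 'rV[K]_d.+1 -> M} := HB.pack g (GRing.isLinear.Build K _ _ _ g g_lin).
have : injective G.
  move=> u v e_uv; apply/rowP => k; apply/eqP; rewrite -subr_eq0; apply/eqP.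
  have := weight_independent (n := d.+1) s0 hw (fun k _ => w0 k) (c := entry (u - v)) _ (ltn_ord k).
  rewrite entry_ord !mxE; apply.
  have : G (u - v) = 0 by rewrite raddfB /= /G /= in e_uv *; rewrite e_uv subrr.
  by apply: etrans; apply: eq_bigr => i _; rewrite entry_ord.
by move/(dim_injective phi_bij); rewrite ltnn.
Qed.

Lemma first_zero (w : nat -> M) : w 0%N <> 0 -> (exists k, w k = 0) ->
  exists n, w n.+1 = 0 /\ forall k, (k <= n)%N -> w k <> 0.
Proof.
move=> w0 [k wk]; have ex : exists k, `[< w k = 0 >] by exists k; apply/asboolP.
case: (ex_minnP ex) => -[|n] /asboolP wn min; first by case: w0.
exists n; split=> // j jn wj; have := min j; rewrite asboolT // => /(_ isT).
by rewrite ltnNge jn.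
Qed.

(** Along e the eigenvalue of h rises by 2, so in finite dimension the sequence e^k w must reach 0;
    its last nonzero term is the vector. *)
Lemma highest_weight_vector :
  exists (mu : K) (v : M), [/\ v <> 0, e v = 0 & h v = mu *: v].
Proof.
have [lam [w [hw w0]]] := exists_eigenvector h.
have hek k : h (iter k e w) = (lam + 2%:R * k%:R) *: iter k e w.
  elim: k => [|k IH]; first by rewrite mulr0 addr0.
  rewrite /= he IH linearZ -scalerDl -natr1; congr (_ *: _); ring.
have [n [en0 en]] := first_zero (w := fun k => iter k e w) w0
  (weight_vanish (s := 2%:R) (negbT (pnatr_eq0 K 2)) hek).
by exists (lam + 2%:R * n%:R), (iter n e w); split=> //; apply: en.
Qed.

Hypothesis irr : forall N : set M,
  (forall u v, N u -> N v -> N (u + v)) -> (forall k u, N u -> N (k *: u)) ->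
  (forall u, N u -> N (e u)) -> (forall u, N u -> N (f u)) -> (forall u, N u -> N (h u)) ->
  forall u, N u -> u <> 0 -> forall v, N v.

(** The vectors f^k v0 span by irreducibility. Their number n + 1 is identified with d only at the
    end, by comparing two linear bijections. *)
Lemma sl2_module_standard :
  exists g : {linear 'rV[K]_d -> M}, [/\ bijective g,
    forall u, g (std_e u) = e (g u), forall u, g (std_f u) = f (g u) &
    forall u, g (std_h u) = h (g u)].
Proof.
have [mu [v0 [v0_neq0 ev0 hv0]]] := highest_weight_vector.
pose v k := iter k f v0.
have hv k : h (v k) = (mu + (- 2%:R) * k%:R) *: v k.
  elim: k => [|k IH]; first by rewrite mulr0 addr0.
  rewrite /v /= hf -/(v k) IH linearZ -scalerBl -natr1; congr (_ *: _); ring.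
have ev k : e (v k.+1) = (k.+1%:R * (mu - k%:R)) *: v k.
  elim: k => [|k IH].
    by rewrite /v /= ef ev0 raddf0 add0r hv0 mul1r subr0.
  rewrite [v k.+2]/(f (v k.+1)) ef IH linearZ -/(v k.+1) hv -scalerDl -!natr1.
  by congr (_ *: _); ring.
have fv k : f (v k) = v k.+1 by [].
have two0 : - 2%:R != 0 :> K by rewrite oppr_eq0 pnatr_eq0.
have [n [vn0 vn]] := first_zero v0_neq0 (weight_vanish two0 hv).
(* Here 0 = e (v (n + 1)) = (n + 1) (mu - n) v n, and v n is nonzero. *)
have muE : mu = n%:R.
  have := ev n; rewrite vn0 raddf0 => /esym /eqP.
  rewrite scaler_eq0 mulf_eq0 pnatr_eq0 /= subr_eq0 => /orP [/eqP //|/eqP].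
  by move/(vn n (leqnn n)).
pose g (c : 'rV[K]_n.+1) : M := \sum_(k < n.+1) entry c k *: v k.
have g_lin : linear g.
  move=> k u w; rewrite /g scaler_sumr -big_split /=; apply: eq_bigr => i _.
  by rewrite entryP scalerDl scalerA.
pose G : {linear 'rV[K]_n.+1 -> M} := HB.pack g (GRing.isLinear.Build K _ _ _ g g_lin).
have Gf u : G (std_f u) = f (G u).
  rewrite /= /g big_ord_recl entry_f0 scale0r add0r linear_sum [RHS]big_ord_recr /=.
  rewrite (linZ f) fv vn0 scaler0 addr0; apply: eq_bigr => i _.
  by rewrite entry_fS /= ltnS (ltn_ord i) (linZ f) fv.
have Ge u : G (std_e u) = e (G u).
  rewrite /= /g [LHS]big_ord_recr linear_sum [RHS]big_ord_recl /=.
  rewrite entry_e entry_out // mulr0 scale0r addr0 (linZ e) (_ : e (v (@ord0 n)) = 0) ?scaler0 ?add0r //.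
  apply: eq_bigr => i _; rewrite entry_e (linZ e) (_ : bump 0 i = i.+1) // ev scalerA muE -!natr1.
  by congr (_ *: _); ring.
have Gh u : G (std_h u) = h (G u).
  rewrite /= /g linear_sum; apply: eq_bigr => i _.
  by rewrite entry_h linearZ /= hv scalerA muE -!natr1; congr (_ *: _); ring.
have G_inj : injective G.
  move=> u w e_uw; apply/rowP => k; apply/eqP; rewrite -subr_eq0; apply/eqP.
  have := weight_independent (n := n.+1) two0 hv vn (c := entry (u - w)) _ (ltn_ord k).
  rewrite entry_ord !mxE; apply.
  by rewrite -[LHS]/(G (u - w)) (linB G) e_uw subrr.
have G_surj m : exists u, G u = m.
  pose N : set M := [set m | exists u, G u = m]%classic.
  apply: (irr (N := N) _ _ _ _ _ (u := v0)) => //.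
  - by move=> _ _ [a <-] [b <-]; exists (a + b); rewrite raddfD.
  - by move=> k _ [a <-]; exists (k *: a); rewrite linearZ.
  - by move=> _ [a <-]; exists (std_e a).
  - by move=> _ [a <-]; exists (std_f a).
  - by move=> _ [a <-]; exists (std_h a).
  exists (\row_(i < n.+1) (i == 0%N :> nat)%:R); rewrite /= /g.
  rewrite big_ord_recl big1 => [|i _]; rewrite (@entry_row _ _ (fun i => (i == 0%N)%:R)) /=.
    by rewrite scale1r addr0.
  by rewrite if_same scale0r.
have G_bij : bijective G.
  have [G' GK] := choice G_surj; exists G' => // u.
  by apply: G_inj; rewrite GK.
have nd : n.+1 = d.
  apply/eqP; rewrite eqn_leq (dim_injective phi_bij G_inj) /=.
  by apply: (dim_injective G_bij (g := phi)); apply: bij_inj.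
by rewrite -nd; exists G; split.
Qed.

End Sl2Modules.

Section PoissonModuleEquations.
Variables (K : fieldType) (A : comAlgType K) (P : poisson A) (M : poisson_module P).
Implicit Types (a b : A) (m n : M).

Lemma pm_br0l m : pm_br 0 m = 0.
Proof.
have /eqP := pm_br_linear_l m 1 0 0.
by rewrite scale1r addr0 scale1r -subr_eq subrr eq_sym => /eqP.
Qed.
Lemma pm_br0r a : pm_br a (0 : M) = 0.
Proof.
have /eqP := pm_br_linear_r a 1 (0 : M) 0.
by rewrite scale1r addr0 scale1r -subr_eq subrr eq_sym => /eqP.
Qed.
Lemma pm_brDl a b m : pm_br (a + b) m = pm_br a m + pm_br b m.
Proof. by rewrite -[a in LHS]scale1r [LHS]pm_br_linear_l scale1r. Qed.
Lemma pm_brZl (k : K) a m : pm_br (k *: a) m = k *: pm_br a m.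
Proof. by rewrite -[k *: a]addr0 [LHS]pm_br_linear_l pm_br0l addr0. Qed.
Lemma pm_br1 m : pm_br (1 : A) m = 0.
Proof.
have /eqP := pm_br_mul (1 : A) 1 m.
by rewrite mul1r !pm_act1 -subr_eq subrr eq_sym => /eqP.
Qed.
Lemma pm_act0r a : pm_act a (0 : M) = 0.
Proof. by have /eqP := pm_actDr a (0 : M) 0; rewrite addr0 -subr_eq subrr eq_sym => /eqP. Qed.
Lemma pm_actZl (k : K) a m : pm_act (k *: a) m = k *: pm_act a m.
Proof. by rewrite -mulr_algl pm_actM pm_act_scale. Qed.
Lemma pm_actZr (k : K) a m : pm_act a (k *: m) = k *: pm_act a m.
Proof. by rewrite -pm_act_scale -pm_actM mulr_algr pm_actZl. Qed.
Lemma pm_actN a m : pm_act (- a) m = - pm_act a m.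
Proof. by rewrite -[- a]scaleN1r pm_actZl scaleN1r. Qed.
Lemma pm_actB a b m : pm_act (a - b) m = pm_act a m - pm_act b m.
Proof. by rewrite pm_actDl pm_actN. Qed.
Lemma pm_actC a b m : pm_act a (pm_act b m) = pm_act b (pm_act a m).
Proof. by rewrite -!pm_actM mulrC. Qed.

Fact pm_act_linear a : linear (@pm_act K A P M a).
Proof. by move=> k m n; rewrite pm_actDr pm_actZr. Qed.

Definition pm_act_lin a : {linear M -> M} :=
  HB.pack (@pm_act K A P M a) (GRing.isLinear.Build K M M _ _ (pm_act_linear a)).
Definition pm_br_lin a : {linear M -> M} :=
  HB.pack (@pm_br K A P M a) (GRing.isLinear.Build K M M _ _ (pm_br_linear_r a)).

Lemma pm_act_exp a (k : nat) m : pm_act (a ^+ k) m = iter k (pm_act a) m.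
Proof. by elim: k => [|k IH]; rewrite ?pm_act1 // exprS pm_actM IH. Qed.

End PoissonModuleEquations.

(** * Simple Poisson modules at a given point *)

Section IrreducibleModules.
Variables (K : numClosedFieldType) (A : comAlgType K) (P : poisson A).
Variables (ev : {lrmorphism A -> K | *%R}) (delta : {linear A -> 'M[K]_2}).
Hypothesis pt : sl2_point P ev delta.
Variable d : nat.
Local Notation V := 'rV[K]_d.

Let act (a : A) (m : V) : V := ev a *: m.
Let br (a : A) (m : V) : V := std_rep (delta a) m.

Fact irr_act1 m : act 1 m = m. Proof. by rewrite /act ev1 scale1r. Qed.
Fact irr_actM a b m : act (a * b) m = act a (act b m).
Proof. by rewrite /act evM scalerA. Qed.
Fact irr_actDl a b m : act (a + b) m = act a m + act b m.
Proof. by rewrite /act evD scalerDl. Qed.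
Fact irr_actDr a m n : act a (m + n) = act a m + act a n.
Proof. exact: scalerDr. Qed.
Fact irr_act_scale (k : K) m : act k%:A m = k *: m.
Proof. by rewrite /act evA. Qed.
Fact irr_br_linear_l m : linear (br^~ m).
Proof.
move=> k a b; rewrite /br linearP /std_rep !mxE.
by lmod (K : fieldType) (V : lmodType K).
Qed.
Fact irr_br_linear_r a : linear (br a).
Proof. exact: std_rep_linear. Qed.
Fact irr_br_lie a b m : br (P a b) m = br a (br b m) - br b (br a m).
Proof. by rewrite /br (sl2p_br pt) std_rep_commutator ?(sl2p_tr pt). Qed.
Fact irr_br_act a b m : br a (act b m) = act (P a b) m + act b (br a m).
Proof. by rewrite /br /act (sl2p_ev pt) scale0r add0r (linZ (std_rep (delta a))). Qed.
Fact irr_br_mul a b m : br (a * b) m = act a (br b m) + act b (br a m).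
Proof.
rewrite /br /act (sl2p_der pt) /std_rep !mxE.
by lmod (K : fieldType) (V : lmodType K).
Qed.

Definition irr_module : poisson_module P :=
  @PoissonModule K A P V act irr_act1 irr_actM irr_actDl irr_actDr irr_act_scale
    br irr_br_linear_l irr_br_linear_r irr_br_lie irr_br_act irr_br_mul.

Lemma irr_has_dim : has_dim irr_module d.
Proof. by exists idfun; exists idfun. Qed.

Lemma sl2_triple_lift : exists a b c : A,
  [/\ forall m, br a m = std_e m, forall m, br b m = std_f m &
      forall m, br c m = std_h m].
Proof.
pose E : 'M[K]_2 := delta_mx 0 1; pose F : 'M[K]_2 := delta_mx 1 0.
pose H : 'M[K]_2 := delta_mx 0 0 - delta_mx 1 1.
have trE : \tr E = 0 by rewrite mxtrace2 !mxE /= addr0.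
have trF : \tr F = 0 by rewrite mxtrace2 !mxE /= addr0.
have trH : \tr H = 0 by rewrite mxtrace2 !mxE /= subr0 sub0r subrr.
have [a _ da] := sl2p_surj pt trE; have [b _ db] := sl2p_surj pt trF.
have [c _ dc] := sl2p_surj pt trH.
exists a, b, c; split=> m; rewrite /br /std_rep ?da ?db ?dc !mxE /=.
- by rewrite scale1r !scale0r !addr0.
- by rewrite scale1r !scale0r add0r addr0.
- by rewrite !subr0 scale1r !scale0r !add0r.
Qed.

Hypothesis d_gt0 : (0 < d)%N.

Lemma irr_simple : simple_poisson_module irr_module.
Proof.
split.
  exists (const_mx 1 : V) => /rowP /(_ (Ordinal d_gt0)); rewrite !mxE => /eqP.
  by rewrite oner_eq0.
move=> N [N0 ND Na Nb].
have [[u [Nu u0]]|none] := pselect (exists u, N u /\ u <> 0); [right | left].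
  apply/seteqP; split=> // v _.
  have [a [b [c [ae bf ch]]]] := sl2_triple_lift.
  apply: (std_irreducible d_gt0 (N := N) (u := u)) => //.
  - move=> k w Nw; rewrite -(irr_act_scale k w); exact: Na.
  - by move=> w Nw; rewrite -ae; apply: Nb.
  - by move=> w Nw; rewrite -bf; apply: Nb.
apply/seteqP; split=> [u Nu /=|_ -> //].
by apply: contrapT => u0; apply: none; exists u.
Qed.

(* J^2 acts trivially through the bracket of a module killed by J. *)
Lemma killed_module_iso (M : poisson_module P) :
  (forall a (m : M), pm_act a m = ev a *: m) ->
  simple_poisson_module M -> has_dim M d -> poisson_module_iso M irr_module.
Proof.
move=> actE [_ M_simple] [phi phi_bij].
have square0 s : ideal_square (kernel_of ev) s -> forall m : M, pm_br s m = 0.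
  pose S := [set s : A | ev s = 0 /\ forall m : M, pm_br s m = 0]%classic.
  have idS : is_ideal S.
    have SM a u : S u -> S (a * u).
      move=> [eu bu]; split; first by rewrite evM eu mulr0.
      by move=> m; rewrite pm_br_mul bu actE scaler0 add0r actE eu scale0r.
    split=> //.
    - by split; [rewrite ev0 | move=> m; rewrite pm_br0l].
    - move=> u v [eu bu] [ev' bv]; split; first by rewrite evD eu ev' addr0.
      by move=> m; rewrite pm_brDl bu bv addr0.
    - by move=> a u Su; rewrite mulrC; apply: SM.
  have subS : ([set i * j | i in kernel_of ev & j in kernel_of ev] `<=` S)%classic.
    move=> _ [i ei] [j ej <-]; rewrite /kernel_of /= in ei ej.
    split; first by rewrite evM ei mul0r.
    by move=> m; rewrite pm_br_mul !actE ei ej !scale0r addr0.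
  by move=> hs; have [] := hs S (conj idS subS).
(* If the differentials agree, a - b is a constant plus an element of J^2, and both bracket
   trivially; so the bracket of M factors through sl_2. *)
have br_delta a b : delta a = delta b -> forall m : M, pm_br a m = pm_br b m.
  move=> dab m.
  have sq : ideal_square (kernel_of ev) (a - b - (ev (a - b))%:A).
    apply: (sl2p_ker pt); first by rewrite evB evA subrr.
    have d1 : delta 1 = 0.
      have /eqP := sl2p_der pt 1 1.
      by rewrite mulr1 ev1 scale1r -subr_eq subrr eq_sym => /eqP.
    by rewrite !(linB delta) (linZ delta) d1 scaler0 subr0 dab subrr.
  have [s [s2 ->]] : exists s, ideal_square (kernel_of ev) s /\ a = (ev (a - b))%:A + s + b.
    by eexists; split; [exact: sq | rewrite [_ + (_ - _)]addrC subrK subrK].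
  by rewrite !pm_brDl pm_brZl pm_br1 scaler0 add0r (square0 _ s2) add0r.
pose E : 'M[K]_2 := delta_mx 0 1; pose F : 'M[K]_2 := delta_mx 1 0.
pose H : 'M[K]_2 := delta_mx 0 0 - delta_mx 1 1.
have trE : \tr E = 0 by rewrite mxtrace2 !mxE /= addr0.
have trF : \tr F = 0 by rewrite mxtrace2 !mxE /= addr0.
have trH : \tr H = 0 by rewrite mxtrace2 !mxE /= subr0 sub0r subrr.
have [ae _ dae] := sl2p_surj pt trE; have [af _ daf] := sl2p_surj pt trF.
have [ah _ dah] := sl2p_surj pt trH.
pose e := pm_br_lin M ae; pose f := pm_br_lin M af; pose h := pm_br_lin M ah.
have tr11 a : delta a 1 1 = - delta a 0 0.
  by apply/eqP; rewrite -addr_eq0 addrC -mxtrace2 (sl2p_tr pt).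
have brE a (m : M) : pm_br a m = delta a 0 1 *: e m + delta a 1 0 *: f m + delta a 0 0 *: h m.
  rewrite /e /f /h /= -!pm_brZl -!pm_brDl; apply: br_delta.
  rewrite !(linD delta) !(linZ delta) dae daf dah.
  by apply: mx2P; rewrite ?tr11 !mxE /=; ring.
have comm a b c (m : M) : mx_commutator (delta a) (delta b) = delta c ->
    pm_br a (pm_br b m) = pm_br b (pm_br a m) + pm_br c m.
  move=> abc; rewrite -(br_delta (P a b) c) ?(sl2p_br pt) //.
  by rewrite pm_br_lie [RHS]addrC subrK.
have ef m : e (f m) = f (e m) + h m.
  apply: comm; rewrite dae daf dah.
  by apply: mx2P; rewrite mx_commutator2 !mxE /=; ring.
have he m : h (e m) = e (h m) + 2%:R *: e m.
  rewrite -[2%:R *: e m]pm_brZl; apply: comm; rewrite (linZ delta) dae dah.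
  by apply: mx2P; rewrite mx_commutator2 !mxE /=; ring.
have hf m : h (f m) = f (h m) - 2%:R *: f m.
  rewrite -scaleNr -[(- 2%:R) *: f m]pm_brZl; apply: comm; rewrite (linZ delta) daf dah.
  by apply: mx2P; rewrite mx_commutator2 !mxE /=; ring.
have irr (N : set M) :
  (forall u v, N u -> N v -> N (u + v)) -> (forall k u, N u -> N (k *: u)) ->
  (forall u, N u -> N (e u)) -> (forall u, N u -> N (f u)) -> (forall u, N u -> N (h u)) ->
  forall u, N u -> u <> 0 -> forall v, N v.
  move=> ND NZ Ne Nf Nh u Nu u0.
  have [|N0|NT] := M_simple N; last by move=> v; rewrite NT.
  - split=> //; first by rewrite -(scale0r u); apply: NZ.
      by move=> a m Nm; rewrite actE; apply: NZ.
    by move=> a m Nm; rewrite brE; apply: (ND); [apply: (ND)|]; apply: (NZ); auto.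
  - by move: Nu; rewrite N0 => /u0.
have [g [[g' gK g'K] ge gf gh]] := sl2_module_standard ef he hf d_gt0 phi_bij irr.
pose G' : {linear M -> V} :=
  HB.pack g' (GRing.isLinear.Build K M V _ g' (linear_inverse gK g'K)).
exists G'; split.
- by exists g.
- move=> a m; rewrite actE; exact: (linZ G').
- move=> a m; rewrite -[m]g'K brE -ge -gf -gh.
  rewrite -!(linZ g) -!(linD g) /= !gK.
  by [].
Qed.

End IrreducibleModules.

(** Modules at different points are told apart by the scalars through which A acts on a nonzero
    vector. *)
Lemma irr_module_iso_ev (K : numClosedFieldType) (A : comAlgType K) (P : poisson A)
    (ev ev' : {lrmorphism A -> K | *%R}) (delta delta' : {linear A -> 'M[K]_2})
    (pt : sl2_point P ev delta) (pt' : sl2_point P ev' delta') (d : nat) :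
  (0 < d)%N -> poisson_module_iso (irr_module pt d) (irr_module pt' d) -> ev =1 ev'.
Proof.
move=> d_gt0 [f [[g fK gK] fa _]] a.
pose u : 'rV[K]_d := const_mx 1.
have u0 : u <> 0.
  by move=> /rowP /(_ (Ordinal d_gt0)); rewrite !mxE => /eqP; rewrite oner_eq0.
have fu0 : f u <> 0.
  by move=> fu; apply: u0; rewrite -[u]fK fu -[X in g X](raddf0 f) fK.
have := fa a u; rewrite /= (linZ f) => /eqP.
rewrite -subr_eq0 -scalerBl scaler_eq0 subr_eq0 => /orP [/eqP //|/eqP].
by move/fu0.
Qed.

(** Weights and residues are obtained by choice as bare functions; this turns them into
    morphisms. *)
Lemma character_intro (K : fieldType) (A : comAlgType K) (chi : A -> K) :
  (forall k a b, chi (k *: a + b) = k * chi a + chi b) -> chi 1 = 1 ->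
  (forall a b, chi (a * b) = chi a * chi b) ->
  exists ev : {lrmorphism A -> K | *%R}, ev =1 chi.
Proof.
move=> chiP chi1 chiM.
have chi_mon : monoid_morphism chi by split.
pose L := GRing.isLinear.Build K A K *%R chi chiP.
pose M := GRing.isMonoidMorphism.Build A K chi chi_mon.
pose E : {lrmorphism A -> K | *%R} := HB.pack chi L M.
by exists E.
Qed.

(** * The point supporting a simple Poisson module *)

Section SimpleModules.
Variables (K : numClosedFieldType) (A : comAlgType K) (P : poisson A).
Variables (n : nat) (t : 'I_n -> A).
Hypothesis gt : generates t.
Variables (M : poisson_module P) (d : nat).
Hypotheses (M_simple : simple_poisson_module M) (M_dim : has_dim M d) (d_gt0 : (0 < d)%N).

Lemma simple_submoduleT (N : set M) (w : M) :
  poisson_submodule N -> N w -> w <> 0 -> forall m, N m.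
Proof.
move=> hN Nw w0 m; have [_ /(_ N hN) [NE|->//]] := M_simple.
by move: Nw; rewrite NE => /w0.
Qed.

(** Finitely many generators act by commuting matrices, which have a common eigenvector; the
    elements that preserve its line form a subalgebra. *)
Lemma exists_weight_vector : exists (w : M) (chi : {lrmorphism A -> K | *%R}),
  w <> 0 /\ forall a, pm_act a w = chi a *: w.
Proof.
have [phi phi_bij] := M_dim; have [psi phiK psiK] := phi_bij.
pose Psi : {linear M -> 'rV[K]_d} :=
  HB.pack psi (GRing.isLinear.Build K M 'rV[K]_d _ psi (linear_inverse phiK psiK)).
pose B i : 'M[K]_d := lin1_mx (Psi \o (pm_act_lin M (t i) \o phi)).
have [] := @common_eigenvector K d [seq B i | i <- enum 'I_n] d_gt0.
  move=> _ _ /mapP [i _ ->] /mapP [j _ ->]; apply/row_matrixP => k.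
  by rewrite !row_mul !rowE !mul_rV_lin1 /= !psiK pm_actC.
move=> v v0 /allP stab; pose w := phi v.
have w0 : w <> 0.
  by rewrite /w -(raddf0 phi) => /(can_inj phiK) /eqP; rewrite (negPf v0).
have weight a : exists c : K, pm_act a w = c *: w.
  move: a; apply: gt; first split.
  - by move=> k; exists k; rewrite pm_act_scale.
  - by move=> a b [c ac] [c' bc]; exists (c + c'); rewrite pm_actDl ac bc scalerDl.
  - move=> a b [c ac] [c' bc]; exists (c * c').
    by rewrite pm_actM bc pm_actZr ac scalerA mulrC.
  move=> i; have /stab /sub_rVP [c] : B i \in [seq B i | i <- enum 'I_n].
    by apply: map_f; rewrite mem_enum.
  rewrite mul_rV_lin1 /= => e; exists c.
  by rewrite -[LHS]psiK e linearZ.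
have [chi chiE] := choice weight.
have w_inj c c' : c *: w = c' *: w -> c = c'.
  move/eqP; rewrite -subr_eq0 -scalerBl scaler_eq0 => /orP [|/eqP //].
  by rewrite subr_eq0 => /eqP.
have [ev evE] : exists ev : {lrmorphism A -> K | *%R}, ev =1 chi.
  apply: character_intro.
  - move=> k a b; apply: w_inj.
    by rewrite -chiE pm_actDl pm_actZl !chiE scalerA -scalerDl.
  - by apply: w_inj; rewrite -chiE pm_act1 scale1r.
  - by move=> a b; apply: w_inj; rewrite -chiE pm_actM !chiE pm_actZr chiE scalerA mulrC.
by exists w, ev; split=> // a; rewrite evE chiE.
Qed.

Lemma pm_br_exp (b c : A) (k : nat) (m : M) :
  pm_act (P b (c ^+ k.+1)) m = k.+1%:R *: pm_act (c ^+ k) (pm_act (P b c) m).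
Proof.
have PX : P b (c ^+ k.+1) = k.+1%:R *: (c ^+ k * P b c).
  elim: k => [|k IH]; first by rewrite expr0 expr1 mul1r scale1r.
  rewrite exprS poisson_leibniz IH -scalerAr mulrA -exprS mulrC.
  by rewrite -[k.+2%:R]natr1 scalerDl scale1r addrC.
by rewrite PX pm_actZl pm_actM.
Qed.

(** Bracketing costs one exponent: c^(k+1) {b, m} = {b, c^(k+1) m} - (k + 1) c^k {b, c} m, and both
    terms vanish if c^k m = 0. On a simple module c is therefore locally nilpotent as soon as it
    kills one nonzero vector. *)
Lemma torsion_submodule (c : A) :
  poisson_submodule [set m : M | exists k, pm_act (c ^+ k) m = 0]%classic.
Proof.
have widen k k' (m : M) : (k <= k')%N -> pm_act (c ^+ k) m = 0 -> pm_act (c ^+ k') m = 0.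
  by move=> le e; rewrite -(subnK le) exprD pm_actM e pm_act0r.
split.
- by exists 0%N; rewrite pm_act0r.
- move=> m m' [k ek] [k' ek']; exists (maxn k k'); rewrite pm_actDr.
  by rewrite (widen k) ?leq_maxl // (widen k') ?leq_maxr // addr0.
- by move=> a m [k ek]; exists k; rewrite pm_actC ek pm_act0r.
- move=> b m [k ek]; exists k.+1.
  have := pm_br_act b (c ^+ k.+1) m.
  rewrite pm_br_exp pm_actC ek pm_act0r scaler0 add0r => <-.
  by rewrite exprS pm_actM ek pm_act0r pm_br0r.
Qed.

Lemma simple_module_character : exists chi : {lrmorphism A -> K | *%R},
  (forall a b, chi (P a b) = 0) /\ forall a (m : M), pm_act a m = chi a *: m.
Proof.
have [w [chi [w0 wE]]] := exists_weight_vector; exists chi.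
have nil a (m : M) : exists k, pm_act ((a - (chi a)%:A) ^+ k) m = 0.
  have Nw : exists k, pm_act ((a - (chi a)%:A) ^+ k) w = 0.
    by exists 1%N; rewrite expr1 pm_actB pm_act_scale wE subrr.
  exact: (simple_submoduleT (torsion_submodule (a - (chi a)%:A)) Nw w0 m).
have chi_poisson0 b j : chi j = 0 -> chi (P b j) = 0.
  move=> chij; pose g := P b j.
  have [phi phi_bij] := M_dim.
  have [N0 N0P] : exists k, forall m : M, iter k (pm_act_lin M j) m = 0.
    apply: (nilpotent_bound phi_bij) => m; have [k] := nil j m.
    by rewrite chij scale0r subr0 pm_act_exp; exists k.
  have ex : exists k, `[< forall m : M, pm_act (j ^+ k) m = 0 >].
    by exists N0; apply/asboolP => m; rewrite pm_act_exp.
  case: (ex_minnP ex) => -[|N] /asboolP NP Nmin.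
    by case: w0; rewrite -[w]pm_act1 -(expr0 j).
  have jg (m : M) : pm_act (j ^+ N) (pm_act g m) = 0.
    have /eqP := pm_br_act b (j ^+ N.+1) m.
    rewrite NP NP pm_br0r addr0 pm_br_exp eq_sym scaler_eq0 pnatr_eq0 /=.
    by move/eqP.
  have [m0 jm0] : exists m0 : M, pm_act (j ^+ N) m0 <> 0.
    apply: contrapT => none; have := Nmin N; rewrite asboolT; last first.
      by move=> m; apply: contrapT => jm; apply: none; exists m.
    by move/(_ isT); rewrite ltnn.
  have [k gk] := nil g m0.
  (* As j^N g acts by 0, each factor g - chi g acts behind j^N as the scalar - chi g. A power of g -
     chi g kills m0 while j^N m0 is nonzero, so chi g = 0. *)
  have step i (m : M) : pm_act (j ^+ N) (pm_act ((g - (chi g)%:A) ^+ i) m) =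
      (- chi g) ^+ i *: pm_act (j ^+ N) m.
    elim: i => [|i IH]; first by rewrite pm_act1 scale1r.
    rewrite exprS pm_actM pm_actB pm_act_scale -scaleN1r pm_actDr jg add0r.
    by rewrite !pm_actZr IH !scalerA exprS mulN1r.
  have := step k m0; rewrite gk pm_act0r => /esym /eqP.
  rewrite scaler_eq0 => /orP [|/eqP //].
  by rewrite expf_eq0 oppr_eq0 => /andP [_ /eqP].
have chi_poisson a b : chi (P a b) = 0.
  have := chi_poisson0 a (b - (chi b)%:A).
  rewrite evB evA subrr => /(_ erefl).
  by rewrite pbDr pbNr pbZr pb1r scaler0 oppr0 addr0.
split=> // a m.
pose N : set M := [set m | forall j, chi j = 0 -> pm_act j m = 0]%classic.
have N_sub : poisson_submodule N.
  split.
  - by move=> j _; rewrite pm_act0r.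
  - by move=> u v Nu Nv j cj; rewrite pm_actDr Nu ?Nv // addr0.
  - by move=> b u Nu j cj; rewrite pm_actC Nu // pm_act0r.
  - move=> b u Nu j cj; have := pm_br_act b j u.
    by rewrite !Nu // pm_br0r add0r.
have Nw : N w by move=> j cj; rewrite wE cj scale0r.
have := simple_submoduleT N_sub Nw w0 m (a - (chi a)%:A).
rewrite evB evA subrr => /(_ erefl) /eqP.
by rewrite pm_actB pm_act_scale subr_eq0 => /eqP.
Qed.

End SimpleModules.

(** * Homogeneity and the number of Poisson maximal ideals *)

Section Homogeneity.
Variables (K : numClosedFieldType) (A : comAlgType K) (P : poisson A).
Variables (n : nat) (g : 'I_n -> A).
Hypothesis gg : generates g.
Variables (t : nat) (ev : 'I_t -> {lrmorphism A -> K | *%R}).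
Variable delta : 'I_t -> {linear A -> 'M[K]_2}.
Hypothesis pt : forall i, sl2_point P (ev i) (delta i).
Hypothesis ev_inj : forall i j, ev i =1 ev j -> i = j.
Hypothesis ev_all : forall chi : {lrmorphism A -> K | *%R},
  (forall a b, chi (P a b) = 0) -> exists i, chi =1 ev i.

Lemma homogeneous_of_points : homogeneous P t.
Proof.
move=> d d_gt0; exists (fun i => irr_module (pt i) d); split.
- by move=> i; split; [apply: irr_simple | apply: irr_has_dim].
- by move=> i j /(irr_module_iso_ev d_gt0) /ev_inj.
- move=> M M_simple M_dim.
  have [chi [chiP chiE]] := simple_module_character gg M_simple M_dim d_gt0.
  have [i ei] := ev_all chiP; exists i.
  by apply: killed_module_iso => // a m; rewrite chiE ei.
Qed.

Hypothesis residue : forall J : set A, is_maximal_ideal J ->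
  exists chi : {lrmorphism A -> K | *%R}, J = kernel_of chi.

Lemma poisson_maximal_points (J : set A) : is_poisson_maximal P J ->
  exists i, J = kernel_of (ev i).
Proof.
move=> [Jmax [_ JP]]; have [chi JE] := residue Jmax.
have chiP a b : chi (P a b) = 0.
  have : J (P (a - (chi a)%:A) b).
    by apply: JP; rewrite JE /kernel_of /= evB evA subrr.
  by rewrite JE /kernel_of /= pbDl pbNl pbZl pb1l scaler0 oppr0 addr0.
have [i ei] := ev_all chiP; exists i; rewrite JE; apply/seteqP.
by split=> a; rewrite /kernel_of /= ei.
Qed.

Lemma kernel_of_inj (chi chi' : {lrmorphism A -> K | *%R}) :
  kernel_of chi = kernel_of chi' -> chi =1 chi'.
Proof.
move=> e a; have : kernel_of chi (a - (chi a)%:A) by rewrite /kernel_of /= evB evA subrr.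
by rewrite e /kernel_of /= evB evA => /eqP; rewrite subr_eq0 => /eqP.
Qed.

Lemma card_poisson_maximal :
  ([set J : set A | is_poisson_maximal P J] #= `I_t)%card.
Proof.
(* The cardinality refers to a set of natural numbers, so the points are reindexed by k < t; the
   empty set is a filler beyond t. *)
pose f (k : nat) : set A := oapp (fun i => kernel_of (ev i)) set0 (insub k : option 'I_t).
have fE (i : 'I_t) : f i = kernel_of (ev i) by rewrite /f valK.
have -> : [set J : set A | is_poisson_maximal P J]%classic = [set f k | k in `I_t]%classic.
  apply/seteqP; split=> [J /poisson_maximal_points [i ->] | _ [k kt <-]] /=.
    by exists i; rewrite ?fE //=.
  by rewrite (fE (Ordinal kt)); apply: (sl2_point_maximal (pt _)).
apply: inj_card_eq => k l /set_mem kt /set_mem lt; rewrite /= in kt lt.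
by rewrite (fE (Ordinal kt)) (fE (Ordinal lt)) => /kernel_of_inj /ev_inj [].
Qed.

End Homogeneity.

(** * Residue fields of maximal ideals *)

Section Uncountability.
Variable R : realType.

(** Nested intervals: the next interval is the last third if f k lies before it, and the first third
    otherwise, so f k is excluded in either case; the supremum of the left endpoints lies in all of
    them. *)
Lemma real_uncountable (f : nat -> R) : exists x, forall n, f n <> x.
Proof.
pose m1 (I : R * R) := (2%:R * I.1 + I.2) / 3%:R.
pose m2 (I : R * R) := (I.1 + 2%:R * I.2) / 3%:R.
pose next (x : R) (I : R * R) := if x < m2 I then (m2 I, I.2) else (I.1, m1 I).
pose I := fix I n := if n is k.+1 then next (f k) (I k) else (0, 1) : R * R.
have Ilt n : (I n).1 < (I n).2.
  elim: n => [|n IH] /=; first exact: ltr01.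
  by rewrite /next; case: ifP => _ /=; rewrite /m1 /m2; lra.
have step n : (I n).1 <= (I n.+1).1 /\ (I n.+1).2 <= (I n).2.
  have := Ilt n; rewrite /= /next; case: ifP => _ /=; rewrite /m1 /m2 => lt; split; lra.
have mono1 n m : (n <= m)%N -> (I n).1 <= (I m).1.
  move=> /subnK <-; elim: (m - n)%N => [|k IH] //; rewrite addSn.
  exact: le_trans IH (step _).1.
have mono2 n m : (n <= m)%N -> (I m).2 <= (I n).2.
  move=> /subnK <-; elim: (m - n)%N => [|k IH] //; rewrite addSn.
  exact: le_trans (step _).2 IH.
have cross n m : (I n).1 <= (I m).2.
  apply: le_trans (mono1 n (maxn n m) (leq_maxl _ _)) _.
  exact: le_trans (ltW (Ilt _)) (mono2 _ _ (leq_maxr n m)).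
pose E : set R := [set x | exists n, x = (I n).1]%classic.
have E_ub m : ubound E (I m).2 by move=> _ [n ->].
have E0 : (E !=set0)%classic by exists (I 0%N).1, 0%N.
exists (sup E) => n fn.
have ge n' : (I n').1 <= sup E.
  by apply: ub_le_sup; [exists (I 0%N).2; apply: E_ub | exists n'].
have le n' : sup E <= (I n').2 by apply: ge_sup.
have := ge n.+1; have := le n.+1; have := Ilt n.
rewrite /= /next -fn; case: (ltP (f n) (m2 (I n))) => /=; rewrite /m1 /m2 => *; lra.
Qed.

Lemma complex_uncountable (f : nat -> R[i]) : exists x, forall n, f n <> x.
Proof.
have [x xP] := real_uncountable (fun n => complex.Re (f n)).
by exists (x%:C)%C => n fn; apply: (xP n); rewrite fn.
Qed.

End Uncountability.

(** * Nullstellensatz over an uncountable algebraically closed field *)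

Section Nullstellensatz.
Variables (K : numClosedFieldType) (A : comAlgType K).
Hypothesis K_uncountable : forall f : nat -> K, exists x, forall n, f n <> x.
Variable J : set A.
Hypothesis J_max : is_maximal_ideal J.

Let J_ideal : is_ideal J. Proof. by case: J_max. Qed.

Lemma maximal_inverse a : ~ J a -> exists b, J (a * b - 1).
Proof.
move=> nJa; have [J0 JD JM _] := J_ideal.
pose I : set A := [set u | exists v w, J v /\ u = v + a * w]%classic.
have idI : is_ideal I.
  have IM c u : I u -> I (c * u).
    move=> [v [w [Jv ->]]]; exists (c * v), (c * w).
    by split; [apply: JM | rewrite mulrDr [a * (c * w)]mulrCA].
  split=> //.
  - by exists 0, 0; rewrite mulr0 addr0.
  - move=> _ _ [v [w [Jv ->]]] [v' [w' [Jv' ->]]]; exists (v + v'), (w + w').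
    by split; [apply: JD | rewrite mulrDr addrACA].
  - by move=> c u Iu; rewrite mulrC; apply: IM.
have [_ _ /(_ I idI) [|IJ|IT]] := J_max.
- by move=> u Ju; exists u, 0; rewrite mulr0 addr0.
- by case: nJa; rewrite -IJ; exists 0, 1; rewrite mulr1 add0r.
- have : I 1 by rewrite IT.
  case=> v [w [Jv e]]; exists w.
  by rewrite e opprD addrCA subrr addr0 -mulN1r; apply: JM.
Qed.

Lemma maximal_roots a (r : seq K) : J (\prod_(z <- r) (a - z%:A)) ->
  exists c : K, J (a - c%:A).
Proof.
have [J0 JD JM _] := J_ideal; have [_ J1 _] := J_max.
elim: r => [|z r IH]; first by rewrite big_nil.
rewrite big_cons; have [Jz _|/maximal_inverse [b Jb]] := pselect (J (a - z%:A)).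
  by exists z.
move=> Jp; apply: IH.
have -> : \prod_(z0 <- r) (a - z0%:A) =
    b * ((a - z%:A) * \prod_(z0 <- r) (a - z0%:A)) -
    (\prod_(z0 <- r) (a - z0%:A)) * ((a - z%:A) * b - 1) by ring.
by apply: JD; [apply: JM | rewrite -mulrN1 mulrC; do 2!apply: (JM)].
Qed.

Lemma maximal_algebraic a (p : {poly K}) : p != 0 -> J (horner_alg a p) ->
  exists c : K, J (a - c%:A).
Proof.
move=> p0; have [r ->] := closed_field_poly_normal p.
have [J0 JD JM _] := J_ideal.
rewrite linearZ /= mulr_algl rmorph_prod => Jp; apply: (maximal_roots (r := r)).
have -> : \prod_(z <- r) (a - z%:A) =
    (lead_coef p)^-1 *: (lead_coef p *: \prod_(z <- r) horner_alg a ('X - z%:P)).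
  rewrite scalerA mulVf ?lead_coef_eq0 // scale1r; apply: eq_bigr => z _.
  by rewrite raddfB /= horner_algX horner_algC.
by rewrite -[(lead_coef p)^-1 *: _]mulr_algl; apply: (JM).
Qed.

(* n + 1 inverses of a - c in an n-dimensional space are linearly dependent;
   clearing denominators in such a relation makes a algebraic modulo J. *)
Lemma dependent_inverses a (n : nat) (e : nat -> A) (c : 'I_n.+1 -> K)
    (b : 'I_n.+1 -> nat -> K) : injective c ->
  (forall k, J ((a - (c k)%:A) * (\sum_(i < n) b k i *: e i) - 1)) ->
  exists x : K, J (a - x%:A).
Proof.
move=> c_inj Jb; have [J0 JD JM _] := J_ideal.
pose B : 'M[K]_(n.+1, n) := \matrix_(k, i) b k i.
have [al al0 alB] : exists2 al : 'rV[K]_n.+1, al != 0 & al *m B = 0.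
  have : kermx B != 0.
    by rewrite kermx_eq0 /row_free neq_ltn (leq_ltn_trans (rank_leq_col B)).
  by move=> /rowV0Pn [al /sub_kermxP alB al0]; exists al.
have rel : \sum_k al 0 k *: (\sum_(i < n) b k i *: e i) = 0.
  under eq_bigr => k _ do rewrite scaler_sumr.
  rewrite exchange_big big1 //= => i _.
  have := congr1 (fun u : 'rV_n => u 0 i) alB; rewrite !mxE => /= alB0.
  under eq_bigr => k _ do rewrite scalerA.
  rewrite -scaler_suml [X in X *: _](_ : _ = 0) ?scale0r // -[RHS]alB0.
  by apply: eq_bigr => k _; rewrite mxE.
pose q k : {poly K} := \prod_(l | l != k) ('X - (c l)%:P).
pose p : {poly K} := \sum_k al 0 k *: q k.
have [k0 alk0] : exists k, al 0 k != 0.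
  apply: contrapT => none; move/eqP: al0; apply; apply/rowP => k; rewrite mxE.
  by apply/eqP; apply: contrapT => /negP h; apply: none; exists k.
(* As in Lagrange interpolation, evaluation at [c k0] leaves only the term of [q k0]. *)
have p0 : p != 0.
  apply/eqP => /(congr1 (fun r => r.[c k0])); rewrite horner_sum (bigD1 k0) //= big1.
    rewrite addr0 hornerZ horner0 => /eqP; rewrite mulf_eq0 (negPf alk0) /=.
    rewrite horner_prod => /prodf_eq0 [l lk0].
    by rewrite hornerXsubC subr_eq0 (inj_eq c_inj) eq_sym (negPf lk0).
  move=> k kk0; rewrite hornerZ horner_prod (bigD1 k0) ?[k0 == k]eq_sym //=.
  by rewrite hornerXsubC subrr mul0r mulr0.
apply: (maximal_algebraic p0).
have qE k : (a - (c k)%:A) * horner_alg a (q k) = \prod_l (a - (c l)%:A).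
  rewrite [RHS](bigD1 k) //= rmorph_prod; congr (_ * _); apply: eq_bigr => l _.
  by rewrite raddfB /= horner_algX horner_algC.
(* The sum of al_k q_k(a) (a - c_k) b_k is the product of all a - c_l times the vanishing
   combination [rel], so only the terms al_k q_k(a) survive on the right. *)
have -> : horner_alg a p = - \sum_k al 0 k *: (horner_alg a (q k) *
    ((a - (c k)%:A) * (\sum_(i < n) b k i *: e i) - 1)).
  rewrite /p linear_sum /= -sumrN.
  apply/eqP; rewrite -subr_eq0 -sumrB; apply/eqP.
  transitivity (\prod_l (a - (c l)%:A) * \sum_k al 0 k *: (\sum_(i < n) b k i *: e i));
    last by rewrite rel mulr0.
  rewrite mulr_sumr; apply: eq_bigr => k _.
  rewrite linearZ /= mulr_algl opprK -scalerDr -scalerAr -(qE k).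
  by congr (_ *: _); ring.
have JN u : J u -> J (- u) by move=> Ju; rewrite -mulN1r; apply: JM.
have JZ z u : J u -> J (z *: u) by move=> Ju; rewrite -mulr_algl; apply: JM.
apply: JN; elim/big_ind: _ => [|u v Ju Jv|k _]; [exact: J0 | exact: JD |].
by apply: JZ; apply: JM.
Qed.

Hypothesis A_countable : countably_spanned A.

(** Sort the scalars c by the number of spanning vectors used to write an inverse of a - c modulo J.
    By [dependent_inverses] every class is finite, and K would be countable. *)
Lemma maximal_residue a : exists c : K, J (a - c%:A).
Proof.
have [e eP] := A_countable.
apply: contrapT => none.
have inv (c : K) : exists nb : nat * (nat -> K),
    J ((a - c%:A) * (\sum_(i < nb.1) nb.2 i *: e i) - 1).
  have [|b Jb] := @maximal_inverse (a - c%:A); first by move=> Jc; apply: none; exists c.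
  by have [n [b' bE]] := eP b; exists (n, b'); rewrite /= -bE.
have [nb nbP] := choice inv.
have finite_fibers n : exists s : seq K, forall c, (nb c).1 = n -> c \in s.
  apply: contrapT => infin.
  have pick (s : seq K) : exists c, (nb c).1 = n /\ c \notin s.
    apply: contrapT => no; apply: infin; exists s => c cn.
    by apply: contrapT => /negP cs; apply: no; exists c.
  have large m : exists s : seq K, [/\ uniq s, size s = m & forall c, c \in s -> (nb c).1 = n].
    elim: m => [|m [s [s_uniq s_size sP]]]; first by exists [::].
    have [c [cn cs]] := pick s; exists (c :: s); split=> /=.
    - by rewrite cs.
    - by rewrite s_size.
    - by move=> c'; rewrite inE => /predU1P [->|/sP].
  have [s [s_uniq s_size sP]] := large n.+1.
  pose c (k : 'I_n.+1) := nth 0 s k.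
  have c_inj : injective c.
    move=> k l; rewrite /c => /eqP.
    by rewrite nth_uniq ?s_size // => /eqP /val_inj.
  apply: none; apply: (dependent_inverses (n := n) (e := e) (b := fun k => (nb (c k)).2) c_inj).
  move=> k; have := nbP (c k); rewrite (sP (c k)) //.
  by apply: mem_nth; rewrite s_size.
have [s sP] := choice finite_fibers.
pose f m := oapp (fun nk : nat * nat => nth 0 (s nk.1) nk.2) 0 (choice.unpickle m).
have [x xP] := K_uncountable f.
apply: (xP (choice.pickle ((nb x).1, index x (s (nb x).1)))).
by rewrite /f choice.pickleK /= nth_index // sP.
Qed.

Lemma nullstellensatz : exists chi : {lrmorphism A -> K | *%R}, J = kernel_of chi.
Proof.
have [J0 JD JM JMr] := J_ideal; have [_ J1 _] := J_max.
have [chi chiP] := choice maximal_residue.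
have JZ k u : J u -> J (k *: u) by move=> Ju; rewrite -mulr_algl; apply: JM.
have JB u v : J u -> J v -> J (u - v).
  by move=> Ju Jv; apply: JD => //; rewrite -scaleN1r; apply: JZ.
have scalar0 (c : K) : J (c%:A) -> c = 0.
  move=> Jc; apply/eqP; apply: contrapT => /negP c0; apply: J1.
  by rewrite -[1]scale1r -(mulVf c0) -scalerA; apply: JZ.
have uniq_chi a c : J (a - c%:A) -> chi a = c.
  move=> Jc; apply/eqP; rewrite -subr_eq0; apply/eqP/scalar0.
  have -> : (chi a - c)%:A = (a - c%:A) - (a - (chi a)%:A).
    by lmod (K : fieldType) (A : lmodType K).
  by apply: JB.
have [ev evE] : exists ev : {lrmorphism A -> K | *%R}, ev =1 chi.
  apply: character_intro.
  - move=> k a b; apply: uniq_chi.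
    have -> : k *: a + b - (k * chi a + chi b)%:A =
        k *: (a - (chi a)%:A) + (b - (chi b)%:A).
      by lmod (K : fieldType) (A : lmodType K).
    by apply: JD => //; apply: JZ.
  - by apply: uniq_chi; rewrite scale1r subrr.
  - move=> a b; apply: uniq_chi.
    have -> : a * b - (chi a * chi b)%:A =
        a * (b - (chi b)%:A) + chi b *: (a - (chi a)%:A).
      rewrite mulrBr mulr_algr.
      by lmod (K : fieldType) (A : lmodType K).
    by apply: JD; [apply: JM | apply: JZ].
exists ev; apply/seteqP; split=> a; rewrite /kernel_of /= evE.
- by move=> Ja; apply: uniq_chi; rewrite scale0r subr0.
- by move=> ca; have := chiP a; rewrite ca scale0r subr0.
Qed.

End Nullstellensatz.

(** * Traceless matrices of size 2 and characters of the coordinate rings *)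

Section Sl2Matrices.
Variable K : fieldType.

Definition sl2_mx (p q r : K) : 'M[K]_2 :=
  p *: (delta_mx 0 0 - delta_mx 1 1) + q *: delta_mx 0 1 + r *: delta_mx 1 0.

Lemma sl2_mx00 p q r : sl2_mx p q r 0 0 = p.
Proof. by rewrite !mxE /=; ring. Qed.
Lemma sl2_mx01 p q r : sl2_mx p q r 0 1 = q.
Proof. by rewrite !mxE /=; ring. Qed.
Lemma sl2_mx10 p q r : sl2_mx p q r 1 0 = r.
Proof. by rewrite !mxE /=; ring. Qed.
Lemma sl2_mx11 p q r : sl2_mx p q r 1 1 = - p.
Proof. by rewrite !mxE /=; ring. Qed.
Definition sl2_mxE := (sl2_mx00, sl2_mx01, sl2_mx10, sl2_mx11).

Lemma sl2_mx_trace p q r : \tr (sl2_mx p q r) = 0.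
Proof. by rewrite mxtrace2 !sl2_mxE subrr. Qed.

Lemma sl2_mx_comb a b c p q r p' q' r' p'' q'' r'' :
  a *: sl2_mx p q r + b *: sl2_mx p' q' r' + c *: sl2_mx p'' q'' r'' =
  sl2_mx (a * p + b * p' + c * p'') (a * q + b * q' + c * q'') (a * r + b * r' + c * r'').
Proof. by rewrite /sl2_mx; lmod K ('M[K]_2 : lmodType K). Qed.

Lemma sl2_mx_commutator p q r p' q' r' :
  mx_commutator (sl2_mx p q r) (sl2_mx p' q' r') =
  sl2_mx (q * r' - q' * r) (2%:R * (p * q' - q * p')) (2%:R * (r * p' - p * r')).
Proof. by apply: mx2P; rewrite mx_commutator2 !sl2_mxE; ring. Qed.

Lemma sl2_mx_surj (M : 'M[K]_2) : \tr M = 0 -> M = sl2_mx (M 0 0) (M 0 1) (M 1 0).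
Proof.
rewrite mxtrace2 addrC => /eqP; rewrite addr_eq0 => /eqP M11.
by apply: mx2P; rewrite !sl2_mxE.
Qed.

Lemma sl2_mx_eq0 p q r : sl2_mx p q r = 0 -> [/\ p = 0, q = 0 & r = 0].
Proof.
move=> e; split; [rewrite -(sl2_mx00 p q r) | rewrite -(sl2_mx01 p q r)
  | rewrite -(sl2_mx10 p q r)]; by rewrite e mxE.
Qed.

End Sl2Matrices.

Section Characters.
Variable K : fieldType.

Lemma character_of_lrmorphism (A : comAlgType K) (g : {lrmorphism A -> K^o}) :
  exists ev : {lrmorphism A -> K | *%R}, forall a, ev a = g a.
Proof.
apply: (@character_intro K A g).
- by move=> k a b; rewrite linearP.
- exact: rmorph1.
- exact: rmorphM.
Qed.

Lemma mpoly_character n (c : 'I_n -> K) :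
  exists ev : {lrmorphism mpoly n K -> K | *%R}, forall i, ev (mvar K i) = c i.
Proof.
have [ev evE] := character_of_lrmorphism (mpoly_lift (c : 'I_n -> K^o)).
by exists ev => i; rewrite evE /= mpoly_lift_mvar.
Qed.

Lemma laurent_character (c : 'I_4 -> K) : c 2%R * c 3%R = 1 ->
  exists ev : {lrmorphism laurent3 K -> K | *%R}, forall i, ev (lvar K i) = c i.
Proof.
move=> c1; have [g gE] := @laurent_lift K K^o c c1.
by have [ev evE] := character_of_lrmorphism g; exists ev => i; rewrite evE gE.
Qed.

Lemma character_eq3 (A : comAlgType K) (x y z : A) (ev ev' : {lrmorphism A -> K | *%R}) :
  generates3 x y z -> ev x = ev' x -> ev y = ev' y -> ev z = ev' z -> ev =1 ev'.
Proof.
move=> gen ex ey ez; apply: gen => //.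
- split.
  + by move=> k; rewrite !evA.
  + by move=> a b ea eb; rewrite !evD ea eb.
  + by move=> a b ea eb; rewrite !evM ea eb.
- move=> u v eu uv.
  have e1 : ev u * ev v = 1 by rewrite -evM uv ev1.
  have e2 : ev u * ev' v = 1 by rewrite eu -evM uv ev1.
  have u0 : ev u != 0.
    by apply/eqP => u0; move/eqP: e1; rewrite u0 mul0r eq_sym oner_eq0.
  by apply: (mulfI u0); rewrite e1 e2.
Qed.

End Characters.

Lemma jac_br_coordinates (K : fieldType) (A : comAlgType K) (D1 D2 D3 : {linear A -> A})
    (x y z p q r : A) :
  is_partial D1 x y z -> is_partial D2 y x z -> is_partial D3 z x y ->
  [/\ jac_br D1 D2 D3 p q r x y = p, jac_br D1 D2 D3 p q r y z = q &
      jac_br D1 D2 D3 p q r z x = r].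
Proof.
move=> [_ d1x d1y d1z] [_ d2y d2x d2z] [_ d3z d3x d3y].
by split; rewrite /jac_br !(d1x, d1y, d1z, d2x, d2y, d2z, d3x, d3y, d3z); ring.
Qed.

Section HomogeneousDeformation.
Variables (K : numClosedFieldType) (A : comAlgType K) (x y z : A).
Hypothesis K_uncountable : forall f : nat -> K, exists x, forall n, f n <> x.
Hypothesis A_countable : countably_spanned A.
Variables D1 D2 D3 : {linear A -> A}.
Hypotheses (D1x : is_partial D1 x y z) (D2y : is_partial D2 y x z)
  (D3z : is_partial D3 z x y).
Hypothesis D12 : forall a, D2 (D1 a) = D1 (D2 a).
Hypothesis D13 : forall a, D3 (D1 a) = D1 (D3 a).
Hypothesis D23 : forall a, D3 (D2 a) = D2 (D3 a).
Hypothesis gen : generates3 x y z.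
Variables (n : nat) (g : 'I_n -> A).
Hypothesis gg : generates g.
Variables (bxy byz bzx f : A) (U : algType K) (t : nat).
Hypothesis vcurl :
  byz * (D2 bxy - D3 bzx) + bzx * (D3 byz - D1 bxy) + bxy * (D1 bzx - D2 byz) = 0.
Variables (ev : 'I_t -> {lrmorphism A -> K | *%R}).
Variables m1 m2 m3 : 'I_t -> 'M[K]_2.
Hypothesis ev_xy : forall i, ev i bxy = 0.
Hypothesis ev_yz : forall i, ev i byz = 0.
Hypothesis ev_zx : forall i, ev i bzx = 0.
Hypothesis tr_m : forall i, [/\ \tr (m1 i) = 0, \tr (m2 i) = 0 & \tr (m3 i) = 0].
Let dif i (a : A) := ev i (D1 a) *: m1 i + ev i (D2 a) *: m2 i + ev i (D3 a) *: m3 i.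
Hypothesis br12 : forall i, mx_commutator (m1 i) (m2 i) = dif i bxy.
Hypothesis br23 : forall i, mx_commutator (m2 i) (m3 i) = dif i byz.
Hypothesis br31 : forall i, mx_commutator (m3 i) (m1 i) = dif i bzx.
Hypothesis m_span : forall i M, \tr M = 0 ->
  exists a b c : K, M = a *: m1 i + b *: m2 i + c *: m3 i.
Hypothesis m_free : forall i (a b c : K), a *: m1 i + b *: m2 i + c *: m3 i = 0 ->
  [/\ a = 0, b = 0 & c = 0].
Hypothesis ev_inj : forall i j, ev i =1 ev j -> i = j.
Hypothesis ev_all : forall chi : {lrmorphism A -> K | *%R},
  chi bxy = 0 -> chi byz = 0 -> chi bzx = 0 ->
  exists i, [/\ chi x = ev i x, chi y = ev i y & chi z = ev i z].
Hypothesis singular : forall i,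
  [/\ ev i (D1 f) = 0, ev i (D2 f) = 0 & ev i (D3 f) = 0].
Hypothesis deformation : forall P : poisson A,
  [/\ P x y = bxy, P y z = byz & P z x = bzx] -> is_deformation P U.

(** Reduces each case to explicit data: the list of points where the three brackets vanish and, at
    each of them, a basis of sl_2 satisfying the linearized brackets. *)
Lemma homogeneous_deformation_intro :
  homogeneous_deformation x y z bxy byz bzx f U t.
Proof.
split.
  have [d1 _ _ _] := D1x; have [d2 _ _ _] := D2y; have [d3 _ _ _] := D3z.
  exists (jac_poisson d1 d2 d3 D12 D13 D23 vcurl).
  exact: jac_br_coordinates.
move=> P hP; have [Pxy Pyz Pzx] := hP.
have pt i : sl2_point P (ev i) (differential D1 D2 D3 (ev i) (m1 i) (m2 i) (m3 i)).
  have [tr1 tr2 tr3] := tr_m i.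
  apply: (sl2_point_intro D1x D2y D3z gen); rewrite ?Pxy ?Pyz ?Pzx //.
  - exact: m_span.
  - exact: m_free.
have all (chi : {lrmorphism A -> K | *%R}) :
    (forall a b, chi (P a b) = 0) -> exists i, chi =1 ev i.
  move=> chiP; have [|||i [ex ey ez]] := @ev_all chi; rewrite -?Pxy -?Pyz -?Pzx //.
  by exists i; apply: (character_eq3 gen).
have res (J : set A) : is_maximal_ideal J -> exists chi, J = kernel_of chi.
  by move=> Jmax; apply: nullstellensatz.
split.
- exact: deformation.
- exact: (homogeneous_of_points gg pt ev_inj all).
- exact: (card_poisson_maximal pt ev_inj all res).
- move=> J /(poisson_maximal_points all res) [i ->].
  exists (ev i x), (ev i y), (ev i z), (ev i); split=> //.
  have [s1 s2 s3] := singular i; split=> //.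
  + by exists D1.
  + by exists D2.
  + by exists D3.
- move=> J hJ Jmax.
  have [i JE] := poisson_maximal_points all res (conj Jmax hJ).
  exact: (sl2_point_cotangent (pt i) hJ JE).
Qed.

End HomogeneousDeformation.

(** * The three deformations *)

Lemma lrmorph_combination (K : fieldType) (T U : algType K) (f : {lrmorphism T -> U}) a u v :
  f (a *: u + v) = a *: f u + f v.
Proof. exact: linearP. Qed.

Lemma lrmorph_commutator (K : fieldType) (T U : algType K) (f : {lrmorphism T -> U}) u v :
  f (u * v - v * u) = f u * f v - f v * f u.
Proof. by rewrite lrmorphB !lrmorphM. Qed.

(** * The universal property of the enveloping algebra *)

Section EnvelopingAlgebra.
Variables (K : fieldType) (L : lie_algebra K).

Definition env_gen (u : L) : env_alg L := alg_pi _ (free_gen K u).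

Lemma generates_env_gen : generates env_gen.
Proof. exact: (generates_alg_pi (J := rel_ideal (@env_rel_char K L)) (@generates_free_gen K L)). Qed.

Fact env_gen_linear : linear env_gen.
Proof.
move=> a u v; pose X (w : L) : free_alg K L := free_gen K w.
apply: etrans (lrmorph_combination (alg_pi (rel_ideal (@env_rel_char K L))) a (X u) (X v)).
apply/alg_piP => J [_]; apply; left; by exists a, u, v.
Qed.
HB.instance Definition _ := GRing.isLinear.Build K L (env_alg L) _ env_gen env_gen_linear.

Lemma env_gen_br u v :
  env_gen (lie_br u v) = env_gen u * env_gen v - env_gen v * env_gen u.
Proof.
pose X (w : L) : free_alg K L := free_gen K w.
apply: etrans (lrmorph_commutator (alg_pi (rel_ideal (@env_rel_char K L))) (X u) (X v)).
apply/alg_piP => J [_]; apply; right; by exists u, v.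
Qed.

Lemma env_lift (B : algType K) (g : {linear L -> B}) :
  (forall u v, g (lie_br u v) = g u * g v - g v * g u) ->
  exists G : {lrmorphism env_alg L -> B}, forall u, G (env_gen u) = g u.
Proof.
move=> g_br; apply: presented_alg_lift => r.
pose X (w : L) : free_alg K L := free_gen K w.
case=> [[a [u [v ->]]]|[u [v ->]]]; apply: (etrans (lrmorphB (free_lift g) _ _));
  apply/eqP; rewrite subr_eq0; apply/eqP; apply: (etrans (free_lift_gen _ _)).
- apply: etrans (esym (lrmorph_combination (free_lift g) a (X u) (X v))).
  by rewrite linearP; congr (_ *: _ + _); apply/esym/free_lift_gen.
- apply: etrans (esym (lrmorph_commutator (free_lift g) (X u) (X v))).
  by rewrite g_br; congr (_ * _ - _ * _); apply/esym/free_lift_gen.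
Qed.

End EnvelopingAlgebra.

Lemma env_alg_iso (K : fieldType) (L L' : lie_algebra K) :
  lie_iso L L' -> alg_iso (env_alg L) (env_alg L').
Proof.
case=> f [g gK fK] f_br.
have g_lin : linear g.
  by move=> k u v; apply: (can_inj gK); rewrite fK linearP !fK.
pose g' : {linear L' -> L} := HB.pack g (GRing.isLinear.Build K L' L _ g g_lin).
have g_br u v : g (lie_br u v) = lie_br (g u) (g v).
  by apply: (can_inj gK); rewrite fK f_br !fK.
have [|F FE] := @env_lift K L _ (@env_gen K L' \o f : {linear _ -> _}).
  by move=> u v; rewrite /= f_br env_gen_br.
have [|G GE] := @env_lift K L' _ (@env_gen K L \o g' : {linear _ -> _}).
  by move=> u v; rewrite /= g_br env_gen_br.
exists F; exists G => u.
- have e : (G \o F : {lrmorphism _ -> _}) =1 (idfun : {lrmorphism env_alg L -> env_alg L}).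
    apply: (lrmorph_eq_on_generators (@generates_env_gen K L)) => i /=.
    by rewrite FE GE /= gK.
  exact: e.
- have e : (F \o G : {lrmorphism _ -> _}) =1 (idfun : {lrmorphism env_alg L' -> env_alg L'}).
    apply: (lrmorph_eq_on_generators (@generates_env_gen K L')) => i /=.
    by rewrite GE FE /= fK.
  exact: e.
Qed.

Section Sl2Elements.
Variable K : fieldType.

Fact sl2_elt_subproof (p q r : K) : sl2_mx p q r \in submodule_pred (sl_submodule K 2).
Proof. by rewrite submodule_predE; apply/asboolP; apply: sl2_mx_trace. Qed.

Definition sl2_elt (p q r : K) : sl K 2 :=
  (Sub (sl2_mx p q r) (sl2_elt_subproof p q r) : sub_lmod (sl_submodule K 2)).

Definition sl2_val (u : sl K 2) : 'M[K]_2 := \val (u : sub_lmod (sl_submodule K 2)).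

Fact sl2_val_linear : linear sl2_val.
Proof. by move=> k u v; apply: (val_sub_lmodP (N := sl_submodule K 2)). Qed.
HB.instance Definition _ := GRing.isLinear.Build K (sl K 2) 'M[K]_2 _ sl2_val sl2_val_linear.

Lemma sl2_val_inj : injective sl2_val.
Proof. exact: val_inj. Qed.

Lemma sl2_val_elt p q r : sl2_val (sl2_elt p q r) = sl2_mx p q r.
Proof. by []. Qed.

Lemma sl2_val_br u v : sl2_val (lie_br u v) = mx_commutator (sl2_val u) (sl2_val v).
Proof. by []. Qed.

Lemma sl2_val_trace u : \tr (sl2_val u) = 0.
Proof.
by have := valP (u : sub_lmod (sl_submodule K 2)); rewrite submodule_predE => /asboolP.
Qed.

Lemma sl2_eltP u : exists p q r, u = sl2_elt p q r.
Proof.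
exists (sl2_val u 0 0), (sl2_val u 0 1), (sl2_val u 1 0); apply: sl2_val_inj.
by rewrite sl2_val_elt -sl2_mx_surj // sl2_val_trace.
Qed.

Lemma sl2_elt_comb a p q r b p' q' r' :
  a *: sl2_elt p q r + b *: sl2_elt p' q' r' =
  sl2_elt (a * p + b * p') (a * q + b * q') (a * r + b * r').
Proof.
apply: sl2_val_inj; rewrite linearD !linearZ /= !sl2_val_elt /sl2_mx.
by lmod K ('M[K]_2 : lmodType K).
Qed.

Lemma sl2_elt_br p q r p' q' r' :
  lie_br (sl2_elt p q r) (sl2_elt p' q' r') =
  sl2_elt (q * r' - q' * r) (2%:R * (p * q' - q * p')) (2%:R * (r * p' - p * r')).
Proof. by apply: sl2_val_inj; rewrite sl2_val_br !sl2_val_elt sl2_mx_commutator. Qed.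

End Sl2Elements.

Section BracketOfGenerators.
Variables (K : fieldType) (T : algType K) (A : comAlgType K) (P : poisson A).
Variables (h : T) (f : {lrmorphism T -> A}).

(* [bracket_lift u v] says that h^-1 [u, v] exists and maps to {f u, f v}. *)
Definition bracket_lift (u v : T) : Prop :=
  exists2 w, u * v - v * u = h * w & f w = P (f u) (f v).

Lemma bracket_liftC u v : bracket_lift u v -> bracket_lift v u.
Proof.
case=> w ew fw; exists (- w); first by rewrite mulrN -ew opprB.
by rewrite (lrmorphN f) fw poissonC opprK.
Qed.

Lemma bracket_lift_self u : bracket_lift u u.
Proof.
by exists 0; rewrite ?subrr ?mulr0 // (lrmorph0 f) poisson_alternating.
Qed.

Lemma bracket_lift_central u v (k : K) :
  (forall w, u * w = w * u) -> f u = k%:A -> bracket_lift u v.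
Proof.
move=> uC fu; exists 0; first by rewrite uC subrr mulr0.
by rewrite (lrmorph0 f) fu (pbZl P) (pb1l P) scaler0.
Qed.

Lemma bracket_lift_ordinal n (t : 'I_n -> T) :
  (forall i j : 'I_n, (i < j)%N -> bracket_lift (t i) (t j)) ->
  forall i j, bracket_lift (t i) (t j).
Proof.
move=> lt_ij i j; case: (ltngtP i j) => [||/val_inj ->].
- exact: lt_ij.
- by move=> ji; apply/bracket_liftC/lt_ij.
- exact: bracket_lift_self.
Qed.

End BracketOfGenerators.

(* The universal property of the commutative polynomial algebra in x, y, z. *)
Definition polynomial_in (K : fieldType) (A : comAlgType K) (x y z : A) : Prop :=
  generates (fun i : 'I_3 => nth 0 [:: x; y; z] i) /\
  forall (B : comAlgType K) (a b c : B),
    exists g : {lrmorphism A -> B}, [/\ g x = a, g y = b & g z = c].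

Lemma mpoly_polynomial (K : fieldType) :
  polynomial_in (mvar K (0 : 'I_3)) (mvar K (1 : 'I_3)) (mvar K (2 : 'I_3)).
Proof.
split.
  apply: generatesW (@generates_mvar K 3) => S hS St.
  by apply: ord3P; [apply: (St 0) | apply: (St 1) | apply: (St 2%R)].
move=> B a b c; exists (mpoly_lift (fun i : 'I_3 => nth 0 [:: a; b; c] i)).
by split; rewrite /= mpoly_lift_mvar.
Qed.

(** * U(sl_2) as a deformation *)

Section DeformationSl2.
Variables (K : fieldType) (A : comAlgType K) (x y z : A) (P : poisson A).
Hypothesis two_neq0 : 2%:R != 0 :> K.
Hypothesis xyz : polynomial_in x y z.
Hypothesis Pxy : P x y = 2%:R * z.
Hypothesis Pyz : P y z = - y.
Hypothesis Pzx : P z x = - x.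

Variables (T : algType K) (t : 'I_4 -> T).
Hypothesis T_gen : generates t.
Hypothesis T_rels : all_zero (hsl2_rels t).
Hypothesis T_lift : forall (B : algType K) (c : 'I_4 -> B), all_zero (hsl2_rels c) ->
  exists g : {lrmorphism T -> B}, forall i, g (t i) = c i.
Local Notation h := (t 0).
Local Notation X := (t 1).
Local Notation Y := (t 2%R).
Local Notation Z := (t 3%R).

Fact hsl2_relations : [/\ h * X = X * h, h * Y = Y * h & h * Z = Z * h] /\
  [/\ X * Y = Y * X + 2%:R *: (h * Z), Y * Z = Z * Y - h * Y & Z * X = X * Z - h * X].
Proof.
have [r1 [r2 [r3 [r4 [r5 [r6 _]]]]]] := T_rels.
have e0 (u v : T) : u - v = 0 -> u = v by move/eqP; rewrite subr_eq0 => /eqP.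
have e1 (u v w : T) : u - v - w = 0 -> u = v + w.
  by move=> e; apply: e0; rewrite opprD addrA.
have e2 (u v w : T) : u - v + w = 0 -> u = v - w.
  by move=> e; apply: e0; rewrite opprB addrA addrAC.
split; split; [exact: e0 r1|exact: e0 r2|exact: e0 r3|exact: e1 r4|exact: e2 r5|exact: e2 r6].
Qed.

Lemma hsl2_h_central : is_central h.
Proof.
have [[hx hy hz] _] := hsl2_relations.
apply: (is_central_gen T_gen).
exact: ord4P.
Qed.

Lemma hsl2_h_regular u : h * u = 0 -> u = 0.
Proof.
have [[hx hy hz] [xy yz zx]] := hsl2_relations.
have [rho rhoE] := T_lift (hsl2_act_rels K).
apply: (@regular_of_module K T _ t T_gen _ _ _ rho (hsl2_monomial h X Y Z)).
- by rewrite hsl2_monomial_basis !mul1r.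
- move=> i v; rewrite rhoE; move: i; apply: ord4P; rewrite /hsl2_act /= to_endoE.
  + exact: hsl2_monomial_h.
  + exact: hsl2_monomial_x.
  + by have [] := hsl2_monomial_yz hx hy hz xy yz zx v.
  + by have [] := hsl2_monomial_yz hx hy hz xy yz zx v.
- move=> v; rewrite rhoE /hsl2_act /= to_endoE => v0.
  (* Multiplication by h raises the last exponent, and the predecessor is a left inverse of this
     shift. *)
  rewrite -[v](fm_reindexK (g := fun m => (m.1.1.1, m.1.1.2, m.1.2, m.2.+1))
    (g' := fun m => (m.1.1.1, m.1.1.2, m.1.2, m.2.-1))); last by case=> [[[? ?] ?] ?].
  by rewrite [X in fm_reindex _ _ X]v0 lin0.
Qed.

Lemma hsl2_eval : exists f : {lrmorphism T -> A},
  [/\ f h = 0, f X = x, f Y = y & f Z = z].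
Proof.
have [|f fE] := @T_lift A
  (fun i : 'I_4 => nth 0 [:: 0; x; y; z] i).
  by rewrite /= !mul0r !mulr0 scaler0 (mulrC y x) (mulrC z y) (mulrC x z) !(subrr, addr0).
by exists f; split; rewrite fE.
Qed.

Variables (U : algType K) (e : {linear sl K 2 -> U}).
Hypothesis U_gen : generates e.
Hypothesis U_br : forall u v, e (lie_br u v) = e u * e v - e v * e u.
Hypothesis U_lift : forall (B : algType K) (g : {linear sl K 2 -> B}),
  (forall u v, g (lie_br u v) = g u * g v - g v * g u) ->
  exists G : {lrmorphism U -> B}, forall u, G (e u) = g u.
Local Notation E := (e (sl2_elt (0 : K) 1 0)).
Local Notation F := (e (sl2_elt (0 : K) 0 1)).
Local Notation H := (e (sl2_elt (1 : K) 0 0)).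

Lemma env_sl2_relations :
  [/\ E * F - F * E = H, H * E - E * H = 2%:R *: E & H * F - F * H = - (2%:R *: F)].
Proof.
have Z a p q r : a *: sl2_elt p q r = sl2_elt (a * p) (a * q) (a * r) :> sl K 2.
  rewrite -[LHS]addr0 -(scale0r (sl2_elt p q r)) sl2_elt_comb !mul0r !addr0 //.
have N p q r : - sl2_elt p q r = sl2_elt (- p) (- q) (- r) :> sl K 2.
  by rewrite -scaleN1r Z !mulN1r.
by split; rewrite -U_br sl2_elt_br -?(linZ e) ?Z -?(linN e) ?N; congr (e (sl2_elt _ _ _)); ring.
Qed.

Lemma env_sl2_elt p q r : e (sl2_elt p q r) = p *: H + q *: E + r *: F.
Proof.
rewrite -!(linZ e) -!(linD e); congr (e _).
rewrite sl2_elt_comb -[X in X + _]scale1r sl2_elt_comb.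
congr sl2_elt; ring.
Qed.

Lemma hsl2_env : exists phi : {lrmorphism T -> U},
  [/\ phi h = 1, phi X = E, phi Y = - F & phi Z = - (2%:R^-1 *: H)].
Proof.
have [EF HE HF] := env_sl2_relations.
have [|f fE] := @T_lift U
  (fun i : 'I_4 => nth 0 [:: 1; E; - F; - (2%:R^-1 *: H)] i).
  have EF' : E * F = F * E + H by rewrite -EF addrC subrK.
  have HE' : H * E = E * H + 2%:R *: E by rewrite -HE addrC subrK.
  have HF' : H * F = F * H - 2%:R *: F by rewrite -HF addrC subrK.
  rewrite /= !mul1r !mulr1 !subrr; do 3!split=> //.
  rewrite !mulrN !mulNr -!scalerAl -!scalerAr EF' HE' HF'.
  by do 3?split=> //; lmod_coefs K (U : lmodType K); field.
by exists f; split; rewrite fE.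
Qed.

Lemma env_sl2_deformation_subproof : is_deformation P U.
Proof.
have [f [fh fX fY fZ]] := hsl2_eval.
have [phi [ph pX pY pZ]] := hsl2_env.
have [[hx hy hz] [xy yz zx]] := hsl2_relations.
have [A_gen A_lift] := xyz.
have [EF HE HF] := env_sl2_relations.
apply: (@is_deformation_intro K A P U T _ t h 1 T_gen hsl2_h_central
  hsl2_h_regular f fh _ _ _ phi); rewrite ?scale1r //.
- apply: generatesW A_gen => S hS St; apply: ord3P => /=.
  + by rewrite -fX.
  + by rewrite -fY.
  + by rewrite -fZ.
- move=> B p ph0; have [g [gx gy gz]] := A_lift B (p X) (p Y) (p Z).
  exists g; apply: ord4P; rewrite ?fh ?fX ?fY ?fZ //.
  by rewrite ph0 (lrmorph0 g).
- apply: bracket_lift_ordinal; apply: ord4P => j; move: j; apply: ord4P => // _.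
  + by apply: (@bracket_lift_central K T A P h f _ _ 0); rewrite ?scale0r //; apply: hsl2_h_central.
  + by apply: (@bracket_lift_central K T A P h f _ _ 0); rewrite ?scale0r //; apply: hsl2_h_central.
  + by apply: (@bracket_lift_central K T A P h f _ _ 0); rewrite ?scale0r //; apply: hsl2_h_central.
  + exists (2%:R *: Z); first by rewrite xy addrAC subrr add0r scalerAr.
    by rewrite (lrmorphZ f) fX fY fZ Pxy scaler_nat mulr_natl.
  + apply: bracket_liftC; exists (- X); first by rewrite zx addrAC subrr add0r mulrN.
    by rewrite (lrmorphN f) fX fZ Pzx.
  + exists (- Y); first by rewrite yz addrAC subrr add0r mulrN.
    by rewrite (lrmorphN f) fY fZ Pyz.
- apply: generatesW U_gen => S hS St u.
  have [p [q [r ->]]] := sl2_eltP u; rewrite env_sl2_elt; case: (hS) => _ SD SM.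
  have SZ k v : S v -> S (k *: v) by apply: is_subalgZ.
  have SH : S H.
    rewrite (_ : H = (- 2%:R) *: phi Z); first exact/SZ/(St 3%R).
    by rewrite pZ scalerN scalerA mulNr divff // scaleNr scale1r opprK.
  have SF : S F.
    rewrite (_ : F = (- 1) *: phi Y); first exact/SZ/(St 2%R).
    by rewrite pY scaleN1r opprK.
  have SE : S E by rewrite -pX; apply: (St 1).
  by apply: (SD); [apply: (SD)|]; apply: SZ.
- move=> B p ph1.
  have php := ph1; rewrite scale1r in php.
  (* Inverting the substitution of [phi]: E, F, H go to p X, - p Y, - 2 p Z. *)
  pose g (u : sl K 2) : B := sl2_val u 0 1 *: p X - sl2_val u 1 0 *: p Y
    - (2%:R * sl2_val u 0 0) *: p Z.
  have gE a b c : g (sl2_elt a b c) = b *: p X - c *: p Y - (2%:R * a) *: p Z.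
    by rewrite /g sl2_val_elt !sl2_mxE.
  have g_lin : linear g.
    move=> k u v; rewrite /g linearP !mxE.
    by lmod K (B : lmodType K).
  pose g' : {linear sl K 2 -> B} := HB.pack g (GRing.isLinear.Build K (sl K 2) B _ g g_lin).
  have [|G GE] := @U_lift B g'.
    have pxy : p X * p Y = p Y * p X + 2%:R *: p Z.
      by rewrite -(lrmorphM p) xy (lrmorphD p) (lrmorphZ p) !(lrmorphM p) php mul1r.
    have pyz : p Y * p Z = p Z * p Y - p Y.
      by rewrite -(lrmorphM p) yz (lrmorphB p) !(lrmorphM p) php mul1r.
    have pzx : p Z * p X = p X * p Z - p X.
      by rewrite -(lrmorphM p) zx (lrmorphB p) !(lrmorphM p) php mul1r.
    move=> u v; rewrite -[LHS]/(g _) -![g' _]/(g _).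
    have [a [b [c ->]]] := sl2_eltP u; have [a' [b' [c' ->]]] := sl2_eltP v.
    rewrite sl2_elt_br !gE.
    rewrite ?(mulrDl, mulrDr, mulrN, mulNr, scalerDr) -?scalerAl -?scalerAr ?scalerA.
    rewrite pxy pyz pzx.
    by lmod K (B : lmodType K).
  exists G; apply: ord4P; rewrite ?ph ?pX ?pY ?pZ ?(lrmorph1 G) ?php //.
  + by rewrite GE [LHS]gE !(mulr0, scale0r, scale1r, subr0).
  + by rewrite (lrmorphN G) GE [g' _]gE !(mulr0, scale0r, scale1r, subr0) sub0r opprK.
  + rewrite (lrmorphN G) (lrmorphZ G) GE [g' _]gE !(mulr1, scale0r, oppr0, add0r).
    by rewrite scalerN scalerA mulVf // scale1r opprK.
Qed.

End DeformationSl2.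

Lemma env_sl2_deformation (K : fieldType) (A : comAlgType K) (x y z : A) (P : poisson A) :
  2%:R != 0 :> K -> polynomial_in x y z ->
  P x y = 2%:R * z -> P y z = - y -> P z x = - x ->
  is_deformation P (env_alg (sl K 2)).
Proof.
move=> two_neq0 xyz Pxy Pyz Pzx.
have [T [t [T_gen T_rels T_lift]]] := presented_exists (@hsl2_rels_natural K) (@hsl2_rels0 K).
exact: (@env_sl2_deformation_subproof K A x y z P two_neq0 xyz Pxy Pyz Pzx T t T_gen
  T_rels T_lift (env_alg (sl K 2)) (@env_gen K (sl K 2)) (@generates_env_gen K (sl K 2))
  (@env_gen_br K (sl K 2)) (@env_lift K (sl K 2))).
Qed.

(** * Integer powers of a unit *)

Section InvertiblePowers.
Variables (K : fieldType) (T : algType K) (u u' : T).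
Hypotheses (uu' : u * u' = 1) (u'u : u' * u = 1).

Definition zpow (j : int) : T := match j with Posz n => u ^+ n | Negz n => u' ^+ n.+1 end.

Lemma zpowS j : u * zpow j = zpow (j + 1).
Proof.
case: j => n; first by rewrite addrC -intS /= -exprS.
rewrite NegzE intS opprD addrAC addNr add0r -opprD -intS -NegzE.
case: n => [|n]; first by rewrite oppr0 /= expr1.
by rewrite -NegzE /= exprS mulrA uu' mul1r.
Qed.

Lemma zpowB j : u' * zpow j = zpow (j - 1).
Proof.
rewrite -{1}[j](subrK 1) -zpowS mulrA u'u mul1r.
by [].
Qed.

Lemma zpow_comm j v : v * u = u * v -> v * zpow j = zpow j * v.
Proof.
move=> vu; have vu' : v * u' = u' * v.
  by rewrite -[v in LHS]mul1r -u'u -!mulrA [u * (v * _)]mulrA -vu -!mulrA uu' mulr1.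
case: j => n; [exact: (commrX n vu) | exact: (commrX n.+1 vu')].
Qed.

End InvertiblePowers.

Lemma ord6P (P : 'I_6 -> Prop) : P 0 -> P 1 -> P 2%R -> P 3%R -> P 4%R -> P 5%R ->
  forall i, P i.
Proof.
by move=> P0 P1 P2 P3 P4 P5 [[|[|[|[|[|[|//]]]]]] p];
  [move: P0 | move: P1 | move: P2 | move: P3 | move: P4 | move: P5]; congr P; apply: val_inj.
Qed.

(** * A PBW basis of U_q(sl_2) with q^2 an indeterminate *)

Section QuantumSl2.
Variable K : fieldType.

(* U_q(sl_2) with q^2 replaced by a central indeterminate Q, and with E rescaled
   to x so that the last relation has no denominator. *)
Definition qsl2_rels (T : algType K) (c : 'I_6 -> T) : seq T :=
  let Q := c 0 in let Q' := c 1 in let x := c 2%R in let y := c 3%R in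
  let k := c 4%R in let k' := c 5%R in
  [:: Q * Q' - 1; Q' * Q - 1; k * k' - 1; k' * k - 1;
      Q * x - x * Q; Q * y - y * Q; Q * k - k * Q;
      k * x - Q * (x * k); y * k - Q * (k * y);
      x * y - y * x - (Q - 1) * (k - k')].

Lemma qsl2_rels_natural (T U : algType K) (f : {lrmorphism T -> U}) (c : 'I_6 -> T) :
  map f (qsl2_rels c) = qsl2_rels (fun i => f (c i)).
Proof. by rewrite /= !lrmorphE. Qed.

Lemma qsl2_rels0 :
  all_zero (qsl2_rels (fun i : 'I_6 => ((i != 2%R) && (i != 3%R))%:R : K^o)).
Proof. by rewrite /= !(mulr0, mul0r, mulr1, subrr). Qed.

Let I : choiceType := (nat * nat * int * int)%type.
Let V := malg_free_module K I.
Let b (i k : nat) (j l : int) : V := fm_basis V (i, k, j, l).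

Definition qsl2_Q := fm_reindex V (fun m : I => (m.1.1.1, m.1.1.2, m.1.2, m.2 + 1)).
Definition qsl2_Q' := fm_reindex V (fun m : I => (m.1.1.1, m.1.1.2, m.1.2, m.2 - 1)).
Definition qsl2_x := fm_reindex V (fun m : I => (m.1.1.1.+1, m.1.1.2, m.1.2, m.2)).
(** The shift of the last exponent is k x^i y^n = Q^(i-n) x^i y^n k. *)
Definition qsl2_k := fm_reindex V (fun m : I =>
  (m.1.1.1, m.1.1.2, m.1.2 + 1, m.2 + m.1.1.1%:Z - m.1.1.2%:Z)).
Definition qsl2_k' := fm_reindex V (fun m : I =>
  (m.1.1.1, m.1.1.2, m.1.2 - 1, m.2 - m.1.1.1%:Z + m.1.1.2%:Z)).
Local Notation Q := qsl2_Q.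
Local Notation Q' := qsl2_Q'.
Local Notation x := qsl2_x.
Local Notation k := qsl2_k.
Local Notation k' := qsl2_k'.

Lemma qsl2_Q_basis i n j l : Q (b i n j l) = b i n j (l + 1).
Proof. exact: fm_reindex_basis. Qed.
Lemma qsl2_x_basis i n j l : x (b i n j l) = b i.+1 n j l.
Proof. exact: fm_reindex_basis. Qed.
Lemma qsl2_k_basis i n j l : k (b i n j l) = b i n (j + 1) (l + i%:Z - n%:Z).
Proof. exact: fm_reindex_basis. Qed.

Lemma qsl2_QK v : Q (Q' v) = v.
Proof. by apply: fm_reindexK => -[[[i n] j] l] /=; rewrite subrK. Qed.
Lemma qsl2_QK' v : Q' (Q v) = v.
Proof. by apply: fm_reindexK => -[[[i n] j] l] /=; rewrite addrK. Qed.
Lemma qsl2_kK v : k (k' v) = v.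
Proof.
apply: fm_reindexK => -[[[i n] j] l] /=; rewrite subrK; congr (_, _).
by ring.
Qed.
Lemma qsl2_kK' v : k' (k v) = v.
Proof.
apply: fm_reindexK => -[[[i n] j] l] /=; rewrite addrK; congr (_, _).
by ring.
Qed.
Lemma qsl2_xQ v : x (Q v) = Q (x v).
Proof. exact: fm_reindexC. Qed.
Lemma qsl2_kQ v : k (Q v) = Q (k v).
Proof. by apply: fm_reindexC => -[[[i n] j] l] /=; congr (_, _); ring. Qed.
Lemma qsl2_k'Q v : k' (Q v) = Q (k' v).
Proof. by rewrite -[Q (k' v)]qsl2_kK' qsl2_kQ qsl2_kK. Qed.

(* x^i y^n k^j Q^l; the values of y at i + 1 are forced by the commutator of
   x and y. *)
Fixpoint qsl2_act_y (i n : nat) (j l : int) : V :=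
  if i is i'.+1 then
    let w := k (b i' n j l) - k' (b i' n j l) in
    x (qsl2_act_y i' n j l) - (Q w - w)
  else b 0 n.+1 j l.

Definition qsl2_y : {linear V -> V} :=
  fm_lift V (fun m : I => qsl2_act_y m.1.1.1 m.1.1.2 m.1.2 m.2).
Local Notation y := qsl2_y.

Lemma qsl2_y_basis i n j l : y (b i n j l) = qsl2_act_y i n j l.
Proof. exact: fm_lift_basis. Qed.

Lemma qsl2_ext (W : lmodType K) (f g : {linear V -> W}) :
  (forall i n j l, f (b i n j l) = g (b i n j l)) -> f =1 g.
Proof. by move=> e; apply: fm_ext => -[[[i n] j] l]; apply: e. Qed.

(** As y is defined by recursion on the exponent of x, identities of operators are checked at
    exponent 0 and propagated along x. *)
Lemma qsl2_ext_x (W : lmodType K) (f g : {linear V -> W}) :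
  (forall n j l, f (b 0 n j l) = g (b 0 n j l)) ->
  (forall v, f v = g v -> f (x v) = g (x v)) -> f =1 g.
Proof.
move=> e0 eS; apply: qsl2_ext; elim=> [|i IH] n j l; first exact: e0.
by rewrite -qsl2_x_basis; apply/eS/IH.
Qed.

Lemma qsl2_y_x v : y (x v) = x (y v) - (Q (k v - k' v) - (k v - k' v)).
Proof.
apply: (qsl2_ext (f := y \o x)
  (g := (x \o y) \- ((Q \o (k \- k')) \- (k \- k')))) => i n j l /=.
by rewrite qsl2_x_basis !qsl2_y_basis.
Qed.

Lemma qsl2_yQ v : y (Q v) = Q (y v).
Proof.
apply: (qsl2_ext_x (f := y \o Q) (g := Q \o y)) => [n j l|{}v e] /=.
  by rewrite qsl2_Q_basis !qsl2_y_basis /= qsl2_Q_basis.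
have {}e : y (Q v) = Q (y v) := e.
rewrite -qsl2_xQ !qsl2_y_x e !(linB Q) !qsl2_kQ !qsl2_k'Q qsl2_xQ.
by [].
Qed.

Lemma qsl2_kx v : k (x v) = Q (x (k v)).
Proof.
apply: (qsl2_ext (f := k \o x) (g := Q \o x \o k)) => i n j l /=.
rewrite qsl2_x_basis !qsl2_k_basis qsl2_x_basis qsl2_Q_basis; congr b.
by rewrite intS; ring.
Qed.

Lemma qsl2_yk v : y (k v) = Q (k (y v)).
Proof.
apply: (qsl2_ext_x (f := y \o k) (g := Q \o k \o y)) => [n j l|{}v e] /=.
  rewrite qsl2_k_basis !qsl2_y_basis /= qsl2_k_basis qsl2_Q_basis; congr b.
  by rewrite intS; ring.
have {}e : y (k v) = Q (k (y v)) := e.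
rewrite qsl2_kx qsl2_yQ !qsl2_y_x e ?(linB Q) ?(linB k) ?(linB Q).
by rewrite !(qsl2_kQ, qsl2_xQ, qsl2_kx, qsl2_kK, qsl2_kK') ?(linB Q).
Qed.

Lemma qsl2_v0_neq0 : b 0 0 0 0 <> 0.
Proof.
move/(congr1 (fm_coord (0%N, 0%N, 0 : int, 0 : int))); rewrite fm_coord0 fm_coord_basis eqxx.
by apply/eqP; rewrite oner_eq0.
Qed.

Definition qsl2_act (i : 'I_6) : endo qsl2_v0_neq0 :=
  nth 0 [seq to_endo qsl2_v0_neq0 f | f : {linear V -> V} <- [:: Q; Q'; x; y; k; k']] i.

Lemma qsl2_act_rels : all_zero (qsl2_rels qsl2_act).
Proof.
do 10?split=> //; apply: endoP => v;
  rewrite !(endo_funD, endo_funN, endo_funZ, endo_funM, endo_fun0, endo_fun1) !to_endoE.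
- by rewrite qsl2_QK subrr.
- by rewrite qsl2_QK' subrr.
- by rewrite qsl2_kK subrr.
- by rewrite qsl2_kK' subrr.
- by rewrite qsl2_xQ subrr.
- by rewrite qsl2_yQ subrr.
- by rewrite qsl2_kQ subrr.
- by rewrite qsl2_kx subrr.
- by rewrite qsl2_yk subrr.
- by rewrite qsl2_y_x subKr subrr.
Qed.

Lemma qsl2_Q_fixed0 v : Q v = v -> v = 0.
Proof.
apply: fm_reindex_fixed0.
  by move=> [[[i n] j] l] [[[i' n'] j'] l'] /= [-> -> -> /addIr ->].
move=> [[[i n] j] l] m m'.
have iterE r : iter r (fun m : I => (m.1.1.1, m.1.1.2, m.1.2, m.2 + 1)) (i, n, j, l)
    = (i, n, j, l + r%:Z).
  elim: r => [|r IH]; first by rewrite addr0.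
  by rewrite iterS IH /= intS -addrA [1 + _]addrC.
by rewrite !iterE => -[/addrI [->]].
Qed.

Section Monomials.
Variables (T : algType K) (t : 'I_6 -> T).
Local Notation tQ := (t 0).
Local Notation tQ' := (t 1).
Local Notation tx := (t 2%R).
Local Notation ty := (t 3%R).
Local Notation tk := (t 4%R).
Local Notation tk' := (t 5%R).
Hypotheses (QQ' : tQ * tQ' = 1) (Q'Q : tQ' * tQ = 1)
  (kk' : tk * tk' = 1) (k'k : tk' * tk = 1).
Hypotheses (Qx : tQ * tx = tx * tQ) (Qy : tQ * ty = ty * tQ) (Qk : tQ * tk = tk * tQ).
Hypotheses (kx : tk * tx = tQ * (tx * tk)) (yk : ty * tk = tQ * (tk * ty)).
Hypothesis xy : tx * ty = ty * tx + (tQ - 1) * (tk - tk').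

Definition qsl2_monomial : {linear V -> T} := fm_lift V (fun m : I =>
  tx ^+ m.1.1.1 * (ty ^+ m.1.1.2 * (zpow tk tk' m.1.2 * zpow tQ tQ' m.2))).
Local Notation s := qsl2_monomial.

Lemma qsl2_monomial_basis i n j l :
  s (b i n j l) = tx ^+ i * (ty ^+ n * (zpow tk tk' j * zpow tQ tQ' l)).
Proof. exact: fm_lift_basis. Qed.

Lemma qsl2_monomial_x v : s (x v) = tx * s v.
Proof.
apply: (qsl2_ext (f := s \o x) (g := mul_left tx \o s)) => i n j l /=.
by rewrite qsl2_x_basis !qsl2_monomial_basis /mul_left exprS -mulrA.
Qed.

Lemma qsl2_monomial_Q v : s (Q v) = tQ * s v.
Proof.
apply: (qsl2_ext (f := s \o Q) (g := mul_left tQ \o s)) => i n j l /=.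
rewrite qsl2_Q_basis !qsl2_monomial_basis /mul_left -zpowS //.
rewrite [RHS]mulrA (commrX i Qx) -[RHS]mulrA; congr (_ * _).
rewrite [RHS]mulrA (commrX n Qy) -[RHS]mulrA; congr (_ * _).
by rewrite [RHS]mulrA (zpow_comm kk' k'k _ Qk) -[RHS]mulrA.
Qed.

Lemma qsl2_monomial_Q' v : s (Q' v) = tQ' * s v.
Proof. by rewrite -{2}[v]qsl2_QK qsl2_monomial_Q mulrA Q'Q mul1r. Qed.

Lemma qsl2_monomial_k v : s (k v) = tk * s v.
Proof.
apply: (qsl2_ext_x (f := s \o k) (g := mul_left tk \o s)) => [n j l|{}v e] /=.
  have y0 m i r : s (y (b 0 m i r)) = ty * s (b 0 m i r).
    by rewrite qsl2_y_basis /= !qsl2_monomial_basis !mul1r exprS -mulrA.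
  have yb m i r : b 0 m.+1 i r = y (b 0 m i r) by rewrite qsl2_y_basis.
  elim: n j l => [|n IH] j l; rewrite /mul_left.
    rewrite qsl2_k_basis !qsl2_monomial_basis !mul1r !addr0.
    by rewrite -zpowS // mulrA.
  (* The relation y k = Q k y controls k y only up to the factor Q, so both sides are compared after
     multiplication by the unit Q. *)
  rewrite yb y0; apply: (can_inj (g := fun u => tQ' * u) (f := fun u => tQ * u)).
    by move=> u; rewrite mulrA Q'Q mul1r.
  rewrite -qsl2_monomial_Q -qsl2_yk qsl2_k_basis y0 -qsl2_k_basis IH /mul_left.
  by rewrite !mulrA yk !mulrA.
have {}e : s (k v) = tk * s v := e.
rewrite qsl2_kx qsl2_monomial_Q !qsl2_monomial_x e /mul_left.
by rewrite !mulrA kx !mulrA.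
Qed.

Lemma qsl2_monomial_k' v : s (k' v) = tk' * s v.
Proof. by rewrite -{2}[v]qsl2_kK qsl2_monomial_k mulrA k'k mul1r. Qed.

Lemma qsl2_monomial_y v : s (y v) = ty * s v.
Proof.
apply: (qsl2_ext_x (f := s \o y) (g := mul_left ty \o s)) => [n j l|{}v e] /=.
  by rewrite qsl2_y_basis /mul_left /= !qsl2_monomial_basis !mul1r exprS -mulrA.
have {}e : s (y v) = ty * s v := e.
rewrite /mul_left qsl2_y_x !(linB s) !qsl2_monomial_Q !qsl2_monomial_x !(linB s).
rewrite e qsl2_monomial_k qsl2_monomial_k' !mulrA xy.
rewrite !(mulrDl, mulrDr, mulNr, mul1r, mulrN, mulrA).
by lmod K (T : lmodType K).
Qed.

End Monomials.
End QuantumSl2.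

(* The universal property of the algebra K[x, y, z^+-1], with z' the inverse of z. *)
Definition laurent_in (K : fieldType) (A : comAlgType K) (x y z z' : A) : Prop :=
  [/\ generates (fun i : 'I_4 => nth 0 [:: x; y; z; z'] i), z * z' = 1 &
  forall (B : comAlgType K) (a b c c' : B), c * c' = 1 ->
    exists g : {lrmorphism A -> B}, [/\ g x = a, g y = b, g z = c & g z' = c']].

Lemma laurent3_laurent (K : fieldType) :
  laurent_in (lvar K 0) (lvar K 1) (lvar K 2) (lvar K 3).
Proof.
split; last 1 first.
- move=> B a b c c' cc'.
  have [g gE] := @laurent_lift K B (fun i : 'I_4 => nth 0 [:: a; b; c; c'] i) cc'.
  by exists g; rewrite !gE.
- apply: generatesW (@generates_lvar K) => S hS St.
  by apply: ord4P; [apply: (St 0) | apply: (St 1) | apply: (St 2%R) | apply: (St 3%R)].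
- exact: lvar_zw.
Qed.

Section QuantumRelations.
Variables (K : fieldType) (q : K).

Definition uq_rels (T : algType K) (c : 'I_4 -> T) : seq T :=
  let E := c 0 in let F := c 1 in let k := c 2%R in let k' := c 3%R in
  [:: k * k' - 1; k' * k - 1; k * E - q ^+ 2 *: (E * k); k * F - q ^- 2 *: (F * k);
      E * F - F * E - (q - q^-1)^-1 *: (k - k')].

Lemma uq_rels_natural (T U : algType K) (f : {lrmorphism T -> U}) (c : 'I_4 -> T) :
  map f (uq_rels c) = uq_rels (fun i => f (c i)).
Proof. by rewrite /= !lrmorphE. Qed.

End QuantumRelations.

(** * U_q(sl_2) as a deformation *)

Section QuantumDeformation.
Variables (K : fieldType) (q : K) (A : comAlgType K) (x y z z' : A) (P : poisson A).
Hypothesis two_neq0 : 2%:R != 0 :> K.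
Hypotheses (q_neq0 : q != 0) (q2_neq1 : q ^+ 2 != 1).
Hypothesis xyz : laurent_in x y z z'.
Hypothesis Pxy : P x y = 2%:R * (z - z').
Hypothesis Pyz : P y z = 2%:R * z * y.
Hypothesis Pzx : P z x = 2%:R * z * x.

Variables (T : algType K) (t : 'I_6 -> T).
Hypothesis T_gen : generates t.
Hypothesis T_rels : all_zero (qsl2_rels t).
Hypothesis T_lift : forall (B : algType K) (c : 'I_6 -> B), all_zero (qsl2_rels c) ->
  exists g : {lrmorphism T -> B}, forall i, g (t i) = c i.
Local Notation Q := (t 0).
Local Notation Q' := (t 1).
Local Notation X := (t 2%R).
Local Notation Y := (t 3%R).
Local Notation k := (t 4%R).
Local Notation k' := (t 5%R).
(** The factor 1/2 fits the prescribed brackets: [X, Y] = (Q - 1) (k - k') = h * 2 (k - k'). *)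
Local Notation h := (2%:R^-1 *: (Q - 1)).

Variables (U : algType K) (u : 'I_4 -> U).
Hypothesis U_gen : generates u.
Hypothesis U_rels : all_zero (uq_rels q u).
Hypothesis U_lift : forall (B : algType K) (c : 'I_4 -> B), all_zero (uq_rels q c) ->
  exists g : {lrmorphism U -> B}, forall i, g (u i) = c i.

Let eq0 (V : zmodType) (a b : V) : a - b = 0 -> a = b.
Proof. by move/eqP; rewrite subr_eq0 => /eqP. Qed.

Fact qsl2_units : [/\ Q * Q' = 1, Q' * Q = 1, k * k' = 1 & k' * k = 1].
Proof.
by have [r1 [r2 [r3 [r4 _]]]] := T_rels; split; [exact: eq0 r1|exact: eq0 r2|exact: eq0 r3|exact: eq0 r4].
Qed.

Fact qsl2_Q_comm : [/\ Q * X = X * Q, Q * Y = Y * Q & Q * k = k * Q].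
Proof.
have [_ [_ [_ [_ [r1 [r2 [r3 _]]]]]]] := T_rels.
by split; [exact: eq0 r1|exact: eq0 r2|exact: eq0 r3].
Qed.

Fact qsl2_relations : [/\ k * X = Q * (X * k), Y * k = Q * (k * Y) &
  X * Y = Y * X + (Q - 1) * (k - k')].
Proof.
have [_ [_ [_ [_ [_ [_ [_ [r1 [r2 [r3 _]]]]]]]]]] := T_rels.
split; [exact: eq0 r1|exact: eq0 r2|].
by apply: eq0; rewrite opprD addrA; exact: r3.
Qed.

Lemma qsl2_Q_central : is_central Q.
Proof.
have [QX QY Qk] := qsl2_Q_comm; have [QQ' Q'Q kk' k'k] := qsl2_units.
apply: (is_central_gen T_gen); apply: ord6P => //.
- by rewrite QQ' Q'Q.
- by rewrite -[Q * k']mul1r -k'k -!mulrA [k * (Q * _)]mulrA -Qk -!mulrA kk' mulr1.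
Qed.

Lemma qsl2_Q'_central : is_central Q'.
Proof.
have [QQ' Q'Q kk' k'k] := qsl2_units => v.
by rewrite -[v in LHS]mulr1 -QQ' [v * (Q * _)]mulrA -qsl2_Q_central !mulrA Q'Q mul1r.
Qed.

Lemma qsl2_h_central : is_central h.
Proof. by move=> v; rewrite -scalerAl -scalerAr mulrBl mulrBr mul1r mulr1 qsl2_Q_central. Qed.

Lemma qsl2_h_regular v : h * v = 0 -> v = 0.
Proof.
have [QX QY Qk] := qsl2_Q_comm; have [QQ' Q'Q kk' k'k] := qsl2_units.
have [kX Yk XY] := qsl2_relations.
have [rho rhoE] := T_lift (qsl2_act_rels K).
apply: (@regular_of_module K T _ t T_gen _ _ _ rho (qsl2_monomial t)).
- by rewrite qsl2_monomial_basis !mul1r.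
- move=> i w; rewrite rhoE; move: i; apply: ord6P; rewrite /qsl2_act /= to_endoE.
  + exact: qsl2_monomial_Q.
  + exact: qsl2_monomial_Q'.
  + exact: qsl2_monomial_x.
  + exact: qsl2_monomial_y.
  + exact: qsl2_monomial_k.
  + exact: qsl2_monomial_k'.
- move=> w; rewrite (lrmorphZ rho) (lrmorphB rho) (lrmorph1 rho) rhoE.
  rewrite endo_funZ endo_funD endo_funN endo_fun1 /qsl2_act /= to_endoE => w0.
  apply: qsl2_Q_fixed0; apply: eq0; move/eqP: w0.
  by rewrite scaler_eq0 invr_eq0 (negPf two_neq0) => /eqP.
Qed.

Lemma qsl2_eval : exists f : {lrmorphism T -> A},
  [/\ f Q = 1 /\ f Q' = 1, f X = x, f Y = y, f k = z & f k' = z'].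
Proof.
have [_ zz' _] := xyz.
have [|f fE] := @T_lift A (fun i : 'I_6 => nth 0 [:: 1; 1; x; y; z; z'] i).
  rewrite /= !mul1r !mulr1 !subrr mul0r (mulrC z' z) zz' (mulrC z x) (mulrC z y) (mulrC y x).
  by rewrite !subrr.
by exists f; split; rewrite ?fE.
Qed.

(** The value h = lam means Q = q^2, and X = alpha E turns [E, F] = (K - K^-1) / (q - q^-1) into
    [X, Y] = (q^2 - 1) (K - K^-1). *)
Local Notation lam := ((q ^+ 2 - 1) / 2%:R).
Local Notation alpha := ((q ^+ 2 - 1) * (q - q^-1)).

Let q2B1_neq0 : q ^+ 2 - 1 != 0. Proof. by rewrite subr_eq0. Qed.
Let qBqV_neq0 : q - q^-1 != 0.
Proof.
apply: contra q2B1_neq0 => /eqP e; rewrite (_ : q ^+ 2 - 1 = q * (q - q^-1)).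
  by rewrite e mulr0.
by field.
Qed.
Let alpha_neq0 : alpha != 0. Proof. exact: mulf_neq0. Qed.

Local Notation E := (u 0).
Local Notation F := (u 1).
Local Notation kU := (u 2%R).
Local Notation kU' := (u 3%R).

Fact uq_relations : [/\ kU * kU' = 1, kU' * kU = 1 & [/\ kU * E = q ^+ 2 *: (E * kU),
  kU * F = q ^- 2 *: (F * kU) & E * F = F * E + (q - q^-1)^-1 *: (kU - kU')]].
Proof.
have [r1 [r2 [r3 [r4 [r5 _]]]]] := U_rels.
split; [exact: eq0 r1|exact: eq0 r2|split; [exact: eq0 r3|exact: eq0 r4|]].
by apply: eq0; rewrite opprD addrA; exact: r5.
Qed.

Lemma qsl2_specialize : exists phi : {lrmorphism T -> U},
  [/\ phi Q = (q ^+ 2)%:A /\ phi Q' = (q ^- 2)%:A, phi X = alpha *: E, phi Y = F,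
      phi k = kU & phi k' = kU'].
Proof.
have [kk' k'k [kE kF EF]] := uq_relations.
have q2_neq0 : q ^+ 2 != 0 by rewrite expf_neq0.
have [|f fE] := @T_lift U (fun i : 'I_6 =>
    nth 0 [:: (q ^+ 2)%:A; (q ^- 2)%:A; alpha *: E; F; kU; kU'] i).
  rewrite /= !mulr_algl !mulr_algr kk' k'k !subrr !scalerA.
  rewrite divff // mulVf // scale1r !subrr; do 7!split=> //.
  rewrite -!scalerAr -!scalerAl kE kF EF !scalerA.
  do 3?split=> //.
  - by rewrite mulrC subrr.
  - by rewrite divff // scale1r subrr.
  - rewrite (mulrBl (kU - kU')) mulr_algl mul1r.
    by lmod_coefs K (U : lmodType K); field; rewrite ?q_neq0 ?qBqV_neq0.
by exists f; split; rewrite ?fE.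
Qed.

Lemma uq_sl2_deformation_subproof : is_deformation P U.
Proof.
have [f [[fQ fQ'] fX fY fk fk']] := qsl2_eval.
have [phi [[pQ pQ'] pX pY pk pk']] := qsl2_specialize.
have [QX QY Qk] := qsl2_Q_comm; have [QQ' Q'Q kk' k'k] := qsl2_units.
have [kX Yk XY] := qsl2_relations.
have [A_gen zz' A_lift] := xyz.
have [kkU k'kU [kE kF EF]] := uq_relations.
have Z2 (a : A) : (2%:R : K) *: a = 2%:R * a by rewrite scaler_nat mulr_natl.
have f_h : f h = 0 by rewrite (lrmorphZ f) (lrmorphB f) fQ (lrmorph1 f) subrr scaler0.
have hE v : (Q - 1) * v = h * (2%:R *: v).
  by rewrite -scalerAl -scalerAr scalerA mulVf // scale1r.
have Xk' : X * k' = Q * (k' * X).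
  rewrite -[X in LHS]mul1r -k'k -!mulrA [k * (X * _)]mulrA kX -!mulrA kk' mulr1.
  by rewrite !mulrA qsl2_Q_central.
have kY : k * Y = Q' * (Y * k) by rewrite Yk mulrA Q'Q mul1r.
have Yk' : Y * k' = Q' * (k' * Y).
  rewrite -[Y in LHS]mul1r -k'k -!mulrA [k * (Y * _)]mulrA kY -!mulrA kk' mulr1.
  by rewrite !mulrA qsl2_Q'_central.
(* The bracket with the inverse of z is forced by {a, z z'} = 0. *)
have Pz' a : P a z' = - (z' ^+ 2 * P a z).
  have e : P a z * z' + z * P a z' = 0 by rewrite -poisson_leibniz zz' (pb1r P).
  have -> : P a z' = z' * (P a z * z' + z * P a z') - (z * z' - 1) * P a z' - z' ^+ 2 * P a z.
    ring.
  by rewrite e zz' subrr mulr0 mul0r subrr sub0r.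
apply: (@is_deformation_intro K A P U T _ t h lam T_gen qsl2_h_central
  qsl2_h_regular f f_h _ _ _ phi).
- apply: generatesW A_gen => S hS St; apply: ord4P => /=.
  + by rewrite -fX.
  + by rewrite -fY.
  + by rewrite -fk.
  + by rewrite -fk'.
- move=> B p ph0.
  have pQ1 : p Q = 1.
    apply: eq0; move/eqP: ph0; rewrite (lrmorphZ p) (lrmorphB p) (lrmorph1 p).
    by rewrite scaler_eq0 invr_eq0 (negPf two_neq0) => /eqP.
  have pQ'1 : p Q' = 1 by rewrite -[LHS]mul1r -pQ1 -(lrmorphM p) QQ' (lrmorph1 p).
  have [|g [gx gy gz gz']] := A_lift B (p X) (p Y) (p k) (p k').
    by rewrite -(lrmorphM p) kk' (lrmorph1 p).
  exists g; apply: ord6P; rewrite ?fQ ?fQ' ?fX ?fY ?fk ?fk' ?pQ1 ?pQ'1 ?(lrmorph1 g) //.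
- have Qc j : bracket_lift P h f Q (t j).
    apply: (@bracket_lift_central K T A P h f _ _ 1); last by rewrite fQ scale1r.
    exact: qsl2_Q_central.
  have Q'c j : bracket_lift P h f Q' (t j).
    apply: (@bracket_lift_central K T A P h f _ _ 1); last by rewrite fQ' scale1r.
    exact: qsl2_Q'_central.
  have fE := (lrmorphN f, lrmorphZ f, lrmorphM f, lrmorphB f, fQ, fQ', fX, fY, fk, fk').
  apply: bracket_lift_ordinal; apply: ord6P => // j; move: j; apply: ord6P => // _.
  + exists (2%:R *: (k - k')); first by rewrite XY addrAC subrr add0r hE.
    by rewrite !fE Pxy Z2.
  + exists (2%:R *: - (X * k)).
      by rewrite -hE kX mulrN mulrBl mul1r opprB.
    by rewrite !fE (poissonC P) Pzx Z2; ring.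
  + exists (2%:R *: (k' * X)).
      by rewrite -hE Xk' mulrBl mul1r.
    rewrite !fE Pz' (poissonC P x z) Pzx Z2.
    have -> : - (z' ^+ 2 * - (2%:R * z * x)) = (z * z') * (2%:R * (z' * x)) by ring.
    by rewrite zz' mul1r.
  + exists (2%:R *: (k * Y)).
      by rewrite -hE Yk mulrBl mul1r.
    by rewrite !fE Pyz Z2 mulrA.
  + exists (2%:R *: - (Q' * (k' * Y))).
      by rewrite -hE Yk' mulrN mulrBl mul1r [Q * (Q' * _)]mulrA QQ' mul1r opprB.
    rewrite !fE Pz' Pyz Z2 mul1r.
    have -> : - (z' ^+ 2 * (2%:R * z * y)) = (z * z') * (2%:R * - (z' * y)) by ring.
    by rewrite zz' mul1r.
  + exists 0; first by rewrite kk' k'k subrr mulr0.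
    by rewrite (lrmorph0 f) fk fk' Pz' poisson_alternating mulr0 oppr0.
- rewrite (lrmorphZ phi) (lrmorphB phi) pQ (lrmorph1 phi).
  by rewrite [lam]mulrC -[RHS]scalerA scalerBl scale1r.
- apply: generatesW U_gen => S hS St; apply: ord4P.
  + rewrite (_ : E = alpha^-1 *: phi X); first exact: is_subalgZ hS (St 2%R).
    by rewrite pX scalerA mulVf // scale1r.
  + by rewrite -pY; apply: (St 3%R).
  + by rewrite -pk; apply: (St 4%R).
  + by rewrite -pk'; apply: (St 5%R).
- move=> B p ph.
  have p_Q : p Q = (q ^+ 2)%:A.
    move: ph; rewrite (lrmorphZ p) (lrmorphB p) (lrmorph1 p) mulrC -scalerA.
    have h2 : 2%:R^-1 != 0 :> K by rewrite invr_eq0.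
    move/(scalerI h2)/eqP; rewrite scalerBl scale1r subr_eq subrK => /eqP; exact.
  have p_Q' : p Q' = (q ^- 2)%:A.
    have e : q ^+ 2 *: p Q' = 1 by rewrite -mulr_algl -p_Q -(lrmorphM p) QQ' (lrmorph1 p).
    by rewrite -e scalerA mulVf ?scale1r // expf_neq0.
  have [|G GE] := @U_lift B (fun i : 'I_4 => nth 0 [:: alpha^-1 *: p X; p Y; p k; p k'] i).
    have p_kX : p k * p X = q ^+ 2 *: (p X * p k).
      by rewrite -(lrmorphM p) kX (lrmorphM p Q) p_Q mulr_algl (lrmorphM p).
    have p_kY : p k * p Y = q ^- 2 *: (p Y * p k).
      by rewrite -(lrmorphM p) kY (lrmorphM p Q') p_Q' mulr_algl (lrmorphM p).
    have p_XY : p X * p Y = p Y * p X + (q ^+ 2 - 1) *: (p k - p k').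
      rewrite -(lrmorphM p) XY (lrmorphD p) !(lrmorphM p) !(lrmorphB p) p_Q (lrmorph1 p).
      by rewrite scalerBl mulrBl mulr_algl scale1r mul1r.
    rewrite /= -!(lrmorphM p) kk' k'k (lrmorph1 p) !(lrmorphM p) !subrr; do 2!split=> //.
    rewrite -!scalerAr -!scalerAl p_kX p_kY p_XY !scalerA.
    do 3?split=> //.
    + by rewrite mulrC subrr.
    + by rewrite subrr.
    + by lmod_coefs K (B : lmodType K); field; rewrite ?q_neq0 ?qBqV_neq0 ?q2B1_neq0.
  exists G; apply: ord6P; rewrite ?pQ ?pQ' ?pX ?pY ?pk ?pk' ?(lrmorphZ G) ?(lrmorph1 G) ?GE //=.
  by rewrite scalerA divff // scale1r.
Qed.

End QuantumDeformation.

Lemma uq_sl2_deformation (K : fieldType) (q : K) (A : comAlgType K) (x y z z' : A)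
    (P : poisson A) :
  2%:R != 0 :> K -> q != 0 -> q ^+ 2 != 1 -> laurent_in x y z z' ->
  P x y = 2%:R * (z - z') -> P y z = 2%:R * z * y -> P z x = 2%:R * z * x ->
  is_deformation P (uq_sl2 q).
Proof.
move=> two_neq0 q_neq0 q2_neq1 xyz Pxy Pyz Pzx.
have [T [t [T_gen T_rels T_lift]]] := presented_exists (@qsl2_rels_natural K) (@qsl2_rels0 K).
have [U_gen U_rels U_lift] := @presented_quotient K _ (uq_rels q) (@uq_rels_natural K q) _ _
  (@uq_rel_char K q).
exact: (uq_sl2_deformation_subproof two_neq0 q_neq0 q2_neq1 xyz Pxy Pyz Pzx T_gen T_rels
  T_lift U_gen U_rels U_lift).
Qed.

Lemma ord5P (P : 'I_5 -> Prop) : P 0 -> P 1 -> P 2%R -> P 3%R -> P 4%R -> forall i, P i.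
Proof.
by move=> P0 P1 P2 P3 P4 [[|[|[|[|[|//]]]]] p];
  [move: P0 | move: P1 | move: P2 | move: P3 | move: P4]; congr P; apply: val_inj.
Qed.

(** * A basis of U'_q(so_3) with q an indeterminate *)

Section CyclicSo3.
Variable K : fieldType.

(* U'_q(so_3) with q replaced by a central indeterminate Q. *)
Definition cso3_rels (T : algType K) (c : 'I_5 -> T) : seq T :=
  let Q := c 0 in let Q' := c 1 in let x := c 2%R in let y := c 3%R in let z := c 4%R in
  [:: Q * Q' - 1; Q' * Q - 1; Q * x - x * Q; Q * y - y * Q; Q * z - z * Q;
      x * y - Q * (y * x) - (z - Q * (Q * z));
      y * z - Q * (z * y) - (Q' * x - Q * x);
      z * x - Q * (x * z) - (Q' * y - Q * y)].

Lemma cso3_rels_natural (T U : algType K) (f : {lrmorphism T -> U}) (c : 'I_5 -> T) :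
  map f (cso3_rels c) = cso3_rels (fun i => f (c i)).
Proof. by rewrite /= !lrmorphE. Qed.

Lemma cso3_rels0 : all_zero (cso3_rels (fun i : 'I_5 => (i < 2)%N%:R : K^o)).
Proof. by rewrite /= !(mulr0, mul0r, mulr1, subrr). Qed.

Let I : choiceType := (nat * nat * nat * int)%type.
Let V := malg_free_module K I.
Let b (j i n : nat) (l : int) : V := fm_basis V (j, i, n, l).

Definition cso3_Q := fm_reindex V (fun m : I => (m.1.1.1, m.1.1.2, m.1.2, m.2 + 1)).
Definition cso3_Q' := fm_reindex V (fun m : I => (m.1.1.1, m.1.1.2, m.1.2, m.2 - 1)).
Definition cso3_y := fm_reindex V (fun m : I => (m.1.1.1.+1, m.1.1.2, m.1.2, m.2)).
Local Notation Q := cso3_Q.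
Local Notation Q' := cso3_Q'.
Local Notation y := cso3_y.

Lemma cso3_Q_basis j i n l : Q (b j i n l) = b j i n (l + 1).
Proof. exact: fm_reindex_basis. Qed.
Lemma cso3_Q'_basis j i n l : Q' (b j i n l) = b j i n (l - 1).
Proof. exact: fm_reindex_basis. Qed.
Lemma cso3_y_basis j i n l : y (b j i n l) = b j.+1 i n l.
Proof. exact: fm_reindex_basis. Qed.

Lemma cso3_QK v : Q (Q' v) = v.
Proof. by apply: fm_reindexK => -[[[j i] n] l] /=; rewrite subrK. Qed.
Lemma cso3_QK' v : Q' (Q v) = v.
Proof. by apply: fm_reindexK => -[[[j i] n] l] /=; rewrite addrK. Qed.
Lemma cso3_yQ v : y (Q v) = Q (y v).
Proof. exact: fm_reindexC. Qed.
Lemma cso3_yQ' v : y (Q' v) = Q' (y v).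
Proof. exact: fm_reindexC. Qed.

(* The basis vector (j, i, n, l) stands for y^j H_i(x) z^n Q^l with H_i the
   q-Hermite polynomials x H_i = H_(i+1) + (1 - Q^(2i)) H_(i-1); at i = 0 the
   terms with index i.-1 cancel. *)
Fixpoint cso3_act_xz (j i n : nat) (l : int) : V * V :=
  if j is j'.+1 then
    let u := cso3_act_xz j' i n l in
    (Q (y u.1) + (u.2 - Q (Q u.2)), Q' (y u.2) - (Q' (Q' u.1) - u.1))
  else
    (b 0 i.+1 n l + (b 0 i.-1 n l - b 0 i.-1 n (l + i%:Z + i%:Z)),
     b 0 i n.+1 (l + i%:Z) + (b 1 i.-1 n (l - 1) - b 1 i.-1 n (l + i%:Z + i%:Z - 1))).

Definition cso3_x : {linear V -> V} :=
  fm_lift V (fun m : I => (cso3_act_xz m.1.1.1 m.1.1.2 m.1.2 m.2).1).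
(** At j = 0 this encodes z H_i = Q^i H_i z + (Q^-1 - Q^(2i-1)) y H_(i-1), the two-term formula for
    which the basis is chosen. *)
Definition cso3_z : {linear V -> V} :=
  fm_lift V (fun m : I => (cso3_act_xz m.1.1.1 m.1.1.2 m.1.2 m.2).2).
Local Notation x := cso3_x.
Local Notation z := cso3_z.

Lemma cso3_x_basis j i n l : x (b j i n l) = (cso3_act_xz j i n l).1.
Proof. exact: fm_lift_basis. Qed.
Lemma cso3_z_basis j i n l : z (b j i n l) = (cso3_act_xz j i n l).2.
Proof. exact: fm_lift_basis. Qed.

Lemma cso3_ext (W : lmodType K) (f g : {linear V -> W}) :
  (forall j i n l, f (b j i n l) = g (b j i n l)) -> f =1 g.
Proof. by move=> e; apply: fm_ext => -[[[j i] n] l]; apply: e. Qed.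

Lemma cso3_ext_y (W : lmodType K) (f g : {linear V -> W}) :
  (forall i n l, f (b 0 i n l) = g (b 0 i n l)) ->
  (forall v, f v = g v -> f (y v) = g (y v)) -> f =1 g.
Proof.
move=> e0 eS; apply: cso3_ext; elim=> [|j IH] i n l; first exact: e0.
by rewrite -cso3_y_basis; apply/eS/IH.
Qed.

Lemma cso3_x_y v : x (y v) = Q (y (x v)) + (z v - Q (Q (z v))).
Proof.
apply: (cso3_ext (f := x \o y) (g := (Q \o y \o x) \+ (z \- (Q \o Q \o z)))) => j i n l /=.
by rewrite cso3_y_basis !cso3_x_basis cso3_z_basis.
Qed.

Lemma cso3_z_y v : z (y v) = Q' (y (z v)) - (Q' (Q' (x v)) - x v).
Proof.
apply: (cso3_ext (f := z \o y) (g := (Q' \o y \o z) \- ((Q' \o Q' \o x) \- x))) => j i n l /=.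
by rewrite cso3_y_basis !cso3_z_basis cso3_x_basis.
Qed.

(** The actions of x and z are treated jointly, as moving either past y produces the other. *)
Lemma cso3_xz_Q v : x (Q v) = Q (x v) /\ z (Q v) = Q (z v).
Proof.
suff e j i n l : x (Q (b j i n l)) = Q (x (b j i n l)) /\
    z (Q (b j i n l)) = Q (z (b j i n l)).
  split.
    by apply: (cso3_ext (f := x \o Q) (g := Q \o x)) => j i n l; have [] := e j i n l.
  by apply: (cso3_ext (f := z \o Q) (g := Q \o z)) => j i n l; have [] := e j i n l.
elim: j => [|j [ex ez]].
  rewrite !cso3_Q_basis !cso3_x_basis !cso3_z_basis /= !(linE Q) !cso3_Q_basis.
  by split; congr (_ + (_ - _)); congr b; ring.
rewrite -!cso3_y_basis -!cso3_yQ !cso3_x_y !cso3_z_y ex ez.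
by rewrite !(linE Q) !cso3_yQ !cso3_QK' !cso3_QK.
Qed.

Lemma cso3_xQ v : x (Q v) = Q (x v). Proof. by have [] := cso3_xz_Q v. Qed.
Lemma cso3_zQ v : z (Q v) = Q (z v). Proof. by have [] := cso3_xz_Q v. Qed.
Lemma cso3_xQ' v : x (Q' v) = Q' (x v).
Proof. by rewrite -[x (Q' v)]cso3_QK' -cso3_xQ cso3_QK. Qed.
Lemma cso3_zQ' v : z (Q' v) = Q' (z v).
Proof. by rewrite -[z (Q' v)]cso3_QK' -cso3_zQ cso3_QK. Qed.

(** Unifies basis vectors whose exponents of Q are equal integers in different forms, so that [lmod]
    sees a single atom. *)
Ltac merge_basis :=
  repeat match goal with
  | |- context [b ?j ?i ?n ?e1] =>
    match goal with
    | |- context [b j i n ?e2] =>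
      tryif constr_eq e1 e2 then fail else
      (rewrite (_ : b j i n e2 = b j i n e1); last by congr b; rewrite ?intS; ring)
    end
  end.

(* The commutator of the third relation with y vanishes, so that it suffices to
   check the relation at j = 0. *)
Lemma cso3_zx v : z (x v) = Q (x (z v)) + (Q' (y v) - Q (y v)).
Proof.
apply: (cso3_ext_y (f := z \o x) (g := (Q \o x \o z) \+ ((Q' \o y) \- (Q \o y)))) =>
  [i n l|{}v e] /=; last first.
  have {}e : z (x v) = Q (x (z v)) + (Q' (y v) - Q (y v)) := e.
  rewrite cso3_x_y cso3_z_y !(linE z) !(linB x) !cso3_zQ !cso3_xQ' cso3_z_y.
  rewrite cso3_x_y e !(linE y) !(linE Q) !(linE Q').
  rewrite !(cso3_yQ, cso3_yQ', cso3_QK, cso3_QK', cso3_zQ, cso3_zQ', cso3_xQ, cso3_xQ').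
  rewrite ?(linE Q) ?(linE Q') ?(cso3_QK, cso3_QK').
  by lmod K (V : lmodType K).
rewrite cso3_x_basis cso3_z_basis /= !(linE z) !(linE x).
rewrite !cso3_x_basis !cso3_z_basis /= !(linE Q) ?(linE y).
case: i => [|i] /=.
  rewrite !(cso3_y_basis, cso3_Q_basis, cso3_Q'_basis) ?(linE Q).
  rewrite !(cso3_y_basis, cso3_Q_basis, cso3_Q'_basis).
  merge_basis.
  by lmod K (V : lmodType K).
rewrite !(cso3_y_basis, cso3_Q_basis, cso3_Q'_basis) ?(linE Q).
rewrite !(cso3_y_basis, cso3_Q_basis, cso3_Q'_basis).
merge_basis.
by lmod K (V : lmodType K).
Qed.

Lemma cso3_v0_neq0 : b 0 0 0 0 <> 0.
Proof.
move/(congr1 (fm_coord (0%N, 0%N, 0%N, 0 : int))); rewrite fm_coord0 fm_coord_basis eqxx.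
by apply/eqP; rewrite oner_eq0.
Qed.

Definition cso3_act (i : 'I_5) : endo cso3_v0_neq0 :=
  nth 0 [seq to_endo cso3_v0_neq0 f | f : {linear V -> V} <- [:: Q; Q'; x; y; z]] i.

Lemma cso3_act_rels : all_zero (cso3_rels cso3_act).
Proof.
have e0 (u v : V) : u = v -> u - v = 0 by move=> ->; rewrite subrr.
do 8?split=> //; apply: endoP => v;
  rewrite !(endo_funD, endo_funN, endo_funZ, endo_funM, endo_fun0, endo_fun1) !to_endoE.
- by rewrite cso3_QK subrr.
- by rewrite cso3_QK' subrr.
- by rewrite cso3_xQ subrr.
- by rewrite cso3_yQ subrr.
- by rewrite cso3_zQ subrr.
- by rewrite cso3_x_y addrAC addrK subrr.
- apply: e0; rewrite cso3_z_y !(linE Q) !cso3_QK.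
  by lmod K (V : lmodType K).
- by rewrite cso3_zx addrAC addrK subrr.
Qed.

Lemma cso3_Q_fixed0 v : Q v = v -> v = 0.
Proof.
apply: fm_reindex_fixed0.
  by move=> [[[i n] j] l] [[[i' n'] j'] l'] /= [-> -> -> /addIr ->].
move=> [[[i n] j] l] m m'.
have iterE r : iter r (fun m : I => (m.1.1.1, m.1.1.2, m.1.2, m.2 + 1)) (i, n, j, l)
    = (i, n, j, l + r%:Z).
  elim: r => [|r IH]; first by rewrite addr0.
  by rewrite iterS IH /= intS -addrA [1 + _]addrC.
by rewrite !iterE => -[/addrI [->]].
Qed.

Section Monomials.
Variables (T : algType K) (t : 'I_5 -> T).
Local Notation tQ := (t 0).
Local Notation tQ' := (t 1).
Local Notation tx := (t 2%R).
Local Notation ty := (t 3%R).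
Local Notation tz := (t 4%R).
Hypotheses (QQ' : tQ * tQ' = 1) (Q'Q : tQ' * tQ = 1) (Qc : forall u, tQ * u = u * tQ).
Hypothesis xy : tx * ty = tQ * (ty * tx) + (tz - tQ * (tQ * tz)).
Hypothesis zy : tz * ty = tQ' * (ty * tz) - (tQ' * (tQ' * tx) - tx).
Hypothesis zx : tz * tx = tQ * (tx * tz) + (tQ' * ty - tQ * ty).

(* The pair (H_i, H_(i-1)); the value 1 of H_(-1) is irrelevant, its coefficient in
   the recursion being 0. *)
Fixpoint q_hermite (i : nat) : T * T :=
  if i is i'.+1 then
    let p := q_hermite i' in
    (tx * p.1 - (p.2 - zpow tQ tQ' (i'%:Z + i'%:Z) * p.2), p.1)
  else (1, 1).

Lemma q_hermite_pred i : (q_hermite i).2 = (q_hermite i.-1).1.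
Proof. by case: i. Qed.

Definition cso3_monomial : {linear V -> T} := fm_lift V (fun m : I =>
  ty ^+ m.1.1.1 * ((q_hermite m.1.1.2).1 * (tz ^+ m.1.2 * zpow tQ tQ' m.2))).
Local Notation s := cso3_monomial.

Lemma cso3_monomial_basis j i n l :
  s (b j i n l) = ty ^+ j * ((q_hermite i).1 * (tz ^+ n * zpow tQ tQ' l)).
Proof. exact: fm_lift_basis. Qed.

Lemma cso3_monomial_y v : s (y v) = ty * s v.
Proof.
apply: (cso3_ext (f := s \o y) (g := mul_left ty \o s)) => j i n l /=.
by rewrite cso3_y_basis !cso3_monomial_basis /mul_left exprS -mulrA.
Qed.

Lemma cso3_monomial_Q v : s (Q v) = tQ * s v.
Proof.
apply: (cso3_ext (f := s \o Q) (g := mul_left tQ \o s)) => j i n l /=.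
by rewrite cso3_Q_basis !cso3_monomial_basis /mul_left -zpowS // [RHS]Qc -!mulrA -Qc.
Qed.

Lemma cso3_monomial_Q' v : s (Q' v) = tQ' * s v.
Proof. by rewrite -{2}[v]cso3_QK cso3_monomial_Q mulrA Q'Q mul1r. Qed.

Lemma zpow_central l u : zpow tQ tQ' l * u = u * zpow tQ tQ' l.
Proof. exact/esym/(zpow_comm QQ' Q'Q). Qed.

Lemma zpowD m l : zpow tQ tQ' m * zpow tQ tQ' l = zpow tQ tQ' (l + m).
Proof.
case: m => m; last rewrite NegzE; elim: m => [|m IH].
- by rewrite mul1r addr0.
- rewrite (_ : l + m.+1%:Z = l + m%:Z + 1); last by rewrite intS; ring.
  by rewrite -(zpowS QQ') -IH mulrA /= -exprS.
- by rewrite /= expr1 zpowB.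
- rewrite (_ : l - m.+2%:Z = l - m.+1%:Z - 1); last by rewrite [m.+2%:Z]intS; ring.
  by rewrite -(zpowB QQ' Q'Q) -IH mulrA /= -exprS.
Qed.

Fact cso3_monomial_x0 i n l : s (x (b 0 i n l)) = tx * s (b 0 i n l).
Proof.
rewrite cso3_x_basis /= !(linE s) !cso3_monomial_basis !mul1r /=.
rewrite -q_hermite_pred -(addrA l) -zpowD.
set P := zpow _ _ (_ + _); set H := (q_hermite i).1; set H' := (q_hermite i).2.
have Pc u : P * u = u * P by apply: zpow_central.
have -> : H' * (tz ^+ n * (P * zpow tQ tQ' l)) = P * H' * (tz ^+ n * zpow tQ tQ' l).
  by rewrite [tz ^+ n * _]mulrA -Pc -mulrA mulrA -Pc.
by rewrite !mulrBl !mulrA subrK.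
Qed.

(* By strong induction: z e_(i+1) = z x e_i - ... and the third relation
   expresses z x e_i through x z e_i. *)
Fact cso3_monomial_z0 i n l : s (z (b 0 i n l)) = tz * s (b 0 i n l).
Proof.
elim/ltn_ind: i n l => -[_|i IH] n l.
  rewrite cso3_z_basis /= !addr0 subrr addr0 !cso3_monomial_basis.
  by rewrite !mul1r exprS -mulrA.
have xz : s (x (z (b 0 i n l))) = tx * s (z (b 0 i n l)).
  rewrite cso3_z_basis /= !(linE x) !(linE s) cso3_monomial_x0.
  (* Moving x past the single y produces z acting at index i - 1, where the induction hypothesis
     applies. *)
  have xyb r : i != 0%N -> s (x (b 1 i.-1 n r)) = tx * s (b 1 i.-1 n r).
    case: i IH => [//|i] IH _.
    rewrite -(cso3_y_basis 0 i) cso3_x_y !(linE s) !cso3_monomial_Q !cso3_monomial_y.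
    by rewrite cso3_monomial_x0 !IH // [RHS]mulrA xy !(mulrDl, mulrN, mulNr) !mulrA.
  have [->|i0] := eqVneq i 0%N; first by rewrite /= !addr0 !subrr !addr0.
  by rewrite mulrDr mulrBr !xyb.
have ->: b 0 i.+1 n l = x (b 0 i n l) - (b 0 i.-1 n l - b 0 i.-1 n (l + i%:Z + i%:Z)).
  by rewrite cso3_x_basis /= addrK.
rewrite !(linE z) cso3_zx !(linE s) !cso3_monomial_Q !cso3_monomial_Q' !cso3_monomial_y xz.
have pred_lt : (i.-1 < i.+1)%N by rewrite ltnS leq_pred.
rewrite (IH i) // !(IH i.-1) // cso3_monomial_x0 !(mulrDr, mulrN, mulrDl, mulNr).
rewrite !mulrA zx !(mulrDl, mulNr) !mulrA.
by lmod K (T : lmodType K).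
Qed.

Lemma cso3_monomial_xz v : s (x v) = tx * s v /\ s (z v) = tz * s v.
Proof.
suff e j i n l : s (x (b j i n l)) = tx * s (b j i n l) /\
    s (z (b j i n l)) = tz * s (b j i n l).
  split.
    by apply: (cso3_ext (f := s \o x) (g := mul_left tx \o s)) => j i n l; have [] := e j i n l.
  by apply: (cso3_ext (f := s \o z) (g := mul_left tz \o s)) => j i n l; have [] := e j i n l.
elim: j => [|j [ex ez]]; first by split; [exact: cso3_monomial_x0 | exact: cso3_monomial_z0].
rewrite -!cso3_y_basis cso3_x_y cso3_z_y !(linE s) !cso3_monomial_Q !cso3_monomial_Q'.
rewrite !cso3_monomial_y ex ez !(mulrA tx) xy !(mulrA tz) zy.
by split; rewrite !(mulrDl, mulNr) !mulrA.
Qed.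

End Monomials.
End CyclicSo3.

Definition uq'_rels (K : fieldType) (q : K) (T : algType K) (c : 'I_3 -> T) : seq T :=
  let x := c 0 in let y := c 1 in let z := c 2%R in
  [:: x * y - q *: (y * x) - (1 - q ^+ 2) *: z; y * z - q *: (z * y) - (q^-1 - q) *: x;
      z * x - q *: (x * z) - (q^-1 - q) *: y].

Lemma uq'_rels_natural (K : fieldType) (q : K) (T U : algType K) (f : {lrmorphism T -> U})
    (c : 'I_3 -> T) :
  map f (uq'_rels q c) = uq'_rels q (fun i => f (c i)).
Proof. by rewrite /= !lrmorphE. Qed.

(** * U'_q(so_3) as a deformation *)

Section CyclicDeformation.
Variables (K : fieldType) (q : K) (A : comAlgType K) (x y z : A) (P : poisson A).
Hypothesis q_neq0 : q != 0.
Hypothesis xyz : polynomial_in x y z.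
Hypothesis Pxy : P x y = x * y - 2%:R * z.
Hypothesis Pyz : P y z = y * z - 2%:R * x.
Hypothesis Pzx : P z x = z * x - 2%:R * y.

Variables (T : algType K) (t : 'I_5 -> T).
Hypothesis T_gen : generates t.
Hypothesis T_rels : all_zero (cso3_rels t).
Hypothesis T_lift : forall (B : algType K) (c : 'I_5 -> B), all_zero (cso3_rels c) ->
  exists g : {lrmorphism T -> B}, forall i, g (t i) = c i.
Local Notation Q := (t 0).
Local Notation Q' := (t 1).
Local Notation X := (t 2%R).
Local Notation Y := (t 3%R).
Local Notation Z := (t 4%R).
(** In T one has [X, Y] = h (Y X - (1 + Q) Z), and the second factor becomes x y - 2 z at Q = 1; the
    other two commutators are similar. *)
Local Notation h := (Q - 1).

Variables (U : algType K) (u : 'I_3 -> U).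
Hypothesis U_gen : generates u.
Hypothesis U_rels : all_zero (uq'_rels q u).
Hypothesis U_lift : forall (B : algType K) (c : 'I_3 -> B), all_zero (uq'_rels q c) ->
  exists g : {lrmorphism U -> B}, forall i, g (u i) = c i.

Let eq0 (V : zmodType) (a b : V) : a - b = 0 -> a = b.
Proof. by move/eqP; rewrite subr_eq0 => /eqP. Qed.

Let eq1 (V : zmodType) (a b c : V) : a - b - c = 0 -> a = b + c.
Proof. by move=> e; apply: eq0; rewrite opprD addrA. Qed.

Fact cso3_units : Q * Q' = 1 /\ Q' * Q = 1.
Proof. by have [r1 [r2 _]] := T_rels; split; [exact: eq0 r1|exact: eq0 r2]. Qed.

Lemma cso3_Q_central : is_central Q.
Proof.
have [QQ' Q'Q] := cso3_units; have [_ [_ [r1 [r2 [r3 _]]]]] := T_rels.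
apply: (is_central_gen T_gen); apply: ord5P => //.
- by rewrite QQ' Q'Q.
- exact: eq0 r1.
- exact: eq0 r2.
- exact: eq0 r3.
Qed.

Lemma cso3_Q'_central : is_central Q'.
Proof.
have [QQ' Q'Q] := cso3_units => v.
by rewrite -[v in LHS]mulr1 -QQ' [v * (Q * _)]mulrA -cso3_Q_central !mulrA Q'Q mul1r.
Qed.

Fact cso3_relations : [/\ X * Y = Q * (Y * X) + (Z - Q * (Q * Z)),
  Y * Z = Q * (Z * Y) + (Q' * X - Q * X) & Z * X = Q * (X * Z) + (Q' * Y - Q * Y)].
Proof.
have [_ [_ [_ [_ [_ [r1 [r2 [r3 _]]]]]]]] := T_rels.
by split; [exact: eq1 r1|exact: eq1 r2|exact: eq1 r3].
Qed.

Lemma cso3_h_central : is_central h.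
Proof. by move=> v; rewrite mulrBl mulrBr mul1r mulr1 cso3_Q_central. Qed.

Lemma cso3_h_regular v : h * v = 0 -> v = 0.
Proof.
have [QQ' Q'Q] := cso3_units; have [XY YZ ZX] := cso3_relations.
have Qc := cso3_Q_central.
have ZY : Z * Y = Q' * (Y * Z) - (Q' * (Q' * X) - X).
  rewrite YZ mulrDr !mulrBr !(mulrA Q' Q) Q'Q !mul1r.
  by rewrite addrK.
have [rho rhoE] := T_lift (cso3_act_rels K).
apply: (@regular_of_module K T _ t T_gen _ _ _ rho (cso3_monomial t)).
- by rewrite cso3_monomial_basis !mul1r.
- move=> i w; rewrite rhoE; move: i; apply: ord5P; rewrite /cso3_act /= to_endoE.
  + exact: cso3_monomial_Q.
  + exact: cso3_monomial_Q'.
  + by have [] := cso3_monomial_xz QQ' Q'Q Qc XY ZY ZX w.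
  + exact: cso3_monomial_y.
  + by have [] := cso3_monomial_xz QQ' Q'Q Qc XY ZY ZX w.
- move=> w; rewrite (lrmorphB rho) (lrmorph1 rho) rhoE.
  rewrite endo_funD endo_funN endo_fun1 /cso3_act /= to_endoE => w0.
  exact/cso3_Q_fixed0/eq0.
Qed.

Lemma cso3_eval : exists f : {lrmorphism T -> A},
  [/\ f Q = 1 /\ f Q' = 1, f X = x, f Y = y & f Z = z].
Proof.
have [|f fE] := @T_lift A (fun i : 'I_5 => nth 0 [:: 1; 1; x; y; z] i).
  by rewrite /= !mul1r !mulr1 (mulrC y x) (mulrC z y) (mulrC x z) !subrr.
by exists f; split; rewrite ?fE.
Qed.

Local Notation xU := (u 0).
Local Notation yU := (u 1).
Local Notation zU := (u 2%R).

Fact uq'_relations : [/\ xU * yU = q *: (yU * xU) + (1 - q ^+ 2) *: zU,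
  yU * zU = q *: (zU * yU) + (q^-1 - q) *: xU & zU * xU = q *: (xU * zU) + (q^-1 - q) *: yU].
Proof.
have [r1 [r2 [r3 _]]] := U_rels.
by split; [exact: eq1 r1|exact: eq1 r2|exact: eq1 r3].
Qed.

Lemma cso3_specialize : exists phi : {lrmorphism T -> U},
  [/\ phi Q = q%:A /\ phi Q' = q^-1%:A, phi X = xU, phi Y = yU & phi Z = zU].
Proof.
have [xy yz zx] := uq'_relations.
have [|f fE] := @T_lift U (fun i : 'I_5 => nth 0 [:: q%:A; q^-1%:A; xU; yU; zU] i).
  rewrite /= !mulr_algl !mulr_algr xy yz zx !scalerA divff // mulVf // scale1r !subrr.
  by do 8?split=> //; lmod K (U : lmodType K).
by exists f; split; rewrite ?fE.
Qed.

Lemma uq'_so3_deformation_subproof : is_deformation P U.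
Proof.
have [f [[fQ fQ'] fX fY fZ]] := cso3_eval.
have [phi [[pQ pQ'] pX pY pZ]] := cso3_specialize.
have [QQ' Q'Q] := cso3_units.
have [XY YZ ZX] := cso3_relations.
have [A_gen A_lift] := xyz.
have f_h : f h = 0 by rewrite (lrmorphB f) fQ (lrmorph1 f) subrr.
have Q2 v : v - Q * (Q * v) = h * - (v + Q * v).
  by rewrite mulrN mulrDr !mulrBl !mul1r; lmod K (T : lmodType K).
have QQ'v v : Q' * v - Q * v = h * - (Q' * v + v).
  rewrite mulrN mulrDr !mulrBl !mul1r [Q * (Q' * v)]mulrA QQ' mul1r.
  by lmod K (T : lmodType K).
apply: (@is_deformation_intro K A P U T _ t h (q - 1) T_gen cso3_h_central
  cso3_h_regular f f_h _ _ _ phi).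
- apply: generatesW A_gen => S hS St; apply: ord3P => /=.
  + by rewrite -fX.
  + by rewrite -fY.
  + by rewrite -fZ.
- move=> B p ph0.
  have pQ1 : p Q = 1 by apply: eq0; rewrite -[RHS]ph0 (lrmorphB p) (lrmorph1 p).
  have pQ'1 : p Q' = 1 by rewrite -[LHS]mul1r -pQ1 -(lrmorphM p) QQ' (lrmorph1 p).
  have [g [gx gy gz]] := A_lift B (p X) (p Y) (p Z).
  exists g; apply: ord5P; rewrite ?fQ ?fQ' ?fX ?fY ?fZ ?pQ1 ?pQ'1 ?(lrmorph1 g) //.
- have Qc j : bracket_lift P h f Q (t j).
    apply: (@bracket_lift_central K T A P h f _ _ 1); last by rewrite fQ scale1r.
    exact: cso3_Q_central.
  have Q'c j : bracket_lift P h f Q' (t j).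
    apply: (@bracket_lift_central K T A P h f _ _ 1); last by rewrite fQ' scale1r.
    exact: cso3_Q'_central.
  have fE := (lrmorphN f, lrmorphM f, lrmorphD f, fQ, fQ', fX, fY, fZ).
  apply: bracket_lift_ordinal; apply: ord5P => // j; move: j; apply: ord5P => // _.
  + exists (Y * X - (Z + Q * Z)).
      by rewrite XY addrAC mulrDr -Q2 mulrBl mul1r.
    by rewrite !fE Pxy; ring.
  + apply: bracket_liftC; exists (X * Z - (Q' * Y + Y)).
      by rewrite ZX addrAC mulrDr -QQ'v mulrBl mul1r.
    by rewrite !fE Pzx; ring.
  + exists (Z * Y - (Q' * X + X)).
      by rewrite YZ addrAC mulrDr -QQ'v mulrBl mul1r.
    by rewrite !fE Pyz; ring.
- by rewrite (lrmorphB phi) pQ (lrmorph1 phi) scalerBl scale1r.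
- apply: generatesW U_gen => S hS St; apply: ord3P.
  + by rewrite -pX; apply: (St 2%R).
  + by rewrite -pY; apply: (St 3%R).
  + by rewrite -pZ; apply: (St 4%R).
- move=> B p ph.
  have p_Q : p Q = q%:A.
    by move/eqP: ph; rewrite (lrmorphB p) (lrmorph1 p) subr_eq scalerBl scale1r subrK => /eqP.
  have p_Q' : p Q' = q^-1%:A.
    have e : q *: p Q' = 1 by rewrite -mulr_algl -p_Q -(lrmorphM p) QQ' (lrmorph1 p).
    by rewrite -e scalerA mulVf ?scale1r.
  have [|G GE] := @U_lift B (fun i : 'I_3 => nth 0 [:: p X; p Y; p Z] i).
    rewrite /= -(lrmorphM p X) -(lrmorphM p Y Z) -(lrmorphM p Z X) XY YZ ZX.
    rewrite !(lrmorphD p) !(lrmorphN p) !(lrmorphM p) p_Q p_Q' !mulr_algl !scalerA.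
    by do 3?split=> //; lmod K (B : lmodType K).
  by exists G; apply: ord5P; rewrite ?pQ ?pQ' ?pX ?pY ?pZ ?(lrmorphZ G) ?(lrmorph1 G) ?GE.
Qed.

End CyclicDeformation.

Lemma uq'_so3_deformation (K : fieldType) (q : K) (A : comAlgType K) (x y z : A)
    (P : poisson A) :
  q != 0 -> polynomial_in x y z ->
  P x y = x * y - 2%:R * z -> P y z = y * z - 2%:R * x -> P z x = z * x - 2%:R * y ->
  is_deformation P (uq'_so3 q).
Proof.
move=> q_neq0 xyz Pxy Pyz Pzx.
have [T [t [T_gen T_rels T_lift]]] := presented_exists (@cso3_rels_natural K) (@cso3_rels0 K).
have [U_gen U_rels U_lift] := @presented_quotient K _ (uq'_rels q) (@uq'_rels_natural K q) _ _
  (@uq'_rel_char K q).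
exact: (uq'_so3_deformation_subproof q_neq0 xyz Pxy Pyz Pzx T_gen T_rels
  T_lift U_gen U_rels U_lift).
Qed.

(** * The isomorphism of sl_2 with so_3 *)

Section So3Elements.
Variable K : fieldType.

(** The matrix of the cross product with (a, b, c), so that commutators become cross products. *)
Definition so3_mx (a b c : K) : 'M[K]_3 := \matrix_(i, j)
  nth 0 (nth [::] [:: [:: 0; - c; b]; [:: c; 0; - a]; [:: - b; a; 0]] i) j.

Lemma so3_mx_trmx a b c : (so3_mx a b c)^T = - so3_mx a b c.
Proof.
by apply/matrixP; apply: ord3P; apply: ord3P; rewrite !mxE /= ?oppr0 ?opprK.
Qed.

Lemma so3_mx_surj (M : 'M[K]_3) : 2%:R != 0 :> K -> M^T = - M ->
  M = so3_mx (M 2%R 1) (M 0 2%R) (M 1 0).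
Proof.
move=> two_neq0 /matrixP Msym.
have Mji i j : M j i = - M i j by have := Msym i j; rewrite !mxE.
have Mii i : M i i = 0.
  have := Mji i i; move/eqP; rewrite -subr_eq0 opprK -mulr2n -mulr_natl mulf_eq0.
  by rewrite (negPf two_neq0) => /eqP.
apply/matrixP; apply: ord3P; apply: ord3P; rewrite !mxE /= ?Mii //; exact: Mji.
Qed.

Lemma so3_mx_commutator a b c a' b' c' :
  mx_commutator (so3_mx a b c) (so3_mx a' b' c') =
  so3_mx (b * c' - c * b') (c * a' - a * c') (a * b' - b * a').
Proof.
apply/matrixP; apply: ord3P; apply: ord3P; rewrite /mx_commutator !mxE
  !big_ord_recl !big_ord0 !mxE /=; ring.
Qed.

Fact so3_elt_subproof (a b c : K) : so3_mx a b c \in submodule_pred (so_submodule K 3).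
Proof. by rewrite submodule_predE; apply/asboolP; apply: so3_mx_trmx. Qed.

Definition so3_elt (a b c : K) : so K 3 :=
  (Sub (so3_mx a b c) (so3_elt_subproof a b c) : sub_lmod (so_submodule K 3)).

Definition so3_val (u : so K 3) : 'M[K]_3 := \val (u : sub_lmod (so_submodule K 3)).

Lemma so3_val_inj : injective so3_val.
Proof. exact: val_inj. Qed.

Lemma so3_valP k (u v : so K 3) : so3_val (k *: u + v) = k *: so3_val u + so3_val v.
Proof. exact: (val_sub_lmodP (N := so_submodule K 3)). Qed.

Lemma so3_val_elt a b c : so3_val (so3_elt a b c) = so3_mx a b c.
Proof. by []. Qed.

Lemma so3_val_br u v : so3_val (lie_br u v) = mx_commutator (so3_val u) (so3_val v).
Proof. by []. Qed.

Lemma so3_val_trmx u : (so3_val u)^T = - so3_val u.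
Proof.
by have := valP (u : sub_lmod (so_submodule K 3)); rewrite submodule_predE => /asboolP.
Qed.

(* With [L1, L2] = L3 and cyclically, the triple e = - (L1 + i L2),
   f = L1 - i L2, h = 2 i L3 satisfies the relations of sl2. *)
Lemma sl2_so3_iso (i : K) : 2%:R != 0 :> K -> i * i = -1 -> lie_iso (sl K 2) (so K 3).
Proof.
move=> two_neq0 ii.
pose F (u : sl K 2) : so K 3 := let M := sl2_val u in
  so3_elt (M 1 0 - M 0 1) (- i * (M 0 1 + M 1 0)) (2%:R * i * M 0 0).
pose G (v : so K 3) : sl K 2 := let N := so3_val v in
  sl2_elt (- (i * N 1 0) / 2%:R) ((i * N 0 2%R - N 2%R 1) / 2%:R)
    ((i * N 0 2%R + N 2%R 1) / 2%:R).
have FE p q r : F (sl2_elt p q r) = so3_elt (r - q) (- i * (q + r)) (2%:R * i * p).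
  by rewrite /F sl2_val_elt !sl2_mxE.
have F_lin : linear F.
  move=> k u v; apply: so3_val_inj; rewrite so3_valP !so3_val_elt linearP.
  by apply/matrixP; apply: ord3P; apply: ord3P; rewrite !mxE /=; ring.
pose F' : {linear sl K 2 -> so K 3} := HB.pack F (GRing.isLinear.Build K (sl K 2) (so K 3) _ F F_lin).
exists F'.
- exists G => [u|v].
  + rewrite -[F' u]/(F u); have [p [q [r ->]]] := sl2_eltP u.
    rewrite FE /G so3_val_elt !mxE /=; congr sl2_elt.
    * have -> : i * (2%:R * i * p) = (i * i) * (2%:R * p) by ring.
      by rewrite ii; field.
    * have -> : i * (- i * (q + r)) = - (i * i) * (q + r) by ring.
      by rewrite ii; field.
    * have -> : i * (- i * (q + r)) = - (i * i) * (q + r) by ring.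
      by rewrite ii; field.
  + rewrite -[F' _]/(F _) FE; apply: so3_val_inj; rewrite so3_val_elt.
    rewrite [RHS](so3_mx_surj two_neq0 (so3_val_trmx v)).
    congr so3_mx.
    * by field.
    * transitivity (- (i * i) * so3_val v 0 2%R); first by field.
      by rewrite ii opprK mul1r.
    * transitivity (- (i * i) * so3_val v 1 0); first by field.
      by rewrite ii opprK mul1r.
- move=> u v; rewrite -![F' _]/(F _).
  have [p [q [r ->]]] := sl2_eltP u; have [p' [q' [r' ->]]] := sl2_eltP v.
  rewrite sl2_elt_br !FE; apply: so3_val_inj.
  rewrite so3_val_br !so3_val_elt so3_mx_commutator; congr so3_mx; [ | by ring | by ring].
  transitivity (- (i * i) * (2%:R * (r * p' - p * r') - 2%:R * (p * q' - q * p'))); last by ring.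
  by rewrite ii; ring.
Qed.

End So3Elements.

(** * Homogeneity *)

(** Cramer's rule: [d] is the determinant of the coordinates of the three matrices, and each witness
    replaces one of its rows by (p, q, r). *)
Lemma sl2_mx_span (K : fieldType) p1 q1 r1 p2 q2 r2 p3 q3 r3 :
  let d := p1 * (q2 * r3 - r2 * q3) - q1 * (p2 * r3 - r2 * p3) + r1 * (p2 * q3 - q2 * p3) in
  d != 0 :> K ->
  let m1 := sl2_mx p1 q1 r1 in let m2 := sl2_mx p2 q2 r2 in let m3 := sl2_mx p3 q3 r3 in
  (forall M : 'M[K]_2, \tr M = 0 -> exists a b c : K, M = a *: m1 + b *: m2 + c *: m3) /\
  (forall a b c : K, a *: m1 + b *: m2 + c *: m3 = 0 -> [/\ a = 0, b = 0 & c = 0]).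
Proof.
move=> d d0 m1 m2 m3; split=> [M trM|a b c].
  rewrite (sl2_mx_surj trM); move: (M 0 0) (M 0 1) (M 1 0) => p q r.
  exists ((p * (q2 * r3 - r2 * q3) - q * (p2 * r3 - r2 * p3) + r * (p2 * q3 - q2 * p3)) / d).
  exists ((p1 * (q * r3 - r * q3) - q1 * (p * r3 - r * p3) + r1 * (p * q3 - q * p3)) / d).
  exists ((p1 * (q2 * r - r2 * q) - q1 * (p2 * r - r2 * p) + r1 * (p2 * q - q2 * p)) / d).
  by rewrite sl2_mx_comb; congr sl2_mx; rewrite /d; field; exact: d0.
rewrite sl2_mx_comb => /sl2_mx_eq0 [e1 e2 e3]; split; apply: (mulIf d0); rewrite mul0r /d.
- transitivity ((a * p1 + b * p2 + c * p3) * (q2 * r3 - r2 * q3)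
    - (a * q1 + b * q2 + c * q3) * (p2 * r3 - r2 * p3)
    + (a * r1 + b * r2 + c * r3) * (p2 * q3 - q2 * p3)); first by ring.
  by rewrite e1 e2 e3; ring.
- transitivity (p1 * ((a * q1 + b * q2 + c * q3) * r3 - (a * r1 + b * r2 + c * r3) * q3)
    - q1 * ((a * p1 + b * p2 + c * p3) * r3 - (a * r1 + b * r2 + c * r3) * p3)
    + r1 * ((a * p1 + b * p2 + c * p3) * q3 - (a * q1 + b * q2 + c * q3) * p3)); first by ring.
  by rewrite e1 e2 e3; ring.
- transitivity (p1 * (q2 * (a * r1 + b * r2 + c * r3) - r2 * (a * q1 + b * q2 + c * q3))
    - q1 * (p2 * (a * r1 + b * r2 + c * r3) - r2 * (a * p1 + b * p2 + c * p3))
    + r1 * (p2 * (a * q1 + b * q2 + c * q3) - q2 * (a * p1 + b * p2 + c * p3))); first by ring.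
  by rewrite e1 e2 e3; ring.
Qed.

(** * The three Poisson algebras *)

Section HomogeneousAlgebras.
Variables (K : numClosedFieldType) (A : comAlgType K) (x y z : A).
Hypothesis K_uncountable : forall f : nat -> K, exists x, forall n, f n <> x.
Hypothesis A_countable : countably_spanned A.
Variables D1 D2 D3 : {linear A -> A}.
Hypotheses (D1x : is_partial D1 x y z) (D2y : is_partial D2 y x z)
  (D3z : is_partial D3 z x y).
Hypothesis D12 : forall a, D2 (D1 a) = D1 (D2 a).
Hypothesis D13 : forall a, D3 (D1 a) = D1 (D3 a).
Hypothesis D23 : forall a, D3 (D2 a) = D2 (D3 a).
Hypothesis gen : generates3 x y z.

Let two_neq0 : 2%:R != 0 :> K. Proof. by rewrite pnatr_eq0. Qed.

Let Dnat (D : {linear A -> A}) n a : D (n%:R * a) = n%:R * D a.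
Proof. by rewrite !mulr_natl raddfMn. Qed.

Let D1der : is_derivation D1. Proof. by case: D1x. Qed.
Let D2der : is_derivation D2. Proof. by case: D2y. Qed.
Let D3der : is_derivation D3. Proof. by case: D3z. Qed.

(** The bracket is linear, that is, A is the symmetric algebra of sl_2 with the Kirillov-Kostant
    bracket, x, y, z being E, - F, - H / 2; the origin is the only zero. *)
Lemma sl2_homogeneous : polynomial_in x y z ->
  (forall a b c : K, exists ev : {lrmorphism A -> K | *%R}, [/\ ev x = a, ev y = b & ev z = c]) ->
  homogeneous_deformation x y z (2%:R * z) (- y) (- x) (z ^+ 2 - x * y)
    (env_alg (sl K 2)) 1.
Proof.
move=> xyz point.
have [ev [ex ey ez]] := point 0 0 0.
have [_ d1x d1y d1z] := D1x; have [_ d2y d2x d2z] := D2y; have [_ d3z d3x d3y] := D3z.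
have DE := (expr2, Dnat D1, Dnat D2, Dnat D3, linB D1, linB D2, linB D3, linN D1, linN D2, linN D3, D1der, D2der, D3der,
  d1x, d1y, d1z, d2x, d2y, d2z, d3x, d3y, d3z).
have evE' := (evN ev, evB ev, evD ev, evM ev, ev0 ev, ev1 ev, ev_nat ev, ex, ey, ez).
have [|span free] := @sl2_mx_span K 0 1 0 0 0 (-1) (- 2%:R^-1) 0 0.
  by rewrite [X in X != 0](_ : _ = 2%:R^-1) ?invr_eq0 //; field.
apply: (@homogeneous_deformation_intro K A x y z K_uncountable A_countable D1 D2 D3 D1x D2y
  D3z D12 D13 D23 gen _ _ (proj1 xyz) _ _ _ _ _ 1 _ (fun=> ev) (fun=> sl2_mx 0 1 0)
  (fun=> sl2_mx 0 0 (-1)) (fun=> sl2_mx (- 2%:R^-1) 0 0)).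
- by rewrite !DE; ring.
- by move=> _; rewrite !evE'; ring.
- by move=> _; rewrite !evE'; ring.
- by move=> _; rewrite !evE'; ring.
- by move=> _; rewrite !sl2_mx_trace.
- by move=> _; rewrite sl2_mx_commutator !DE !evE' sl2_mx_comb; congr sl2_mx; field.
- by move=> _; rewrite sl2_mx_commutator !DE !evE' sl2_mx_comb; congr sl2_mx; field.
- by move=> _; rewrite sl2_mx_commutator !DE !evE' sl2_mx_comb; congr sl2_mx; field.
- by move=> _; exact: span.
- by move=> _; exact: free.
- by move=> i j _; rewrite !ord1.
- move=> chi; rewrite (evM chi) (ev_nat chi) !(evN chi) => /eqP.
  rewrite mulf_eq0 (negPf two_neq0) /= => /eqP cz /eqP; rewrite oppr_eq0 => /eqP cy.
  by move/eqP; rewrite oppr_eq0 => /eqP cx; exists 0; rewrite cx cy cz ex ey ez.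
- by move=> _; rewrite !DE !evE'; split; ring.
- by move=> P [Pxy Pyz Pzx]; apply: (env_sl2_deformation two_neq0 xyz).
Qed.

Let der1 (D : {linear A -> A}) : is_derivation D -> D 1 = 0.
Proof.
move=> D_der; have /eqP := D_der 1 1.
by rewrite !mulr1 mul1r -subr_eq subrr eq_sym => /eqP.
Qed.

(** The zeros are x = y = 0, z = eps with eps^2 = 1. There the linearized brackets are [m1, m2] = 4
    m3, [m2, m3] = 2 eps m2, [m3, m1] = 2 eps m1, solved by m1 = E, m3 = eps H, m2 = 4 eps F. *)
Lemma uq_sl2_homogeneous (q : K) (z' : A) : q != 0 -> q ^+ 2 != 1 -> laurent_in x y z z' ->
  (forall a b c c' : K, c * c' = 1 ->
    exists ev : {lrmorphism A -> K | *%R}, [/\ ev x = a, ev y = b, ev z = c & ev z' = c']) ->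
  homogeneous_deformation x y z (2%:R * (z - z')) (2%:R * z * y) (2%:R * z * x)
    (x * y + z + z') (uq_sl2 q) 2.
Proof.
move=> q0 q21 xyz point; have [A_gen zz' _] := xyz.
pose eps (i : 'I_2) : K := (-1) ^+ i.
have eps2 i : eps i * eps i = 1 by rewrite -expr2 sqrr_sign.
have eps0 i : eps i != 0 by rewrite signr_eq0.
have [ev evP] := choice (fun i => point 0 0 (eps i) (eps i) (eps2 i)).
have ex i : ev i x = 0 by have [] := evP i.
have ey i : ev i y = 0 by have [] := evP i.
have ez i : ev i z = eps i by have [] := evP i.
have ez' i : ev i z' = eps i by have [] := evP i.
have [_ d1x d1y d1z] := D1x; have [_ d2y d2x d2z] := D2y; have [_ d3z d3x d3y] := D3z.
have dz' (D : {linear A -> A}) : is_derivation D -> D z' = - (z' * z' * D z).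
  move=> D_der; have e : D z * z' + z * D z' = 0 by rewrite -D_der zz' der1.
  transitivity (z' * (D z * z' + z * D z') - (z * z' - 1) * D z' - z' * z' * D z).
    by ring.
  by rewrite e zz' subrr mulr0 mul0r subrr sub0r.
have DE := (Dnat D1, Dnat D2, Dnat D3, linB D1, linB D2, linB D3, linD D1, linD D2, linD D3, dz' _ D1der,
  dz' _ D2der, dz' _ D3der,
  D1der, D2der, D3der, d1x, d1y, d1z, d2x, d2y, d2z, d3x, d3y, d3z, linN D1, linN D2, linN D3).
have DnatR (D : {linear A -> A}) n : is_derivation D -> D n%:R = 0.
  by move=> D_der; rewrite raddfMn /= der1 // mul0rn.
have DE2 := (DE, DnatR D1 2 D1der, DnatR D2 2 D2der, DnatR D3 2 D3der).
pose evE' i := (evN (ev i), evB (ev i), evD (ev i), evM (ev i), ev0 (ev i), ev1 (ev i),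
  ev_nat (ev i), ex i, ey i, ez i, ez' i).
have mE i := @sl2_mx_span K 0 1 0 0 0 (4%:R * eps i) (eps i) 0 0.
have det0 i : 0 * (0 * 0 - (4%:R * eps i) * 0) - 1 * (0 * 0 - (4%:R * eps i) * eps i)
    + 0 * (0 * 0 - 0 * eps i) != 0 :> K.
  rewrite [X in X != 0](_ : _ = 4%:R * (eps i * eps i)); last by ring.
  by rewrite eps2 mulr1 pnatr_eq0.
apply: (@homogeneous_deformation_intro K A x y z K_uncountable A_countable D1 D2 D3 D1x D2y
  D3z D12 D13 D23 gen _ _ A_gen _ _ _ _ _ 2 _ ev (fun=> sl2_mx 0 1 0)
  (fun i => sl2_mx 0 0 (4%:R * eps i)) (fun i => sl2_mx (eps i) 0 0)).
- by rewrite !DE2; ring.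
- by move=> i; rewrite !(evE' i); ring.
- by move=> i; rewrite !(evE' i); ring.
- by move=> i; rewrite !(evE' i); ring.
- by move=> i; rewrite !sl2_mx_trace.
- move=> i; rewrite sl2_mx_commutator !DE2 !(evE' i) sl2_mx_comb eps2.
  by congr sl2_mx; ring.
- move=> i; rewrite sl2_mx_commutator !DE2 !(evE' i) sl2_mx_comb.
  by congr sl2_mx; ring.
- move=> i; rewrite sl2_mx_commutator !DE2 !(evE' i) sl2_mx_comb.
  by congr sl2_mx; ring.
- by move=> i; have [] := mE i (det0 i).
- by move=> i; have [] := mE i (det0 i).
- move=> i j /(_ z); rewrite !ez /eps.
  case: i j => [[|[|//]] p] [[|[|//]] p'] /=; rewrite ?expr0 ?expr1 => e; apply: val_inj => //=.
  + by move/eqP: e; rewrite eq_sym eqNr oner_eq0.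
  + by move/eqP: e; rewrite eqNr oner_eq0.
- move=> chi; rewrite !(evM chi) (ev_nat chi) (evB chi) => /eqP.
  rewrite mulf_eq0 (negPf two_neq0) subr_eq0 /= => /eqP czz'.
  have cz2 : chi z * chi z = 1 by rewrite {2}czz' -(evM chi) zz' (ev1 chi).
  have cz0 : chi z != 0 by apply/eqP => e; move/eqP: cz2; rewrite e mul0r eq_sym oner_eq0.
  move=> /eqP; rewrite !mulf_eq0 (negPf two_neq0) (negPf cz0) /= => /eqP cy.
  move=> /eqP; rewrite !mulf_eq0 (negPf two_neq0) (negPf cz0) /= => /eqP cx.
  have : chi z ^+ 2 == 1 by rewrite expr2 cz2.
  rewrite sqrf_eq1 => /orP [/eqP cz|/eqP cz].
    by exists 0; rewrite ex ey ez cx cy cz /eps expr0.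
  by exists 1; rewrite ex ey ez cx cy cz /eps expr1.
- move=> i; rewrite !DE2 !(evE' i) eps2; split; ring.
- by move=> P [Pxy Pyz Pzx]; apply: (uq_sl2_deformation two_neq0 q0 q21 xyz).
Qed.

(** Halving the coordinates turns the vanishing of the brackets into a b = c, b c = a, c a = b,
    whose solutions are 0 and the four sign triples of product 1; [s1], [s2], [s3] list them. *)
Lemma uq'_so3_homogeneous (q : K) : q != 0 -> polynomial_in x y z ->
  (forall a b c : K, exists ev : {lrmorphism A -> K | *%R}, [/\ ev x = a, ev y = b & ev z = c]) ->
  homogeneous_deformation x y z (x * y - 2%:R * z) (y * z - 2%:R * x) (z * x - 2%:R * y)
    (x * y * z - x ^+ 2 - y ^+ 2 - z ^+ 2 + 4%:R) (uq'_so3 q) 5.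
Proof.
move=> q0 xyz point.
pose s1 (i : 'I_5) : K := nth 0 [:: 0; 1; 1; -1; -1] i.
pose s2 (i : 'I_5) : K := nth 0 [:: 0; 1; -1; 1; -1] i.
pose s3 (i : 'I_5) : K := nth 0 [:: 0; 1; -1; -1; 1] i.
have [ev evP] := choice (fun i => point (2%:R * s1 i) (2%:R * s2 i) (2%:R * s3 i)).
have ex i : ev i x = 2%:R * s1 i by have [] := evP i.
have ey i : ev i y = 2%:R * s2 i by have [] := evP i.
have ez i : ev i z = 2%:R * s3 i by have [] := evP i.
have [_ d1x d1y d1z] := D1x; have [_ d2y d2x d2z] := D2y; have [_ d3z d3x d3y] := D3z.
have DnatR (D : {linear A -> A}) n : is_derivation D -> D n%:R = 0.
  by move=> D_der; rewrite raddfMn /= der1 // mul0rn.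
have DE := (expr2, Dnat D1, Dnat D2, Dnat D3, linB D1, linB D2, linB D3, linD D1, linD D2, linD D3,
  D1der, D2der, D3der, d1x, d1y, d1z, d2x, d2y, d2z, d3x, d3y, d3z, linN D1, linN D2, linN D3,
  DnatR D1 4 D1der, DnatR D2 4 D2der, DnatR D3 4 D3der).
pose evE' i := (evN (ev i), evB (ev i), evD (ev i), evM (ev i), ev0 (ev i), ev1 (ev i),
  ev_nat (ev i), ex i, ey i, ez i).
pose im : K := 'i%R.
have im2 : im * im = -1 by rewrite -expr2 sqrCi.
(* At the origin the linearized brackets are [m1, m2] = - 2 m3 and cyclically, a rescaled so_3,
   whence a square root of - 1. Elsewhere [m1, m2] = 2 (s2 m1 + s1 m2 - m3): with m1 = s1 E and m2 a
   multiple of s2 F this determines m3, and the bracket of m2 and m3 then forces the factor - 4. *)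
pose m1 (i : 'I_5) := if i == 0 then sl2_mx 0 (2%:R^-1) (- 2%:R) else sl2_mx 0 (s1 i) 0.
pose m2 (i : 'I_5) := if i == 0 then sl2_mx 0 (- im / 2%:R) (- (2%:R * im))
  else sl2_mx 0 0 (- (4%:R * s2 i)).
pose m3 (i : 'I_5) := if i == 0 then sl2_mx im 0 0
  else sl2_mx (2%:R * s3 i) (s3 i) (- (4%:R * s3 i)).
have im_neq0 : im != 0 by apply/eqP => e; move/eqP: im2; rewrite e mul0r eq_sym oppr_eq0 oner_eq0.
have span i : (forall M : 'M[K]_2, \tr M = 0 ->
      exists a b c : K, M = a *: m1 i + b *: m2 i + c *: m3 i) /\
    (forall a b c : K, a *: m1 i + b *: m2 i + c *: m3 i = 0 -> [/\ a = 0, b = 0 & c = 0]).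
  move: i; apply: ord5P; rewrite /m1 /m2 /m3 /s1 /s2 /s3 /=; apply: sl2_mx_span.
  - rewrite [X in X != 0](_ : _ = 2%:R * (- (im * im))); last by field.
    by rewrite im2 opprK mulr1.
  - by rewrite [X in X != 0](_ : _ = - 8%:R) ?oppr_eq0 ?pnatr_eq0 //; ring.
  - by rewrite [X in X != 0](_ : _ = - 8%:R) ?oppr_eq0 ?pnatr_eq0 //; ring.
  - by rewrite [X in X != 0](_ : _ = - 8%:R) ?oppr_eq0 ?pnatr_eq0 //; ring.
  - by rewrite [X in X != 0](_ : _ = - 8%:R) ?oppr_eq0 ?pnatr_eq0 //; ring.
apply: (@homogeneous_deformation_intro K A x y z K_uncountable A_countable D1 D2 D3 D1x D2y
  D3z D12 D13 D23 gen _ _ (proj1 xyz) _ _ _ _ _ 5 _ ev m1 m2 m3).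
- by rewrite !DE; ring.
- by move=> i; rewrite !(evE' i); move: i; apply: ord5P; rewrite /s1 /s2 /s3 /=; ring.
- by move=> i; rewrite !(evE' i); move: i; apply: ord5P; rewrite /s1 /s2 /s3 /=; ring.
- by move=> i; rewrite !(evE' i); move: i; apply: ord5P; rewrite /s1 /s2 /s3 /=; ring.
- by apply: ord5P; rewrite /m1 /m2 /m3 /= !sl2_mx_trace.
- move=> i; rewrite !DE !(evE' i); move: i; apply: ord5P; rewrite /m1 /m2 /m3 /s1 /s2 /s3 /=;
    rewrite sl2_mx_commutator sl2_mx_comb; congr sl2_mx; by field.
- move=> i; rewrite !DE !(evE' i); move: i; apply: ord5P; rewrite /m1 /m2 /m3 /s1 /s2 /s3 /=;
    rewrite sl2_mx_commutator sl2_mx_comb; congr sl2_mx; try by field.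
  + transitivity (im * im); first by field.
    by rewrite im2; field.
  + transitivity (- (4%:R * (im * im))); first by field.
    by rewrite im2; field.
- move=> i; rewrite !DE !(evE' i); move: i; apply: ord5P; rewrite /m1 /m2 /m3 /s1 /s2 /s3 /=;
    rewrite sl2_mx_commutator sl2_mx_comb; congr sl2_mx; by field.
- by move=> i; have [] := span i.
- by move=> i; have [] := span i.
- move=> i j e.
  (* The integer s1 + 2 s2 + 4 s3 takes five different values on the five points and so separates
     them. *)
  pose v (i : 'I_5) : int := nth 0 [:: 0; 7; -5; -3; 1] i.
  have vE (k : 'I_5) : s1 k + 2%:R * s2 k + 4%:R * s3 k = (v k)%:~R.
    by move: k; apply: ord5P; rewrite /s1 /s2 /s3 /v /=; ring.
  have : v i = v j.
    apply: (@intr_inj K); rewrite -!vE; apply: (mulfI two_neq0).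
    move: (e x) (e y) (e z); rewrite !ex !ey !ez => ex' ey' ez'.
    by rewrite !mulrDr ex' (mulrCA _ _ (s2 i)) ey' (mulrCA _ _ (s3 i)) ez' !(mulrCA 2%:R 2%:R) (mulrCA 2%:R 4%:R).
  by move: i j {e}; apply: ord5P; apply: ord5P.
- move=> chi; rewrite !(evB chi) !(evM chi) (ev_nat chi).
  have [a [b [c [-> -> ->]]]] : exists a b c, [/\ chi x = 2%:R * a, chi y = 2%:R * b & chi z = 2%:R * c].
    have half u : u = 2%:R * (u / 2%:R) :> K by rewrite mulrC divfK.
    by exists (chi x / 2%:R), (chi y / 2%:R), (chi z / 2%:R); split; apply: half.
  have mul0 (k e : K) : k != 0 -> k * e = 0 -> e = 0.
    by move=> /negPf k0 /eqP; rewrite mulf_eq0 k0 => /eqP.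
  have red (u v w : K) : 2%:R * u * (2%:R * v) - 2%:R * (2%:R * w) = 0 -> u * v = w :> K.
    move=> e; apply/eqP; rewrite -subr_eq0; apply/eqP/(mul0 4%:R); first by rewrite pnatr_eq0.
    by rewrite -e; ring.
  move=> /red ab /red bc /red ca.
  have [a0|a0] := eqVneq a 0.
    have c0 : c = 0 by rewrite -ab a0 mul0r.
    have b0 : b = 0 by rewrite -ca c0 mul0r.
    by exists 0; rewrite ex ey ez /s1 /s2 /s3 /= a0 b0 c0.
  have b2 : b ^+ 2 == 1.
    rewrite -subr_eq0; apply/eqP/(mul0 a) => //.
    by rewrite (_ : a * _ = a * b * b - a); [rewrite ab (mulrC c) bc subrr | ring].
  have b0 : b != 0.
    by apply/eqP => e; move: b2; rewrite e expr0n /= eq_sym oner_eq0.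
  have a2 : a ^+ 2 == 1.
    rewrite -subr_eq0; apply/eqP/(mul0 b) => //.
    by rewrite (_ : b * _ = a * b * a - b); [rewrite ab ca subrr | ring].
  move: a2 b2; rewrite !sqrf_eq1 => /orP [] /eqP aE /orP [] /eqP bE; rewrite -ab aE bE.
  + by exists 1; rewrite ex ey ez /s1 /s2 /s3 /=; split; ring.
  + by exists 2%R; rewrite ex ey ez /s1 /s2 /s3 /=; split; ring.
  + by exists 3%R; rewrite ex ey ez /s1 /s2 /s3 /=; split; ring.
  + by exists 4%R; rewrite ex ey ez /s1 /s2 /s3 /=; split; ring.
- by move=> i; rewrite !(DE, der1 D1der, der1 D2der, der1 D3der) !(evE' i); move: i; apply: ord5P;
    rewrite /s1 /s2 /s3 /=; split; ring.
- by move=> P [Pxy Pyz Pzx]; apply: (uq'_so3_deformation q0 xyz).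
Qed.

End HomogeneousAlgebras.

(** The complex numbers enter only as a numerically closed field that is uncountable, the latter for
    the residue fields. *)
Lemma homogeneous_deformations (K : numClosedFieldType)
    (K_uncountable : forall f : nat -> K, exists x, forall n, f n <> x)
    (q : K) (q_neq0 : q != 0) (q2_neq1 : q ^+ 2 != 1) :
  [/\ alg_iso (env_alg (sl K 2)) (env_alg (so K 3)),
      let x := mvar K (0 : 'I_3) in
      let y := mvar K (1 : 'I_3) in
      let z := mvar K (2 : 'I_3) in
      homogeneous_deformation x y z
        (2%:R * z) (- y) (- x)
        (z ^+ 2 - x * y)
        (env_alg (sl K 2)) 1,
      let x := lvar K 0 in
      let y := lvar K 1 in
      let z := lvar K 2 in
      let z' := lvar K 3 in
      homogeneous_deformation x y z
        (2%:R * (z - z')) (2%:R * z * y) (2%:R * z * x)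
        (x * y + z + z')
        (uq_sl2 (q : K)) 2 &
      let x := mvar K (0 : 'I_3) in
      let y := mvar K (1 : 'I_3) in
      let z := mvar K (2 : 'I_3) in
      homogeneous_deformation x y z
        (x * y - 2%:R * z) (y * z - 2%:R * x) (z * x - 2%:R * y)
        (x * y * z - x ^+ 2 - y ^+ 2 - z ^+ 2 + 4%:R)
        (uq'_so3 (q : K)) 5].
Proof.
have two_neq0 : 2%:R != 0 :> K by rewrite pnatr_eq0.
have point3 (a b c : K) : exists ev : {lrmorphism mpoly 3 K -> K | *%R},
    [/\ ev (mvar K 0) = a, ev (mvar K 1) = b & ev (mvar K (2 : 'I_3)) = c].
  have [ev evE] := mpoly_character (fun i : 'I_3 => nth 0 [:: a; b; c] i).
  by exists ev; rewrite !evE.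
have point4 (a b c c' : K) : c * c' = 1 -> exists ev : {lrmorphism laurent3 K -> K | *%R},
    [/\ ev (lvar K 0) = a, ev (lvar K 1) = b, ev (lvar K 2) = c & ev (lvar K 3) = c'].
  move=> cc'; have [ev evE] := @laurent_character K (fun i : 'I_4 => nth 0 [:: a; b; c; c'] i) cc'.
  by exists ev; rewrite !evE.
have D1 : is_partial (mderiv 0 : {linear mpoly 3 K -> mpoly 3 K}) (mvar K 0) (mvar K 1)
  (mvar K (2 : 'I_3)) by apply: mvar_partial.
have D2 : is_partial (mderiv 1 : {linear mpoly 3 K -> mpoly 3 K}) (mvar K 1) (mvar K 0)
  (mvar K (2 : 'I_3)) by apply: mvar_partial.
have D3 : is_partial (mderiv (2 : 'I_3) : {linear mpoly 3 K -> mpoly 3 K}) (mvar K (2 : 'I_3))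
  (mvar K 0) (mvar K 1) by apply: mvar_partial.
split.
- apply: env_alg_iso; apply: (@sl2_so3_iso K 'i%R) => //.
  by rewrite -expr2 sqrCi.
- apply: (sl2_homogeneous K_uncountable _ D1 D2 D3) => //.
  + exact: mpoly_countably_spanned.
  + by move=> a; apply: mderiv_comm.
  + by move=> a; apply: mderiv_comm.
  + by move=> a; apply: mderiv_comm.
  + exact: mpoly_generates3.
  + exact: mpoly_polynomial.
- apply: (uq_sl2_homogeneous K_uncountable _ (laurent_partial_x K) (laurent_partial_y K)
    (laurent_partial_z K)) => //.
  + exact/quot_countably_spanned/mpoly_countably_spanned.
  + exact: laurent_dyx.
  + exact: laurent_dzx.
  + exact: laurent_dzy.
  + exact: laurent_generates3.
  + exact: laurent3_laurent.
- apply: (uq'_so3_homogeneous K_uncountable _ D1 D2 D3) => //.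
  + exact: mpoly_countably_spanned.
  + by move=> a; apply: mderiv_comm.
  + by move=> a; apply: mderiv_comm.
  + by move=> a; apply: mderiv_comm.
  + exact: mpoly_generates3.
  + exact: mpoly_polynomial.
Qed.

Theorem mainTheorem3 (R : realType) (q : R[i]) (q_neq0 : q != 0)
    (q2_neq1 : q ^+ 2 != 1) :
  let C : fieldType := R[i] in
  [/\ alg_iso (env_alg (sl C 2)) (env_alg (so C 3)),
      let x := mvar C (0 : 'I_3) in
      let y := mvar C (1 : 'I_3) in
      let z := mvar C (2 : 'I_3) in
      homogeneous_deformation x y z
        (2%:R * z) (- y) (- x)
        (z ^+ 2 - x * y)
        (env_alg (sl C 2)) 1,
      let x := lvar C 0 in
      let y := lvar C 1 in
      let z := lvar C 2 in
      let z' := lvar C 3 in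
      homogeneous_deformation x y z
        (2%:R * (z - z')) (2%:R * z * y) (2%:R * z * x)
        (x * y + z + z')
        (uq_sl2 (q : C)) 2 &
      let x := mvar C (0 : 'I_3) in
      let y := mvar C (1 : 'I_3) in
      let z := mvar C (2 : 'I_3) in
      homogeneous_deformation x y z
        (x * y - 2%:R * z) (y * z - 2%:R * x) (z * x - 2%:R * y)
        (x * y * z - x ^+ 2 - y ^+ 2 - z ^+ 2 + 4%:R)
        (uq'_so3 (q : C)) 5].
Proof. exact: (homogeneous_deformations (@complex_uncountable R) q_neq0 q2_neq1). Qed.
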